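(* Let $(S^3,g_\epsilon)$, $\epsilon>0$, $\epsilon\neq 1$, be a three-dimensional Berger sphere. Then every one-dimensional metric foliation of $(S^3,g_\epsilon)$ is the orbit foliation of a globally defined isometric flow on $(S^3,g_\epsilon)$.
   Context: Berger spheres. Let $S^3=\{(z,w)\in\mathbb C^2 : z\bar z+w\bar w=1\}$ with canonical round metric $g_1$ induced from the Euclidean inner product on $\mathbb R^4$. Let $X_{(z,w)}=(iz,iw)$ be the unit $g_1$-Killing field generating the circle action $e^{i\theta}\cdot(z,w)=(e^{i\theta}z,e^{i\theta}w)$, let $\mathcal V$ be the line field spanned by $X$ and $\mathcal H$ its $g_1$-orthogonal distribution. For $\epsilon>0$, $g_\epsilon$ is the Riemannian metric on $S^3$ for which $\mathcal V$ and $\mathcal H$ are orthogonal, $g_\epsilon=\epsilon g_1$ on $\mathcal H$, and $g_\epsilon=\epsilon^2 g_1$ on $\mathcal V$. A Berger sphere is a Riemannian manifold $(S^3,g_\epsilon)$ with $\epsilon>0$, $\epsilon\ne1$. Foliations. A smooth one-dimensional foliation $\mathcal F$ (one-dimensional leaves) of a Riemannian manifold $(M,g)$ with Levi-Civita connection $\nabla$ is metric if its leaves are locally equidistant; equivalently, the orthogonal distribution $T\mathcal F^{\perp}$ is totally geodesic, meaning that whenever $X,Y$ are (local) sections of $T\mathcal F^\perp$, so is $\nabla_XY+\nabla_YX$. An isometric flow is a smooth $\mathbb R$-action by isometries (the flow of a Killing field); $\mathcal F$ is its orbit foliation if the leaves of $\mathcal F$ are the orbits of the flow. *)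

(* Defs.v *)
From HB Require Import structures.
From mathcomp Require Import all_boot all_order all_algebra.
From mathcomp Require Import all_classical all_reals all_analysis.

Set Implicit Arguments.
Unset Strict Implicit.
Unset Printing Implicit Defensive.

Import Order.TTheory GRing.Theory Num.Theory numFieldNormedType.Exports.

Local Open Scope classical_set_scope.
Local Open Scope ring_scope.

(* In finite dimension, existence and continuity of all iterated directional
   derivatives of order at most k is the usual notion of C^k on the open set
   U; only finite-dimensional V are used below. *)
Fixpoint Ck (R : realType) (V W : normedModType R) (k : nat) (U : set V)
    (f : V -> W) : Prop :=
  if k is k'.+1 then
    (forall x v, U x -> derivable f x v) /\
    (forall v, Ck k' U (fun x => 'D_v f x))
  else forall x, U x -> {for x, continuous f}.

Definition smooth_on (R : realType) (V W : normedModType R) (U : set V)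
  (f : V -> W) : Prop := forall k, Ck k U f.

Section BergerSphere.
Variable R : realType.

(* The point (x0, x1, x2, x3) stands for (z, w) = (x0 + i x1, x2 + i x3). *)
Local Notation R4 := 'rV[R]_4.

Definition dot (u v : R4) : R := \sum_i u 0 i * v 0 i.

Definition S3 : set R4 := [set x | dot x x = 1].

Definition tangent (p u : R4) : Prop := dot p u = 0.

(* (iz, iw) *)
Definition hopf (p : R4) : R4 :=
  \row_j [:: - p 0 1; p 0 0; - p 0 3%:R; p 0 2%:R]`_j.

Definition vert (p u : R4) : R4 := dot u (hopf p) *: hopf p.
Definition horiz (p u : R4) : R4 := u - vert p u.

Definition berger (eps : R) (p u v : R4) : R :=
  eps * dot (horiz p u) (horiz p v) + eps ^+ 2 * dot (vert p u) (vert p v).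

(* Calculus on S^3.  Maps on (open subsets of) S^3 are represented by maps on
   the ambient space whose values off the sphere are irrelevant.  The radial
   retraction r : R^4 \ {0} -> S^3 is a smooth submersion restricting to the
   identity on S^3, so that a map f on the sphere is smooth if and only if
   f \o r is, and the differential of f at p is that of f \o r, restricted to
   the tangent space at p.  Open subsets of S^3 are the traces on S^3 of open
   subsets U of R^4. *)
Definition retr (x : R4) : R4 := (Num.sqrt (dot x x))^-1 *: x.

Definition cone (U : set R4) : set R4 := [set x | x != 0 /\ U (retr x)].

Definition smooth_S3 (W : normedModType R) (U : set R4) (f : R4 -> W) : Prop :=
  smooth_on (cone U) (f \o retr).

Definition dS3 (W : normedModType R) (f : R4 -> W) (p u : R4) : W :=
  'D_u (f \o retr) p.

Definition vector_field (U : set R4) (X : R4 -> R4) : Prop :=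
  smooth_S3 U X /\ forall p, S3 p -> U p -> tangent p (X p).

Definition bracket (X Y : R4 -> R4) (p : R4) : R4 :=
  dS3 Y p (X p) - dS3 X p (Y p).

Record levi_civita (eps : R) (U : set R4)
    (nabla : (R4 -> R4) -> (R4 -> R4) -> R4 -> R4) : Prop := LeviCivita {
  lc_field : forall X Y, vector_field U X -> vector_field U Y ->
    vector_field U (nabla X Y);
  lc_addl : forall X X' Y, vector_field U X -> vector_field U X' ->
    vector_field U Y -> forall p, S3 p -> U p ->
    nabla (fun q => X q + X' q) Y p = nabla X Y p + nabla X' Y p;
  lc_scalel : forall (f : R4 -> R) X Y, smooth_S3 U f -> vector_field U X ->
    vector_field U Y -> forall p, S3 p -> U p ->
    nabla (fun q => f q *: X q) Y p = f p *: nabla X Y p;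
  lc_addr : forall X Y Y', vector_field U X -> vector_field U Y ->
    vector_field U Y' -> forall p, S3 p -> U p ->
    nabla X (fun q => Y q + Y' q) p = nabla X Y p + nabla X Y' p;
  lc_leibniz : forall (f : R4 -> R) X Y, smooth_S3 U f -> vector_field U X ->
    vector_field U Y -> forall p, S3 p -> U p ->
    nabla X (fun q => f q *: Y q) p = dS3 f p (X p) *: Y p + f p *: nabla X Y p;
  lc_torsion_free : forall X Y, vector_field U X -> vector_field U Y ->
    forall p, S3 p -> U p -> nabla X Y p - nabla Y X p = bracket X Y p;
  lc_metric : forall X Y Z, vector_field U X -> vector_field U Y ->
    vector_field U Z -> forall p, S3 p -> U p ->
    dS3 (fun q => berger eps q (Y q) (Z q)) p (X p)
    = berger eps p (nabla X Y p) (Z p) + berger eps p (Y p) (nabla X Z p) }.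

(* A one-dimensional foliation is given by its tangent distribution TF, a
   smooth line field (involutivity is automatic in rank one); its leaves are
   the maximal connected integral manifolds of TF. *)
Definition foliation (TF : R4 -> set R4) : Prop :=
  forall p, S3 p -> exists (U : set R4) (V : R4 -> R4),
    [/\ open U, U p, vector_field U V &
        forall q, S3 q -> U q -> V q <> 0 /\ TF q = [set c *: V q | c in setT]].

Definition leaf (TF : R4 -> set R4) (p : R4) : set R4 :=
  [set q | exists (a b : R) (c : R -> R4),
    [/\ smooth_on `]a, b[ c,
        forall t, a < t < b -> S3 (c t) /\ TF (c t) (derive1 c t) &
        exists s t, [/\ a < s < b, a < t < b, c s = p & c t = q]]].

Definition orthogonal (eps : R) (TF : R4 -> set R4) (p : R4) : set R4 :=
  [set u | tangent p u /\ forall v, TF p v -> berger eps p u v = 0].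

Definition section_of (E : R4 -> set R4) (U : set R4) (X : R4 -> R4) : Prop :=
  vector_field U X /\ forall p, S3 p -> U p -> E p (X p).

(* The Levi-Civita connection exists on every open subset and its values
   there are unique, so quantifying it existentially is just naming it. *)
Definition totally_geodesic (eps : R) (E : R4 -> set R4) : Prop :=
  forall U, open U -> exists2 nabla, levi_civita eps U nabla &
    forall X Y, section_of E U X -> section_of E U Y ->
      section_of E U (fun p => nabla X Y p + nabla Y X p).

Definition metric_foliation (eps : R) (TF : R4 -> set R4) : Prop :=
  foliation TF /\ totally_geodesic eps (orthogonal eps TF).

Definition preserves_metric (eps : R) (f : R4 -> R4) : Prop :=
  forall p u v, S3 p -> tangent p u -> tangent p v ->
    berger eps (f p) (dS3 f p u) (dS3 f p v) = berger eps p u v.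

Record isometric_flow (eps : R) (phi : R -> R4 -> R4) : Prop := IsometricFlow {
  flow_S3 : forall t p, S3 p -> S3 (phi t p);
  flow0 : forall p, S3 p -> phi 0 p = p;
  flowD : forall s t p, S3 p -> phi (s + t) p = phi s (phi t p);
  flow_smooth : smooth_on [set tx : R * R4 | tx.2 != 0]
                          (fun tx => phi tx.1 (retr tx.2));
  flow_isometry : forall t, preserves_metric eps (phi t) }.

Definition orbit (phi : R -> R4 -> R4) (p : R4) : set R4 :=
  [set phi t p | t in setT].

Definition orbit_foliation (phi : R -> R4 -> R4) (TF : R4 -> set R4) : Prop :=
  forall p, S3 p -> leaf TF p = orbit phi p.

End BergerSphere.

(* Main.v *)
(* Let V = v1 e1 + v2 e2 + v3 e3 be a unit field tangent to the foliation,
   where e1 = X / eps, e2, e3 is the left-invariant orthonormal frame.  That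
   V^perp is totally geodesic means g([N, V], N) = 0 for every N orthogonal to
   V.  This determines all first derivatives of v1, v2, v3 up to the leaf
   curvature (kap1, kap2, kap3) and the twist of V^perp.  Where V is not
   vertical, set c = v1 and w = twist; commuting derivatives in the frame V,
   x = e1 - c V, y = V x e1 makes everything a differential consequence of
   this system: Q = 3 w^2 + (4/eps - 4) c^2 is constant along V, and so are
   N and De below, built from the first and second transverse derivatives of Q.
   If V c is nonzero somewhere, so is V w, and eliminating all other quantities
   shows that w satisfies an equation of degree 8 whose coefficients are
   constant along V and whose leading coefficient is a nonzero number, which is
   absurd.  So V c = 0, and the integrability conditions become simple.
   The relations which remain say that the vector Phi of moments of a
   modification of V against the right-invariant Killing fields and X satisfies
   D Phi = mu Phi for a one-form mu.  So Phi has a constant direction, that is,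
   the foliation is locally spanned by a Killing field K_k, k in R^4 = u(2).
   Since k is unique up to a factor, following great circles makes it global.
   The flow of K_k is explicit, and a curve tangent to K_k is an orbit after a
   change of parameter. *)
From HB Require Import structures.
Require Import Defs.
From mathcomp Require Import all_boot all_order all_algebra.
From mathcomp Require Import all_classical all_reals all_analysis.
From mathcomp Require Import ring lra.
Set Implicit Arguments.
Unset Strict Implicit.
Unset Printing Implicit Defensive.
Import Order.TTheory GRing.Theory Num.Theory numFieldNormedType.Exports.
Local Open Scope classical_set_scope.
Local Open Scope ring_scope.

(** * The overdetermined system as differential algebra *)

(** Smooth functions on an open set form a ring with zero divisors, so the elimination cannot
    divide. Nowhere vanishing functions serve as non-zero-divisors, and a contradiction takes the
    form [1 = 0], which says that the open set is empty. Applied to the open set where a given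
    function is nonzero, this shows that the function vanishes; [V c], the coefficient [F] and the
    derivative of [Lam] along [V] are disposed of one after the other in this way. The frame V, x, y
    degenerates where V is vertical, so the outcome is rewritten in e1, e2, e3, checked separately
    in the interior of the vertical set, and extended by continuity. The constants Q, N and De have
    a geometric origin. Q descends to the local leaf space, which carries a metric because the
    leaves are equidistant; N is the squared gradient of Q / 2 there, and De is its Laplacian. The
    assumption on eps enters through e = 2 / eps - 2, a constant that has to be cancelled: the round
    metric has Killing fields outside u(2), which four moments would not detect. *)

Definition derivation (A : pzRingType) (D : A -> A) : Prop :=
  (forall a b, D (a + b) = D a + D b) /\
  (forall a b, D (a * b) = D a * b + a * D b).

Section Derivation.
Variables (A : comPzRingType) (D : A -> A) (hD : derivation D).

Lemma derD a b : D (a + b) = D a + D b. Proof. by case: hD. Qed.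
Lemma derM a b : D (a * b) = D a * b + a * D b. Proof. by case: hD. Qed.
Lemma der0 : D 0 = 0. Proof. by apply: (addrI (D 0)); rewrite -derD !addr0. Qed.
Lemma der1 : D 1 = 0.
Proof. by apply: (addrI (D 1)); rewrite addr0 -{3}[1]mulr1 derM mulr1 mul1r. Qed.
Lemma derN a : D (- a) = - D a.
Proof. by apply: (addrI (D a)); rewrite -derD !subrr der0. Qed.
Lemma derB a b : D (a - b) = D a - D b. Proof. by rewrite derD derN. Qed.
Lemma der_nat n : D n%:R = 0.
Proof. by elim: n => [|n IH]; rewrite ?der0 // -natr1 derD IH der1 addr0. Qed.
Lemma derX a n : D (a ^+ n) = n%:R * a ^+ n.-1 * D a.
Proof.
case: n => [|n]; first by rewrite expr0 der1 !mul0r.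
elim: n => [|n IH]; first by rewrite expr1 expr0 !mul1r.
by rewrite exprS derM IH /= exprS -[n.+2%:R]natr1 -[n.+1%:R]natr1; ring.
Qed.
Definition derE := (der_nat, derB, derD, derN, derM, derX, der0, der1).
End Derivation.

(** Non-zero-divisors replace nonzero elements, because smooth functions on an open set do not form
    a domain; cancellation goes through them. *)
Definition regular (A : comPzRingType) (a : A) : Prop :=
  forall b, a * b = 0 -> b = 0.

Section Regular.
Variable A : comPzRingType.
Lemma regularM (a b : A) : regular a -> regular b -> regular (a * b).
Proof. by move=> ra rb d; rewrite -mulrA => /ra /rb. Qed.
Lemma regular_inv (a b : A) : b * a = 1 -> regular a.
Proof. by move=> ba d ad; rewrite -[d]mul1r -ba -mulrA ad mulr0. Qed.
Lemma regularI (a b d : A) : regular a -> a * b = a * d -> b = d.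
Proof. by move=> ra /eqP; rewrite -subr_eq0 -mulrBr => /eqP/ra/eqP; rewrite subr_eq0 => /eqP. Qed.
Lemma sub0_eq (a b : A) : a - b = 0 -> a = b.
Proof. by move/eqP; rewrite subr_eq0 => /eqP. Qed.
(* [t_i / s] is the derivative [D_i phi] of the polar angle [phi] of [(p, q)];
   the identity expresses [D1 D2 phi - D2 D1 phi = [D1, D2] phi]. *)
Lemma angle_commutator (D1 D2 : A -> A) (h1 : derivation D1) (h2 : derivation D2)
    (p q s t1 t2 : A) : p ^+ 2 + q ^+ 2 = s ->
  p * D1 q - q * D1 p = t1 -> p * D2 q - q * D2 p = t2 ->
  s * (D1 t2 - D2 t1
       - (p * (D1 (D2 q) - D2 (D1 q)) - q * (D1 (D2 p) - D2 (D1 p))))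
  = D1 s * t2 - D2 s * t1.
Proof. by move=> <- <- <-; rewrite !(derE h1) !(derE h2) /=; ring. Qed.
End Regular.

(* [poly_in n a f] : [f] is a polynomial in [w] of degree at most [n], with
   coefficients killed by [V] and with coefficient [a] in degree [n]. *)
Section PolynomialRelation.
Variables (A : comPzRingType) (V : A -> A) (hV : derivation V) (w : A).

Fixpoint poly_in (n : nat) (a f : A) : Prop :=
  if n is n'.+1 then exists g b, [/\ poly_in n' a g, V b = 0 & f = g * w + b]
  else V a = 0 /\ f = a.

Lemma poly_inD n a b f g :
  poly_in n a f -> poly_in n b g -> poly_in n (a + b) (f + g).
Proof.
elim: n f g => [|n IH] f g /=; first by move=> [Va ->] [Vb ->]; split; rewrite // derD // Va Vb addr0.
move=> [f1 [c1 [hf hc1 ->]]] [g1 [c2 [hg hc2 ->]]].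
exists (f1 + g1), (c1 + c2); split; [exact: IH|by rewrite derD // hc1 hc2 addr0|by ring].
Qed.

Lemma poly_in_der n a f : poly_in n.+1 a f ->
  exists2 f', poly_in n (n.+1%:R * a) f' & V f = f' * V w.
Proof.
elim: n f => [|n IH] f.
  move=> [g [b [[Va ->] Vb ->]]]; exists a; first by rewrite mul1r.
  by rewrite derD // derM // Va Vb; ring.
move=> [g [b [hg Vb ->]]]; have [g' hg' Vg] := IH _ hg.
exists (g' * w + g); last by rewrite derD // derM // Vg Vb; ring.
rewrite -natr1 mulrDl mul1r; apply: (@poly_inD n.+1) => //.
by exists g', 0; split => //; [exact: der0|rewrite addr0].
Qed.

(** Differentiating along [V] and cancelling the regular element [V w] lowers the degree by one and
    multiplies the leading coefficient by the degree. What remains at the end is [n! a = 0], and the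
    factorial is regular. *)
Lemma poly_in_eq0 n a : (forall i, regular (i.+1%:R : A)) -> regular (V w) ->
  poly_in n a 0 -> a = 0.
Proof.
move=> ch rW; elim: n a => [|n IH] a; first by case.
move=> /poly_in_der[f' hf']; rewrite der0 // => /esym; rewrite mulrC => /rW f'0.
by move: hf'; rewrite f'0 => /IH; apply: ch.
Qed.

Lemma poly_inS n a f b : poly_in n a f -> V b = 0 -> poly_in n.+1 a (f * w + b).
Proof. by exists f, b. Qed.

(* Only the nonzero leading coefficient matters; the other coefficients come
   from expanding, with [w] as variable, the relation [af_relation] below. *)
Lemma poly_in_relation (e Q N De : A) :
  V e = 0 -> V Q = 0 -> V N = 0 -> V De = 0 ->
  let g := Q - 3 * w ^+ 2 in
  let a := 5 * (2 * w + 1) in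
  let f := 12 * w ^+ 2 * g * (w - 1) + 2 * g ^+ 2 * (4 * w + 1) in
  let P3 := - 30 * Q + 60 * e in
  let P2 := 6 * De - 12 * Q - 48 * Q * e + 24 * Q ^+ 2 + 18 * e in
  let P1 := - 40 * Q * e + 20 * Q ^+ 2 in
  let P0 := - 5 * N - 10 * Q * e + 5 * Q ^+ 2 in
  let P4 := - 81 - 36 * Q + 24 * e in
  let pp := - 36 * w ^+ 6 - 90 * w ^+ 5 + P4 * w ^+ 4 + P3 * w ^+ 3 + P2 * w ^+ 2 + P1 * w + P0 in
  let pp' := - 216 * w ^+ 5 - 450 * w ^+ 4 + 4 * P4 * w ^+ 3 + 3 * P3 * w ^+ 2 + 2 * P2 * w + P1 in
  poly_in 8 (- (112 * 135)) ((10 * g - 3 * w * a) * pp - 3 * w * a ^+ 2 * f - pp' * g * a).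
Proof.
move=> Ve VQ VN VDe; cbv zeta; set E := (X in poly_in _ _ X).
have -> : E = ((((((((- (112 * 135)) * w + - (100 * 378)) * w
  + (- (120 * 243) + (100 * 104 + 40) * Q + 1440 * e)) * w
  + (- (81 * 95) + 200 * 100 * Q + 160 * Q + 2880 * e)) * w
  + ((100 * 136 + 80) * Q - 720 * Q * e - 1320 * Q ^+ 2 + 1800 * e)) * w
  + (90 * De + 3240 * Q - 1200 * Q * e - 1920 * Q ^+ 2 + 270 * e)) * w
  + (- 60 * De * Q + 300 * N - 480 * Q * e - 930 * Q ^+ 2 + 480 * Q ^+ 2 * e - 240 * Q ^+ 3)) * w
  + (- 60 * De * Q + 75 * N - 30 * Q * e - 105 * Q ^+ 2 + 480 * Q ^+ 2 * e - 240 * Q ^+ 3)) * w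
  + (- 50 * N * Q + 100 * Q ^+ 2 * e - 50 * Q ^+ 3).
  by rewrite /E; ring.
by do 8! [apply: poly_inS; last by rewrite !(derE hV) /= ?VDe ?VN ?VQ ?Ve; ring];
  split; rewrite // !(derE hV) ; ring.
Qed.

(** [pp'] is the formal derivative of [pp] in [w]; every other quantity in [pp] is killed by [V]. *)
Lemma sextic_der (e Q N De : A) :
  V e = 0 -> V Q = 0 -> V N = 0 -> V De = 0 ->
  let P3 := - 30 * Q + 60 * e in
  let P2 := 6 * De - 12 * Q - 48 * Q * e + 24 * Q ^+ 2 + 18 * e in
  let P1 := - 40 * Q * e + 20 * Q ^+ 2 in
  let P0 := - 5 * N - 10 * Q * e + 5 * Q ^+ 2 in
  let P4 := - 81 - 36 * Q + 24 * e in
  let pp := - 36 * w ^+ 6 - 90 * w ^+ 5 + P4 * w ^+ 4 + P3 * w ^+ 3 + P2 * w ^+ 2 + P1 * w + P0 in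
  let pp' := - 216 * w ^+ 5 - 450 * w ^+ 4 + 4 * P4 * w ^+ 3 + 3 * P3 * w ^+ 2 + 2 * P2 * w + P1 in
  V pp = pp' * V w.
Proof.
move=> Ve VQ VN VDe; cbv zeta; rewrite !(derE hV) /= Ve VQ VN VDe; ring.
Qed.
End PolynomialRelation.

(** * Consequences of the commutators in the adapted frame *)

Section Structure.
Variables (A : comPzRingType) (V x y : A -> A).
Hypotheses (hV : derivation V) (hx : derivation x) (hy : derivation y).
Variables (c w H K si e p q : A).
Let s := 1 - c ^+ 2.
Let W := V w.
(** By [af_Vx] and [af_Vy], bracketing with [V] acts on the plane of [x] and [y], modulo [V], as a
    rotation with coefficient [F] and a homothety with coefficient [- l]. Both fields have squared
    length [s], and [l] is what keeps the transverse metric invariant: [V s = - 2 * l * s]. *)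
Let F := 1 - w - c * K * si.
Let l := c * H * si.
(* [H] and [K] are the inner products of the leaf curvature with [x] and [y], [w]
   is the twist and [e] stands for [2 / eps - 2].  The last three equations are
   the derivatives of the polar angle of [(p, q)]. *)
Record adapted_frame : Prop := AdaptedFrame {
  af_char : forall n, regular (n.+1%:R : A);
  af_si : si * s = 1;
  af_Ve : V e = 0; af_xe : x e = 0; af_ye : y e = 0;
  af_Vc : V c = H; af_xc : x c = 0; af_yc : y c = - s * (w + 1);
  af_Vx : forall f, V (x f) - x (V f) = - H * V f + F * y f - l * x f;
  af_Vy : forall f, V (y f) - y (V f) = - K * V f - F * x f - l * y f;
  af_xy : forall f, x (y f) - y (x f) = - 2 * s * w * V f;
  af_pq : p ^+ 2 + q ^+ 2 = s;
  af_VT : p * V q - q * V p = - K - e * c * s;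
  af_xT : p * x q - q * x p = - s * (w + 1 + e * s);
  af_yT : p * y q - q * y p = 0 }.
Hypothesis AF : adapted_frame.

Let ch (n : nat) : regular (n.+1%:R : A). Proof. by move=> b; apply: (af_char AF). Qed.
Let rs : regular s. Proof. exact: regular_inv (af_si AF). Qed.
Let hsi : c ^+ 2 * si = si - 1.
Proof. by move: (af_si AF); rewrite /s => h; rewrite -h; ring. Qed.

Lemma af_dsi (D : A -> A) : derivation D -> D si = 2 * c * D c * si ^+ 2.
Proof.
move=> hD; have := congr1 D (af_si AF); rewrite /s !(derE hD) /= => h.
apply: (regularI rs); apply: sub0_eq; rewrite /s.
transitivity (D si * (1 - c ^+ 2) + si * (0 - 2%:R * c ^+ 1 * D c)
  - 2 * c * D c * si * (si * s - 1)); first by rewrite /s; ring.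
by rewrite h (af_si AF); ring.
Qed.

(** All derivatives of [c] and of the polar angle of [(p, q)] are prescribed. Applying the three
    commutators to these two functions gives six equations, which this and the next five lemmas
    solve for the derivatives of [w], [H] and [K] along [x] and [y]. *)
Lemma af_xw : x w = 2 * w * H.
Proof.
have := af_xy AF c; rewrite (af_xc AF) (af_yc AF) (af_Vc AF) (der0 hy) subr0.
rewrite /s !(derE hx) /= (af_xc AF) => h.
apply: (regularI rs); apply: sub0_eq; rewrite /s; move: h => /eqP; rewrite -subr_eq0 => /eqP h.
by rewrite -[RHS]oppr0 -h /s; ring.
Qed.

Lemma af_yw : y w = 2 * w * K - 2 * e * c * s.
Proof.
have := angle_commutator hx hy (af_pq AF) (af_xT AF) (af_yT AF).
rewrite !(af_xy AF) (der0 hx).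
rewrite (_ : p * _ - q * _ = - 2 * s * w * (p * V q - q * V p)); last by ring.
rewrite (af_VT AF) /s !(derE hy, derE hx) /= (af_yc AF) (af_ye AF) (af_xc AF) /s => h.
apply: (regularI rs); apply: (regularI rs); apply: sub0_eq; rewrite /s; move: h => /eqP; rewrite -subr_eq0 => /eqP h.
by rewrite -[RHS]h; ring.
Qed.

Lemma af_xH : x H = H ^+ 2 + F * s * (w + 1).
Proof.
have := af_Vx AF c; rewrite (af_xc AF) (der0 hV) (af_Vc AF) (af_yc AF) mulr0 subr0 sub0r => h.
by rewrite -[x H]opprK h; ring.
Qed.

Lemma af_yH : y H = H * K + c * H * (w + 1) - s * W.
Proof.
have := af_Vy AF c; rewrite (af_xc AF) (af_Vc AF) (af_yc AF) mulr0 subr0.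
rewrite {1}/s !(derE hV) /= (af_Vc AF) -/W => /esym h.
apply: sub0_eq; move: h => /eqP; rewrite -subr_eq0 => /eqP h.
rewrite -[RHS]h /l /s; ring: hsi.
Qed.

Lemma af_xK : x K = H * K + s * W + c * H * (w + 1).
Proof.
have := angle_commutator hV hx (af_pq AF) (af_VT AF) (af_xT AF).
rewrite !(af_Vx AF).
rewrite (_ : p * _ - q * _ = - H * (p * V q - q * V p) + F * (p * y q - q * y p)
  - l * (p * x q - q * x p)); last by ring.
rewrite (af_VT AF) (af_xT AF) (af_yT AF).
rewrite /s !(derE hV, derE hx) /= (af_Vc AF) (af_xc AF) (af_xe AF) (af_Ve AF) -/W => h.
apply: (regularI rs); apply: sub0_eq; move: h => /eqP; rewrite -subr_eq0 => /eqP h.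
by rewrite -[RHS]h /l /s; ring: hsi.
Qed.

Lemma af_yK : y K = c * (w + 1) * K + K ^+ 2 + s * (1 - w ^+ 2) + 2 * e * s ^+ 2.
Proof.
have := angle_commutator hV hy (af_pq AF) (af_VT AF) (af_yT AF).
rewrite !(af_Vy AF).
rewrite (_ : p * _ - q * _ = - K * (p * V q - q * V p) - F * (p * x q - q * x p)
  - l * (p * y q - q * y p)); last by ring.
rewrite (af_VT AF) (af_xT AF) (af_yT AF).
rewrite /s !(derE hV, derE hy) /= (af_Vc AF) (af_yc AF) (af_ye AF) => h.
apply: (regularI rs); apply: sub0_eq; move: h => /eqP; rewrite -subr_eq0 => /eqP h.
by rewrite -[RHS]h /F /s; ring: hsi.
Qed.

(** The first integrability condition: [x w] and [y w] are known by now, so the commutator of [x]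
    and [y] can be applied to [w]. The outcome says precisely that [Q] is constant along [V]. *)
Lemma af_W : 3 * w * W = - 2 * e * c * H.
Proof.
have := af_xy AF w; rewrite af_xw af_yw /s !(derE hx, derE hy) /=.
rewrite af_xw af_yw af_xK af_yH (af_xc AF) (af_xe AF) -/W => h.
apply: (regularI rs); apply: (regularI (@ch 1%N)).
apply: sub0_eq; move: h => /eqP; rewrite -subr_eq0 => /eqP h.
by rewrite -[RHS]h /F /s; ring: hsi.
Qed.

(** [q1] and [q2] are half the derivatives of [Q] along [x] and [y]. These two fields are
    orthogonal, of squared length [s], and commute modulo [V]; hence on the local leaf space [N] is
    the squared gradient of [Q / 2] and [De] its Laplacian, with no first-order correction. *)
Let q1 := 6 * w ^+ 2 * H.
Let q2 := 6 * w ^+ 2 * K - 2 * e * c * s * (4 * w + 1).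
Let Q := 3 * w ^+ 2 + 2 * e * c ^+ 2.
Let N := (q1 ^+ 2 + q2 ^+ 2) * si.
Let De := (x q1 + y q2) * si.

Lemma af_VQ : V Q = 0.
Proof.
rewrite /Q !(derE hV) /= (af_Vc AF) (af_Ve AF) -/W.
apply: sub0_eq; transitivity (2 * (3 * w * W - - 2 * e * c * H)); last by rewrite af_W; ring.
by ring.
Qed.

Lemma af_xQ : x Q = 2 * q1.
Proof. by rewrite /Q !(derE hx) /= (af_xc AF) (af_xe AF) af_xw /q1; ring. Qed.
Lemma af_yQ : y Q = 2 * q2.
Proof. by rewrite /Q !(derE hy) /= (af_yc AF) (af_ye AF) af_yw /q2 /s; ring. Qed.

(** The commutator of [V] and [x] applied to [Q]: since [V Q = 0], only the rotation and the
    homothety are left. *)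
Lemma af_Vq1 : V q1 = F * q2 - l * q1.
Proof.
have := af_Vx AF Q; rewrite af_VQ af_xQ af_yQ (der0 hx) mulr0 subr0 !(derM hV) (der_nat hV) => h.
apply: (regularI (@ch 1%N)); apply: sub0_eq; move: h => /eqP; rewrite -subr_eq0 => /eqP h.
by rewrite -[RHS]h; ring.
Qed.

Lemma af_Vq2 : V q2 = - F * q1 - l * q2.
Proof.
have := af_Vy AF Q; rewrite af_VQ af_xQ af_yQ (der0 hy) mulr0 subr0 !(derM hV) (der_nat hV) => h.
apply: (regularI (@ch 1%N)); apply: sub0_eq; move: h => /eqP; rewrite -subr_eq0 => /eqP h.
by rewrite -[RHS]h; ring.
Qed.

Lemma af_VN : V N = 0.
Proof.
rewrite /N (derM hV) (derD hV) !(derX hV) /= af_Vq1 af_Vq2 (af_dsi hV) (af_Vc AF) /l; ring.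
Qed.

(** The Laplacian of a function on the leaf space is again such a function. In the frame, [V] is
    moved past [x] and [y], and the derivatives of [F] and [l] that appear are eliminated by [xF]
    and [yF]. *)
Lemma af_VDe : V De = 0.
Proof.
have h1 := af_Vx AF q1; have h2 := af_Vy AF q2.
rewrite af_Vq1 in h1; rewrite af_Vq2 in h2.
rewrite /De derM // derD // (af_dsi hV) (af_Vc AF).
have -> : V (x q1) = x (F * q2 - l * q1) - H * (F * q2 - l * q1) + F * y q1 - l * x q1.
  by apply: sub0_eq; move: h1 => /eqP; rewrite -subr_eq0 => /eqP h; rewrite -[RHS]h; ring.
have -> : V (y q2) = y (- F * q1 - l * q2) - K * (- F * q1 - l * q2) - F * x q2 - l * y q2.
  by apply: sub0_eq; move: h2 => /eqP; rewrite -subr_eq0 => /eqP h; rewrite -[RHS]h; ring.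
(* This identity and [yF] are the components along [x] and [y] of the Jacobi identity for [V], [x],
   [y]. *)
have xF : x F - y l = H * F - K * l.
  rewrite /F /l !(derE hx, derE hy) /= (af_dsi hx) (af_dsi hy) (af_xc AF) (af_yc AF).
  by rewrite af_xw af_xK af_yH /F /l /s; ring: hsi.
have yF : y F + x l = H * l + K * F.
  rewrite /F /l !(derE hx, derE hy) /= (af_dsi hx) (af_dsi hy) (af_xc AF) (af_yc AF).
  by rewrite af_yw af_yK af_xH /F /l /s; ring: hsi.
rewrite (derB hx (F * q2)) (derM hx F) (derM hx l) (derB hy (- F * q1)) (derM hy (- F)) (derM hy l) (derN hy F).
have -> : x F = H * F - K * l + y l by rewrite -xF; ring.
have -> : y F = H * l + K * F - x l by rewrite -yF; ring.
by rewrite /l; ring.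
Qed.

Lemma af_DeE : De = 30 * w ^+ 2 * (H ^+ 2 + K ^+ 2) * si - 40 * e * w * c * K
   - 6 * e * c ^+ 2 - 30 * e * c ^+ 2 * w - 36 * e * c ^+ 2 * w ^+ 2 + 16 * e ^+ 2 * c ^+ 2 * s
   + 2 * e + 10 * e * w + 20 * e * w ^+ 2 + 12 * w ^+ 2 - 12 * w ^+ 4.
Proof.
rewrite /De /q1 /q2 /s !(derE hx, derE hy) /=.
rewrite (af_yc AF) (af_ye AF) af_xw af_yw af_xH af_yK /F /s.
by ring: hsi.
Qed.

Let Z := 4 * e * c * q2.
Let g := 2 * e * c ^+ 2.
Let f := 12 * w ^+ 2 * g * (w - 1) + 2 * g ^+ 2 * (4 * w + 1).

(** [V q2] is a multiple of [H], because [q1] and [l] are. The factor [g = 2 * e * c ^+ 2] provides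
    the [2 * e * c] by which [af_W] exchanges [H] for [W]. *)
Lemma af_VZ : g * V Z = - 3 * w * W * (Z + f).
Proof.
rewrite /Z (derM hV (4 * e * c) q2) af_Vq2 !(derE hV) /= (af_Vc AF) (af_Ve AF).
have -> : - 3 * w * W = 2 * e * c * H by rewrite mulNr mulNr af_W; ring.
by rewrite /Z /f /g /q1 /q2 /F /l /s; ring: hsi.
Qed.

Let a := 5 * (2 * w + 1).
Let P3 := - 30 * Q + 60 * e.
Let P2 := 6 * De - 12 * Q - 48 * Q * e + 24 * Q ^+ 2 + 18 * e.
Let P1 := - 40 * Q * e + 20 * Q ^+ 2.
Let P0 := - 5 * N - 10 * Q * e + 5 * Q ^+ 2.
Let P4 := - 81 - 36 * Q + 24 * e.
Let pp := - 36 * w ^+ 6 - 90 * w ^+ 5 + P4 * w ^+ 4 + P3 * w ^+ 3 + P2 * w ^+ 2 + P1 * w + P0.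
Let pp' := - 216 * w ^+ 5 - 450 * w ^+ 4 + 4 * P4 * w ^+ 3 + 3 * P3 * w ^+ 2 + 2 * P2 * w + P1.

(** In [6 * w ^+ 2 * De - 5 * N] the terms with [H ^+ 2 + K ^+ 2] cancel, as 6 * 30 = 5 * 36, and
    the rest is linear in [K]. Expressing [K] through [Z], and [2 * e * c ^+ 2] as [Q - 3 * w ^+ 2],
    leaves on the right-hand side a polynomial in [w] with coefficients constant along [V]. *)
Lemma af_ZP : a * Z = pp.
Proof.
rewrite /pp /P0 /P1 /P2 /P3 /P4 af_DeE /N /q1 /Z /a /q2 /Q /s.
by ring: hsi.
Qed.

Lemma af_Vpp : V pp = pp' * W.
Proof. by have h := sextic_der hV w (af_Ve AF) af_VQ af_VN af_VDe; exact h. Qed.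

(* Differentiate [a * Z = pp] along [V] and eliminate [Z] and [V Z]; a factor
   [W = V w] comes out. *)
Lemma af_relation : regular W ->
  (10 * g - 3 * w * a) * pp - 3 * w * a ^+ 2 * f - pp' * g * a = 0.
Proof.
move=> rW; apply: rW.
have := congr1 V af_ZP; rewrite af_Vpp (derM hV a Z) => h.
have Va : V a = 10 * W by rewrite /a !(derE hV) -/W; ring.
rewrite Va in h.
have h2 : g * ((10 * W) * Z + a * V Z) = g * pp' * W.
  by rewrite -[in RHS]mulrA -h; ring.
rewrite -af_ZP.
transitivity (a * (g * (10 * W * Z + a * V Z) - g * pp' * W) - a * a * (g * V Z - - 3 * w * W * (Z + f))).
  by ring.
by rewrite h2 af_VZ; ring.
Qed.

Lemma af_trivial : (forall b : A, b * b = 0 -> b = 0) -> regular e -> regular H -> (1 : A) = 0.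
Proof.
move=> red re rH.
have r2 := @ch 1%N; have r3 := @ch 2%N.
(* From [c * b = 0], differentiating along [V] and multiplying by [b] gives [H * b ^+ 2 = 0]; then
   [b = 0] because the ring is reduced. *)
have rc : regular c.
  move=> b cb; apply: red; apply: rH.
  have := congr1 V cb; rewrite derM // (af_Vc AF) der0 // => h.
  have -> : H * (b * b) = (H * b + c * V b) * b - V b * (c * b) by ring.
  by rewrite h cb; ring.
have rr : regular (2 * e * c * H) by do !apply: regularM.
have rwW : regular (3 * w * W).
  move=> b; rewrite af_W => h; apply: rr; rewrite -[RHS]oppr0 -[in RHS]h; ring.
have rw : regular w by move=> b wb; apply: rwW; rewrite mulrAC -[3 * w * b]mulrA wb mulr0 mul0r.
have rW : regular W by move=> b wb; apply: rwW; rewrite -mulrA wb mulr0.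
have := af_relation rW.
have gE : g = Q - 3 * w ^+ 2 by rewrite /g /Q; ring.
have := poly_in_relation hV w (af_Ve AF) af_VQ af_VN af_VDe.
cbv zeta; rewrite -gE -/a -/f -/P3 -/P2 -/P1 -/P0 -/P4 -/pp -/pp' => hp h0.
move: hp; rewrite h0 => /(poly_in_eq0 hV (@ch) rW) h.
(* The coefficient of [w ^+ 8] is 2160 - 10800 - 6480 = - 112 * 135, one contribution from each of
   the three products in [af_relation]. *)
have r112 := @ch 111%N; have r135 := @ch 134%N.
by apply: r112; apply: r135; rewrite mulr1 -[RHS]oppr0 -h; ring.
Qed.

Lemma af_H0_W : H = 0 -> W = 0.
Proof.
move=> H0; have := af_yH; rewrite H0 (der0 hy) => h.
by apply: rs; rewrite -[RHS]oppr0 [in RHS]h; ring.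
Qed.

(** With [w = -1] the function [c] is constant along [y], [af_yw] gives [K = - e * c * s], and
    [af_yK] becomes [e * s ^+ 2 * (e * c ^+ 2 + 2) = 0], a product of regular elements. *)
Lemma af_H0_u : regular e -> regular (e * c ^+ 2 + 2) -> H = 0 -> w + 1 = 0 ->
  (1 : A) = 0.
Proof.
move=> re rec H0 u0.
have yc : y c = 0 by rewrite (af_yc AF) u0 mulr0.
have wE : w = -1 by apply: sub0_eq; rewrite -u0; ring.
have := af_yw; rewrite wE (derN hy) (der1 hy) => h.
have KE : K = - e * c * s.
  by apply: (regularI (@ch 1%N)); apply: sub0_eq; rewrite -[RHS]oppr0 -[in RHS]oppr0 [in RHS]h; ring.
have := af_yK; rewrite u0 wE KE /s !(derE hy) /= (af_ye AF) yc -/s => h2.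
apply: rec; apply: re; apply: rs; apply: rs.
by move: h2 => /esym/eqP; rewrite -subr_eq0 => /eqP h2; rewrite -[RHS]h2 /s; ring.
Qed.

(** For [H = 0], [af_xH] reads [F * s * (w + 1) = 0]. *)
Lemma af_H0_F : regular e -> regular (e * c ^+ 2 + 2) -> H = 0 -> regular F ->
  (1 : A) = 0.
Proof.
move=> re rec H0 rF; apply: af_H0_u => //.
have := af_xH; rewrite H0 (der0 hx) => h.
by apply: rs; apply: rF; rewrite [RHS]h; ring.
Qed.

(** When [F = 0], both [K] and [w] are functions of [c] and [lam]. Adding [e * c] to [lam]
    compensates the terms with [e] in [af_yw] and [af_yK], so that the derivative of the sum along
    [y] is a multiple of the sum. *)
Let lam := K - c * (w - 1).

Lemma af_KE : F = 0 -> K = s * lam.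
Proof.
move=> F0; apply: sub0_eq; transitivity (- c * s * F); last by rewrite F0 mulr0.
by rewrite /lam /F /s; ring: hsi.
Qed.

Lemma af_wE : F = 0 -> w = 1 - c * lam.
Proof.
move=> F0; apply: sub0_eq; transitivity (- s * F); last by rewrite F0 mulr0.
by rewrite /lam /F /s; ring: hsi.
Qed.

Lemma af_xlam : H = 0 -> x (lam + e * c) = 0.
Proof.
move=> H0; have W0 := af_H0_W H0.
rewrite /lam !(derE hx) af_xK (af_xc AF) (af_xe AF) af_xw W0 H0; ring.
Qed.

Lemma af_ylam : F = 0 -> y (lam + e * c) = s * lam * (lam + e * c).
Proof.
move=> F0; rewrite (derD hy) {1}/lam !(derE hy) af_yK (af_yc AF) (af_ye AF) af_yw.
by rewrite (af_KE F0) (af_wE F0) /s; ring.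
Qed.

(** Since [W = 0], differentiating [w = 1 - c * lam] along [V] gives [c * V lam = 0]. A regular
    [V lam] forces [c = 0], hence [w = -1] through [af_yc]. *)
Lemma af_Vlam : regular e -> regular (e * c ^+ 2 + 2) -> H = 0 -> F = 0 ->
  regular (V (lam + e * c)) -> (1 : A) = 0.
Proof.
move=> re rec H0 F0 rV; apply: af_H0_u => //.
have W0 := af_H0_W H0.
have Vl : V (lam + e * c) = V lam.
  by rewrite (derD hV) (derM hV) (af_Ve AF) (af_Vc AF) H0; ring.
have c0 : c = 0.
  apply: rV; rewrite Vl; have := congr1 V (af_wE F0).
  rewrite -/W W0 (derB hV) (der1 hV) (derM hV) (af_Vc AF) H0 => h.
  by rewrite -[RHS]oppr0 [in RHS]h; ring.
have := af_yc AF; rewrite c0 (der0 hy) => h.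
by apply: rs; rewrite -[RHS]oppr0 [in RHS]h /s c0; ring.
Qed.
End Structure.

(* [c, p, q] are the components of V in the left-invariant frame and the
   equations are the PDE of a metric foliation, solved for the derivatives. *)
Section Frame.
Variables (A : comPzRingType) (D1 D2 D3 : A -> A).
Hypotheses (h1 : derivation D1) (h2 : derivation D2) (h3 : derivation D3).
Variables (e c p q k1 k2 k3 w si : A).
Let m := e + 2.
Record metric_frame : Prop := MetricFrame {
  mf_D1e : D1 e = 0; mf_D2e : D2 e = 0; mf_D3e : D3 e = 0;
  mf_D23 : forall f, D2 (D3 f) - D3 (D2 f) = 2 * D1 f;
  mf_D31 : forall f, D3 (D1 f) - D1 (D3 f) = m * D2 f;
  mf_D12 : forall f, D1 (D2 f) - D2 (D1 f) = m * D3 f;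
  mf_unit : c ^+ 2 + p ^+ 2 + q ^+ 2 = 1;
  mf_vk : c * k1 + p * k2 + q * k3 = 0;
  mf_D1c : D1 c = c * k1;
  mf_D1p : D1 p = c * k2 + w * q + (m - 1) * q;
  mf_D1q : D1 q = c * k3 - w * p - (m - 1) * p;
  mf_D2c : D2 c = p * k1 - w * q - q;
  mf_D2p : D2 p = p * k2;
  mf_D2q : D2 q = p * k3 + w * c + c;
  mf_D3c : D3 c = q * k1 + w * p + p;
  mf_D3p : D3 p = q * k2 - w * c - c;
  mf_D3q : D3 q = q * k3 }.
Hypothesis MF : metric_frame.

Let s := 1 - c ^+ 2.
(* V, x = e1 - c V and y = V x e1 as derivations. *)
Definition der_V f := c * D1 f + p * D2 f + q * D3 f.
Definition der_x f := s * D1 f - c * p * D2 f - c * q * D3 f.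
Definition der_y f := q * D2 f - p * D3 f.

Lemma der_V_derivation : derivation der_V.
Proof. by split=> f g; rewrite /der_V !(derE h1, derE h2, derE h3); ring. Qed.
Lemma der_x_derivation : derivation der_x.
Proof. by split=> f g; rewrite /der_x !(derE h1, derE h2, derE h3); ring. Qed.
Lemma der_y_derivation : derivation der_y.
Proof. by split=> f g; rewrite /der_y !(derE h1, derE h2, derE h3); ring. Qed.

Let H := k1.
Let K := k2 * q - k3 * p.
Hypotheses (ch : forall n, regular (n.+1%:R : A)) (sis : si * s = 1).

Lemma metric_frame_adapted : adapted_frame der_V der_x der_y c w H K si e p q.
Proof.
have hsi : c ^+ 2 * si = si - 1 by rewrite -[1 in RHS]sis /s; ring.
have hq : q ^+ 2 = 1 - c ^+ 2 - p ^+ 2 by rewrite -(mf_unit MF); ring.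
pose K' := K.
(* The leaf curvature is orthogonal to [V], so [k2] and [k3] are determined by [k1] and [K];
   substituting them uses up the relation [mf_vk]. *)
have E2 : k2 = (K' * q - c * p * k1) * si.
  rewrite -[LHS]mulr1 -sis; apply: sub0_eq.
  transitivity (si * (p * (c * k1 + p * k2 + q * k3) + k2 * (1 - (c ^+ 2 + p ^+ 2 + q ^+ 2)))).
    by rewrite /K' /K /s; ring.
  by rewrite (mf_vk MF) (mf_unit MF); ring.
have E3 : k3 = - (K' * p + c * q * k1) * si.
  rewrite -[LHS]mulr1 -sis; apply: sub0_eq.
  transitivity (si * (q * (c * k1 + p * k2 + q * k3) + k3 * (1 - (c ^+ 2 + p ^+ 2 + q ^+ 2)))).
    by rewrite /K' /K /s; ring.
  by rewrite (mf_vk MF) (mf_unit MF); ring.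
have D32 f : D3 (D2 f) = D2 (D3 f) - 2 * D1 f by rewrite -(mf_D23 MF); ring.
have D31 f : D3 (D1 f) = D1 (D3 f) + m * D2 f by rewrite -(mf_D31 MF); ring.
have D21 f : D2 (D1 f) = D1 (D2 f) - m * D3 f by rewrite -(mf_D12 MF); ring.
have rules := (mf_D1c MF, mf_D1p MF, mf_D1q MF, mf_D2c MF, mf_D2p MF, mf_D2q MF, mf_D3c MF, mf_D3p MF, mf_D3q MF).
have K'E : K = K' by [].
clearbody K'.
split=> //.
- by rewrite /der_V (mf_D1e MF) (mf_D2e MF) (mf_D3e MF); ring.
- by rewrite /der_x (mf_D1e MF) (mf_D2e MF) (mf_D3e MF); ring.
- by rewrite /der_y (mf_D2e MF) (mf_D3e MF); ring.
- by rewrite /der_V !rules /H; ring: hsi hq.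
- by rewrite /der_x !rules /s; ring: hsi hq.
- by rewrite /der_y !rules /s; ring: hsi hq.
- move=> f; rewrite /der_V /der_x /der_y /s !(derE h1, derE h2, derE h3) /= D32 D31 D21 !rules K'E E2 E3 /H /m.
  by ring: hsi hq.
- move=> f; rewrite /der_V /der_x /der_y /s !(derE h1, derE h2, derE h3) /= D32 D31 D21 !rules K'E E2 E3 /H /m.
  by ring: hsi hq.
- move=> f; rewrite /der_V /der_x /der_y /s !(derE h1, derE h2, derE h3) /= D32 D31 D21 !rules E2 E3 /m.
  by ring: hsi hq.
- by rewrite /s -(mf_unit MF); ring.
- by rewrite /der_V !rules K'E E2 E3 /s /m; ring: hsi hq.
- by rewrite /der_x !rules E2 E3 /s /m; ring: hsi hq.
- by rewrite /der_y !rules E2 E3; ring: hsi hq.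
Qed.
End Frame.

(* [M_ij = (D_i v)_j] has quadratic form zero on the plane orthogonal to [v], so
   it is skew there, with a single coefficient [w]. *)
Lemma skew_on_orthogonal (R : realFieldType) (v1 v2 v3 M11 M12 M13 M21 M22 M23 M31 M32 M33 : R) :
  v1 ^+ 2 + v2 ^+ 2 + v3 ^+ 2 = 1 ->
  M11 * v1 + M12 * v2 + M13 * v3 = 0 ->
  M21 * v1 + M22 * v2 + M23 * v3 = 0 ->
  M31 * v1 + M32 * v2 + M33 * v3 = 0 ->
  (forall w1 w2 w3, let n1 := v2 * w3 - v3 * w2 in let n2 := v3 * w1 - v1 * w3 in
     let n3 := v1 * w2 - v2 * w1 in
     n1 * (n1 * M11 + n2 * M21 + n3 * M31) + n2 * (n1 * M12 + n2 * M22 + n3 * M32)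
     + n3 * (n1 * M13 + n2 * M23 + n3 * M33) = 0) ->
  let k1 := v1 * M11 + v2 * M21 + v3 * M31 in
  let k2 := v1 * M12 + v2 * M22 + v3 * M32 in
  let k3 := v1 * M13 + v2 * M23 + v3 * M33 in
  let w := 2^-1 * (v1 * (M23 - M32) + v2 * (M31 - M13) + v3 * (M12 - M21)) in
  [/\ v1 * k1 + v2 * k2 + v3 * k3 = 0,
      [/\ M11 = v1 * k1, M12 = v1 * k2 + w * v3 & M13 = v1 * k3 - w * v2],
      [/\ M21 = v2 * k1 - w * v3, M22 = v2 * k2 & M23 = v2 * k3 + w * v1] &
      [/\ M31 = v3 * k1 + w * v2, M32 = v3 * k2 - w * v1 & M33 = v3 * k3]].
Proof.
move=> u r1 r2 r3 quad k1 k2 k3 w.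
have kv : v1 * k1 + v2 * k2 + v3 * k3 = 0.
  transitivity (v1 * (M11 * v1 + M12 * v2 + M13 * v3) + v2 * (M21 * v1 + M22 * v2 + M23 * v3) + v3 * (M31 * v1 + M32 * v2 + M33 * v3)).
    by rewrite /k1 /k2 /k3; ring.
  by rewrite r1 r2 r3; ring.
(* [T] is the bilinear form [M] evaluated on the cross products of [v] with the basis vectors;
   [quad] at the basis vectors and at their sums makes [T] skew. *)
pose T11 := (v3) * (v3) * M22 + (v3) * (- v2) * M23 + (- v2) * (v3) * M32 + (- v2) * (- v2) * M33.
pose T12 := (v3) * (- v3) * M21 + (v3) * (v1) * M23 + (- v2) * (- v3) * M31 + (- v2) * (v1) * M33.
pose T13 := (v3) * (v2) * M21 + (v3) * (- v1) * M22 + (- v2) * (v2) * M31 + (- v2) * (- v1) * M32.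
pose T21 := (- v3) * (v3) * M12 + (- v3) * (- v2) * M13 + (v1) * (v3) * M32 + (v1) * (- v2) * M33.
pose T22 := (- v3) * (- v3) * M11 + (- v3) * (v1) * M13 + (v1) * (- v3) * M31 + (v1) * (v1) * M33.
pose T23 := (- v3) * (v2) * M11 + (- v3) * (- v1) * M12 + (v1) * (v2) * M31 + (v1) * (- v1) * M32.
pose T31 := (v2) * (v3) * M12 + (v2) * (- v2) * M13 + (- v1) * (v3) * M22 + (- v1) * (- v2) * M23.
pose T32 := (v2) * (- v3) * M11 + (v2) * (v1) * M13 + (- v1) * (- v3) * M21 + (- v1) * (v1) * M23.
pose T33 := (v2) * (v2) * M11 + (v2) * (- v1) * M12 + (- v1) * (v2) * M21 + (- v1) * (- v1) * M22.
have t11 : T11 = 0 by rewrite -[RHS](quad 1 0 0) /T11; ring.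
have t22 : T22 = 0 by rewrite -[RHS](quad 0 1 0) /T22; ring.
have t33 : T33 = 0 by rewrite -[RHS](quad 0 0 1) /T33; ring.
have t21 : T21 = - T12.
  apply: subr0_eq; transitivity (T11 + T22 + T12 + T21); first by rewrite t11 t22; ring.
  by rewrite -[RHS](quad 1 1 0) /T11 /T22 /T12 /T21; ring.
have t32 : T32 = - T23.
  apply: subr0_eq; transitivity (T22 + T33 + T23 + T32); first by rewrite t22 t33; ring.
  by rewrite -[RHS](quad 0 1 1) /T22 /T33 /T23 /T32; ring.
have t31 : T31 = - T13.
  apply: subr0_eq; transitivity (T11 + T33 + T13 + T31); first by rewrite t11 t33; ring.
  by rewrite -[RHS](quad 1 0 1) /T11 /T33 /T13 /T31; ring.
pose u2 := v1 ^+ 2 + v2 ^+ 2 + v3 ^+ 2.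
pose t := v1 * T23 - v2 * T13 + v3 * T12.
(* Crossing twice with the unit vector [v] is minus the projection off [v], so [M] is recovered from
   [T], from the contraction [k] and from the relations [r1], [r2], [r3]. The coefficient [t] is the
   component along [v] of the axial vector of [T]. *)
have e11 : M11 = v1 * k1 + t * (0).
  transitivity (v1 * k1 + ((- v3) * T22 * (- v3) + (- v3) * T23 * (v2) + (v2) * T32 * (- v3) + (v2) * T33 * (v2)) + ((1 - u2 ^+ 2) * M11 - (1 - u2) * v1 * k1 + u2 * (M11 * v1 + M12 * v2 + M13 * v3) * v1 - v1 * v1 * (v1 * k1 + v2 * k2 + v3 * k3))).
    by rewrite /T11 /T12 /T13 /T21 /T22 /T23 /T31 /T32 /T33 /k1 /k2 /k3 /u2; ring.
  by rewrite ?t11 ?t22 ?t33 ?t21 ?t31 ?t32 /u2 u kv r1 /t; ring.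
have e12 : M12 = v1 * k2 + t * (v3).
  transitivity (v1 * k2 + ((- v3) * T21 * (v3) + (- v3) * T23 * (- v1) + (v2) * T31 * (v3) + (v2) * T33 * (- v1)) + ((1 - u2 ^+ 2) * M12 - (1 - u2) * v1 * k2 + u2 * (M11 * v1 + M12 * v2 + M13 * v3) * v2 - v1 * v2 * (v1 * k1 + v2 * k2 + v3 * k3))).
    by rewrite /T11 /T12 /T13 /T21 /T22 /T23 /T31 /T32 /T33 /k1 /k2 /k3 /u2; ring.
  by rewrite ?t11 ?t22 ?t33 ?t21 ?t31 ?t32 /u2 u kv r1 /t; ring.
have e13 : M13 = v1 * k3 + t * (- v2).
  transitivity (v1 * k3 + ((- v3) * T21 * (- v2) + (- v3) * T22 * (v1) + (v2) * T31 * (- v2) + (v2) * T32 * (v1)) + ((1 - u2 ^+ 2) * M13 - (1 - u2) * v1 * k3 + u2 * (M11 * v1 + M12 * v2 + M13 * v3) * v3 - v1 * v3 * (v1 * k1 + v2 * k2 + v3 * k3))).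
    by rewrite /T11 /T12 /T13 /T21 /T22 /T23 /T31 /T32 /T33 /k1 /k2 /k3 /u2; ring.
  by rewrite ?t11 ?t22 ?t33 ?t21 ?t31 ?t32 /u2 u kv r1 /t; ring.
have e21 : M21 = v2 * k1 + t * (- v3).
  transitivity (v2 * k1 + ((v3) * T12 * (- v3) + (v3) * T13 * (v2) + (- v1) * T32 * (- v3) + (- v1) * T33 * (v2)) + ((1 - u2 ^+ 2) * M21 - (1 - u2) * v2 * k1 + u2 * (M21 * v1 + M22 * v2 + M23 * v3) * v1 - v2 * v1 * (v1 * k1 + v2 * k2 + v3 * k3))).
    by rewrite /T11 /T12 /T13 /T21 /T22 /T23 /T31 /T32 /T33 /k1 /k2 /k3 /u2; ring.
  by rewrite ?t11 ?t22 ?t33 ?t21 ?t31 ?t32 /u2 u kv r2 /t; ring.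
have e22 : M22 = v2 * k2 + t * (0).
  transitivity (v2 * k2 + ((v3) * T11 * (v3) + (v3) * T13 * (- v1) + (- v1) * T31 * (v3) + (- v1) * T33 * (- v1)) + ((1 - u2 ^+ 2) * M22 - (1 - u2) * v2 * k2 + u2 * (M21 * v1 + M22 * v2 + M23 * v3) * v2 - v2 * v2 * (v1 * k1 + v2 * k2 + v3 * k3))).
    by rewrite /T11 /T12 /T13 /T21 /T22 /T23 /T31 /T32 /T33 /k1 /k2 /k3 /u2; ring.
  by rewrite ?t11 ?t22 ?t33 ?t21 ?t31 ?t32 /u2 u kv r2 /t; ring.
have e23 : M23 = v2 * k3 + t * (v1).
  transitivity (v2 * k3 + ((v3) * T11 * (- v2) + (v3) * T12 * (v1) + (- v1) * T31 * (- v2) + (- v1) * T32 * (v1)) + ((1 - u2 ^+ 2) * M23 - (1 - u2) * v2 * k3 + u2 * (M21 * v1 + M22 * v2 + M23 * v3) * v3 - v2 * v3 * (v1 * k1 + v2 * k2 + v3 * k3))).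
    by rewrite /T11 /T12 /T13 /T21 /T22 /T23 /T31 /T32 /T33 /k1 /k2 /k3 /u2; ring.
  by rewrite ?t11 ?t22 ?t33 ?t21 ?t31 ?t32 /u2 u kv r2 /t; ring.
have e31 : M31 = v3 * k1 + t * (v2).
  transitivity (v3 * k1 + ((- v2) * T12 * (- v3) + (- v2) * T13 * (v2) + (v1) * T22 * (- v3) + (v1) * T23 * (v2)) + ((1 - u2 ^+ 2) * M31 - (1 - u2) * v3 * k1 + u2 * (M31 * v1 + M32 * v2 + M33 * v3) * v1 - v3 * v1 * (v1 * k1 + v2 * k2 + v3 * k3))).
    by rewrite /T11 /T12 /T13 /T21 /T22 /T23 /T31 /T32 /T33 /k1 /k2 /k3 /u2; ring.
  by rewrite ?t11 ?t22 ?t33 ?t21 ?t31 ?t32 /u2 u kv r3 /t; ring.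
have e32 : M32 = v3 * k2 + t * (- v1).
  transitivity (v3 * k2 + ((- v2) * T11 * (v3) + (- v2) * T13 * (- v1) + (v1) * T21 * (v3) + (v1) * T23 * (- v1)) + ((1 - u2 ^+ 2) * M32 - (1 - u2) * v3 * k2 + u2 * (M31 * v1 + M32 * v2 + M33 * v3) * v2 - v3 * v2 * (v1 * k1 + v2 * k2 + v3 * k3))).
    by rewrite /T11 /T12 /T13 /T21 /T22 /T23 /T31 /T32 /T33 /k1 /k2 /k3 /u2; ring.
  by rewrite ?t11 ?t22 ?t33 ?t21 ?t31 ?t32 /u2 u kv r3 /t; ring.
have e33 : M33 = v3 * k3 + t * (0).
  transitivity (v3 * k3 + ((- v2) * T11 * (- v2) + (- v2) * T12 * (v1) + (v1) * T21 * (- v2) + (v1) * T22 * (v1)) + ((1 - u2 ^+ 2) * M33 - (1 - u2) * v3 * k3 + u2 * (M31 * v1 + M32 * v2 + M33 * v3) * v3 - v3 * v3 * (v1 * k1 + v2 * k2 + v3 * k3))).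
    by rewrite /T11 /T12 /T13 /T21 /T22 /T23 /T31 /T32 /T33 /k1 /k2 /k3 /u2; ring.
  by rewrite ?t11 ?t22 ?t33 ?t21 ?t31 ?t32 /u2 u kv r3 /t; ring.
have wt : w = t.
  rewrite /w e23 e32 e31 e13 e12 e21; transitivity (t * (v1 ^+ 2 + v2 ^+ 2 + v3 ^+ 2)); last by rewrite u; ring.
  by field.
by split=> //; split; rewrite ?wt;
  rewrite ?[LHS]e11 ?[LHS]e12 ?[LHS]e13 ?[LHS]e21 ?[LHS]e22 ?[LHS]e23 ?[LHS]e31 ?[LHS]e32 ?[LHS]e33; ring.
Qed.

(** * Smooth functions *)

Section Smooth.
Variable R : realType.

(* Unlike [Ck], [Cn k.+1] includes continuity of [f], so that [Cn k.+1] implies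
   [Cn k] and [Cn k] is stable under products. *)
Fixpoint Cn (V W : normedModType R) (k : nat) (U : set V) (f : V -> W) : Prop :=
  (forall x, U x -> {for x, continuous f}) /\
  if k is k'.+1 then
    (forall x v, U x -> derivable f x v) /\ (forall v, Cn k' U ('D_v f))
  else True.

Lemma Cn_cont (V W : normedModType R) k (U : set V) (f : V -> W) x :
  Cn k U f -> U x -> {for x, continuous f}.
Proof. by case: k => [|k] [+ _]; apply. Qed.

Lemma Cn_pred (V W : normedModType R) k (U : set V) (f : V -> W) :
  Cn k.+1 U f -> Cn k U f.
Proof.
elim: k f => [|k IH] f; first by case.
by move=> [cf [df Df]]; split=> //; split=> // v; apply/IH/Df.
Qed.

Lemma smooth_onP (V W : normedModType R) (U : set V) (f : V -> W) :
  smooth_on U f <-> forall k, Cn k U f.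
Proof.
split=> [sf k|sf].
  elim: k f sf => [|k IH] f sf; first by split=> //; exact: (sf 0%N).
  split; first exact: (sf 0%N).
  split; first exact: (sf 1%N).1.
  by move=> v; apply: IH => j; apply: (sf j.+1).2.
have h k : Cn k U f -> Ck k U f.
  elim: k f {sf} => [|k IH] f; first by case.
  by move=> [_ [df Df]]; split=> // v; apply/IH/Df.
by move=> k; apply/h/sf.
Qed.

Lemma smooth_cont (V W : normedModType R) (U : set V) (f : V -> W) x :
  smooth_on U f -> U x -> {for x, continuous f}.
Proof. by move=> sf; apply: (sf 0%N). Qed.
Lemma smooth_derivable (V W : normedModType R) (U : set V) (f : V -> W) x v :
  smooth_on U f -> U x -> derivable f x v.
Proof. by move=> sf Ux; apply: (sf 1%N).1. Qed.
Lemma smooth_derive (V W : normedModType R) (U : set V) (f : V -> W) v :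
  smooth_on U f -> smooth_on U ('D_v f).
Proof. by move=> sf k; apply: (sf k.+1).2. Qed.

Lemma eq_near_open (V : topologicalType) (W : Type) (U : set V) (f g : V -> W) x :
  open U -> (forall y, U y -> f y = g y) -> U x -> \near x, f x = g x.
Proof. by move=> oU fg Ux; apply: filterS (open_nbhs_nbhs (conj oU Ux)). Qed.

Lemma eq_derive_open (V W : normedModType R) (U : set V) (f g : V -> W) x u :
  open U -> (forall y, U y -> f y = g y) -> U x -> 'D_u f x = 'D_u g x.
Proof. by move=> oU fg Ux; apply: near_eq_derive; exact: eq_near_open fg Ux. Qed.

Section Open.
Variables (V W : normedModType R) (U : set V).
Hypothesis oU : open U.
Implicit Types f g : V -> W.

Lemma Cn_ext k f g : (forall x, U x -> f x = g x) -> Cn k U f -> Cn k U g.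
Proof.
elim: k f g => [|k IH] f g fg.
  move=> [cf _]; split=> // x Ux.
  rewrite /prop_for /continuous_at -(fg _ Ux).
  by apply: cvg_trans (cf x Ux); apply: near_eq_cvg; exact: (eq_near_open oU fg).
move=> [cf [df Df]]; split.
  move=> x Ux; rewrite /prop_for /continuous_at -(fg _ Ux).
  by apply: cvg_trans (cf x Ux); apply: near_eq_cvg; exact: (eq_near_open oU fg).
split=> [x v Ux|v].
  by apply: near_eq_derivable (df x v Ux); exact: (eq_near_open oU fg).
apply: IH (Df v) => x Ux; apply: near_eq_derive.
exact: (eq_near_open oU fg).
Qed.

Lemma smooth_ext f g : (forall x, U x -> f x = g x) -> smooth_on U f -> smooth_on U g.
Proof. by move=> fg /smooth_onP sf; apply/smooth_onP => k; apply: Cn_ext (sf k). Qed.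

Lemma Cn_cst k (a : W) : Cn k U (cst a).
Proof.
elim: k a => [|k IH] a; first by split=> // x _; exact: cvg_cst.
split; first by move=> x _; exact: cvg_cst.
split=> [x v _|v]; first exact: derivable_cst.
by apply: Cn_ext (IH 0) => x _; rewrite derive_cst.
Qed.

Lemma Cn_add k f g : Cn k U f -> Cn k U g -> Cn k U (f + g).
Proof.
elim: k f g => [|k IH] f g.
  by move=> [cf _] [cg _]; split=> // x Ux; apply: cvgD; [exact: cf|exact: cg].
move=> [cf [df Df]] [cg [dg Dg]]; split=> [x Ux|].
  by apply: cvgD; [exact: cf|exact: cg].
split=> [x v Ux|v]; first by apply: derivableD; [exact: df|exact: dg].
by apply: Cn_ext (IH _ _ (Df v) (Dg v)) => x Ux; rewrite deriveD; [|exact: df|exact: dg].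
Qed.
End Open.

Lemma smooth_sub (V W : normedModType R) (U U' : set V) (f : V -> W) :
  U' `<=` U -> smooth_on U f -> smooth_on U' f.
Proof.
move=> sub; rewrite !smooth_onP => h k; move: {h}(h k).
elim: k f => [|k IH] f; first by move=> [cf _]; split=> // x /sub; exact: cf.
move=> [cf [df Df]]; split=> [x /sub|]; first exact: cf.
by split=> [x v /sub|v]; [exact: df|apply/IH/Df].
Qed.

Lemma is_derive_linear (V W W' : normedModType R) (L : W -> W') (f : V -> W) x v :
  linear L -> continuous L -> derivable f x v -> is_derive x v (L \o f) (L ('D_v f x)).
Proof.
move=> lL cL df.
have LB u w : L (u - w) = L u - L w by rewrite addrC -scaleN1r lL scaleN1r addrC.
have L0 : L 0 = 0 by rewrite -[0]subr0 LB subrr.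
have LZ a u : L (a *: u) = a *: L u by rewrite -[a *: u]addr0 lL L0 addr0.
have h : (fun h : R => h^-1 *: (((L \o f) \o shift x) (h *: v) - (L \o f) x)) @ 0^' --> L ('D_v f x).
  have -> : (fun h : R => h^-1 *: (((L \o f) \o shift x) (h *: v) - (L \o f) x)) =
     L \o (fun h : R => h^-1 *: ((f \o shift x) (h *: v) - f x)).
    by apply/funext => h; rewrite [RHS]/= LZ LB.
  by apply: (@cvg_comp _ _ _ _ L _ _ _ _ (cL _)).
by split; [apply/cvg_ex; exists (L ('D_v f x))|exact: cvg_lim].
Qed.

Lemma Cn_linear (V W W' : normedModType R) (L : W -> W') k (U : set V) (f : V -> W) :
  open U -> linear L -> continuous L -> Cn k U f -> Cn k U (L \o f).
Proof.
move=> oU lL cL; elim: k f => [|k IH] f.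
  move=> [cf _]; split=> // x Ux; apply: continuous_comp; [exact: cf|exact: cL].
move=> [cf [df Df]]; split=> [x Ux|].
  apply: continuous_comp; [exact: cf|exact: cL].
split=> [x v Ux|v]; first by have [] := is_derive_linear lL cL (df x v Ux).
by apply: (Cn_ext oU) (IH _ (Df v)) => x Ux /=; have [_ ->] := is_derive_linear lL cL (df x v Ux).
Qed.

Lemma Cn_id (V : normedModType R) k (U : set V) : open U -> Cn k U (id : V -> V).
Proof.
move=> oU; case: k => [|k]; first by split=> // x _; exact: cvg_id.
split; first by move=> x _; exact: cvg_id.
split=> [x v _|v]; first exact: derivable_id.
by apply: Cn_ext (Cn_cst oU k v) => // x _; rewrite derive_id.
Qed.

Section Scalar.
Variables (V : normedModType R) (U : set V).
Hypothesis oU : open U.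
Implicit Types f g : V -> R.

Lemma Cn_mul k f g : Cn k U f -> Cn k U g -> Cn k U (f * g).
Proof.
elim: k f g => [|k IH] f g.
  by move=> [cf _] [cg _]; split=> // x Ux; exact: (cvgM (cf x Ux) (cg x Ux)).
move=> Cf Cg; have Cf' := Cn_pred Cf; have Cg' := Cn_pred Cg.
case: Cf Cg => [cf [df Df]] [cg [dg Dg]]; split=> [x Ux|].
  exact: (cvgM (cf x Ux) (cg x Ux)).
split=> [x v Ux|v]; first exact: derivableM (df x v Ux) (dg x v Ux).
apply: (Cn_ext oU) (Cn_add oU (IH _ _ Cf' (Dg v)) (IH _ _ Cg' (Df v))) => x Ux.
by rewrite (deriveM (df x v Ux) (dg x v Ux)).
Qed.

Lemma is_derive_comp (g : R -> R) f x v dg :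
  is_derive (f x) 1 g dg -> derivable f x v -> is_derive x v (g \o f) (dg * 'D_v f x).
Proof.
move=> [hg <-] df.
have df1 := (derivable1P f x v).1 df.
have e : (fun h : R => f (h *: v + x)) 0 = f x by rewrite scale0r add0r.
have E W (F : V -> W : normedModType R) : 'D_1 (fun h : R => F (h *: v + x)) 0 = 'D_v F x.
  rewrite /derive; set g1 := fun h => h^-1 *: _; set g2 := fun h => h^-1 *: _.
  suff -> : g1 = g2 by []; apply/funext => h; rewrite /g1 /g2 /=.
  by rewrite addr0 scale0r add0r [_%:A]mulr1.
have e0 : 0 *: v + x = x by rewrite scale0r add0r.
have dg0 : derivable g (f (0 *: v + x)) 1.
  rewrite e0; exact: hg.
have := @is_derive1_comp R g (fun h : R => f (h *: v + x)) 0 _ _ (DeriveDef dg0 erefl) (DeriveDef df1 erefl).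
move=> [h1 h2]; split; first by apply/derivable1P.
by rewrite -E h2 e E.
Qed.

(** A bootstrap: the derivative of [g \o f] is [dg \o f] times that of [f], so regularity climbs one
    order at a time as soon as [dg] is an expression in [g]. This is the case for the inverse, where
    [dg] is minus the square of [g], and for the inverse square root, where it is minus half the
    cube. *)
Lemma Cn_comp_ode (g dg : R -> R) f :
  (forall x, U x -> is_derive (f x) 1 g (dg (f x))) ->
  (forall k, Cn k U (g \o f) -> Cn k U (dg \o f)) ->
  forall k, Cn k U f -> Cn k U (g \o f).
Proof.
move=> Dg hdg.
have cont k x : Cn k U f -> U x -> {for x, continuous (g \o f)}.
  move=> Cf Ux; apply: continuous_comp; first exact: Cn_cont Cf Ux.
  apply: differentiable_continuous; apply/derivable1_diffP.
  by have [] := Dg x Ux.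
elim=> [|k IH] Cf; first by split=> // x; exact: cont Cf.
split=> [x|]; first exact: cont Cf.
have Cf' := Cn_pred Cf; case: Cf => cf [df Df].
have D x v (Ux : U x) := is_derive_comp (Dg x Ux) (df x v Ux).
split=> [x v Ux|v]; first by have [] := D x v Ux.
apply: (Cn_ext oU) (Cn_mul (hdg _ (IH Cf')) (Df v)) => x Ux /=.
by have [_ ->] := D x v Ux.
Qed.
End Scalar.

Section SmoothOps.
Variables (V : normedModType R) (U : set V).
Hypothesis oU : open U.
Implicit Types f g : V -> R.

Lemma smooth_cst (W : normedModType R) (a : W) : smooth_on U (cst a).
Proof. by apply/smooth_onP => k; exact: Cn_cst. Qed.

Lemma smooth_id : smooth_on U (id : V -> V).
Proof. by apply/smooth_onP => k; exact: Cn_id. Qed.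

Lemma smooth_linear (W W' : normedModType R) (L : W -> W') (f : V -> W) :
  linear L -> continuous L -> smooth_on U f -> smooth_on U (L \o f).
Proof. by move=> lL cL /smooth_onP sf; apply/smooth_onP => k; exact: Cn_linear. Qed.

Lemma smooth_add (W : normedModType R) (f g : V -> W) :
  smooth_on U f -> smooth_on U g -> smooth_on U (fun x => f x + g x).
Proof. by move=> /smooth_onP sf /smooth_onP sg; apply/smooth_onP => k; exact: Cn_add. Qed.

Lemma smooth_mul f g : smooth_on U f -> smooth_on U g -> smooth_on U (fun x => f x * g x).
Proof. by move=> /smooth_onP sf /smooth_onP sg; apply/smooth_onP => k; exact: Cn_mul. Qed.

Lemma smooth_opp f : smooth_on U f -> smooth_on U (fun x => - f x).
Proof.
move=> sf; apply: smooth_ext (smooth_mul (smooth_cst (-1 : R)) sf) => // x _ /=.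
by rewrite mulN1r.
Qed.

Lemma smooth_sum (W : normedModType R) n (f : 'I_n -> V -> W) :
  (forall i, smooth_on U (f i)) -> smooth_on U (fun x => \sum_i f i x).
Proof.
elim: n f => [|n IH] f sf.
  by apply: smooth_ext (smooth_cst (0 : W)) => // x _; rewrite big_ord0.
apply: (@smooth_ext _ _ _ oU (fun x => f ord0 x + \sum_i f (lift ord0 i) x)).
  by move=> x _; rewrite big_ord_recl.
by apply: smooth_add => //; apply: IH.
Qed.

Lemma smooth_inv f : (forall x, U x -> f x != 0) -> smooth_on U f ->
  smooth_on U (fun x => (f x)^-1).
Proof.
move=> f0 /smooth_onP sf; apply/smooth_onP => k.
apply: (@Cn_comp_ode _ _ oU (@GRing.inv R) (fun y => - (y^-1 * y^-1))) => //.
  move=> x Ux; split; first by apply: derivableV => //; exact: f0.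
  by rewrite deriveV ?f0// derive_id [_ *: _]mulr1 -exprVn expr2.
move=> {}k h; apply: (Cn_ext oU) (Cn_mul oU (Cn_cst oU k (-1 : R)) (Cn_mul oU h h)).
by move=> x Ux; rewrite /= [LHS]mulN1r.
Qed.

Lemma is_derive_rsqrt (y : R) : 0 < y ->
  is_derive y 1 (fun y => (Num.sqrt y)^-1) (- 2^-1 * ((Num.sqrt y)^-1 * ((Num.sqrt y)^-1 * (Num.sqrt y)^-1))).
Proof.
move=> y0; have [d1 d2] := is_derive1_sqrt y0.
have sy : Num.sqrt y != 0 by rewrite gt_eqF // sqrtr_gt0.
split; first exact: derivableV.
by rewrite deriveV // d2 [_ *: _]mulrC; field.
Qed.

Lemma smooth_rsqrt f : (forall x, U x -> 0 < f x) -> smooth_on U f ->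
  smooth_on U (fun x => (Num.sqrt (f x))^-1).
Proof.
move=> f0 /smooth_onP sf; apply/smooth_onP => k.
refine (@Cn_comp_ode V U oU (fun y => (Num.sqrt y)^-1)
  (fun y => - 2^-1 * ((Num.sqrt y)^-1 * ((Num.sqrt y)^-1 * (Num.sqrt y)^-1))) f _ _ k (sf k)).
  by move=> x Ux; apply: is_derive_rsqrt; exact: f0.
move=> {}k h.
exact: (Cn_mul oU (Cn_cst oU k (- 2^-1 : R)) (Cn_mul oU h (Cn_mul oU h h))).
Qed.

(** Both at once, because each is the derivative of the other up to sign. *)
Lemma Cn_cos_sin k f : Cn k U f -> Cn k U (@cos R \o f) /\ Cn k U (@sin R \o f).
Proof.
elim: k => [|k IH] Cf.
  by split; split=> // x Ux; apply: continuous_comp; try exact: Cn_cont Cf Ux;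
    [exact: continuous_cos|exact: continuous_sin].
have [Cc Cs] := IH (Cn_pred Cf).
have cont := fun x Ux => @Cn_cont _ _ k.+1 U f x Cf Ux.
case: Cf => _ [df Df].
have Dc x v (Ux : U x) := is_derive_comp (is_derive_cos (f x)) (df x v Ux).
have Ds x v (Ux : U x) := is_derive_comp (is_derive_sin (f x)) (df x v Ux).
split; split.
- by move=> x Ux; apply: continuous_comp; [exact: cont|exact: continuous_cos].
- split=> [x v Ux|v]; first by have [] := Dc x v Ux.
  apply: (Cn_ext oU) (Cn_mul oU (Cn_mul oU (Cn_cst oU k (-1 : R)) Cs) (Df v)) => x Ux.
  by have [_ ->] := Dc x v Ux; rewrite -[- sin _]mulN1r.
- by move=> x Ux; apply: continuous_comp; [exact: cont|exact: continuous_sin].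
- split=> [x v Ux|v]; first by have [] := Ds x v Ux.
  apply: (Cn_ext oU) (Cn_mul oU Cc (Df v)) => x Ux.
  by have [_ ->] := Ds x v Ux.
Qed.

Lemma smooth_cos f : smooth_on U f -> smooth_on U (fun x => cos (f x)).
Proof. by move=> /smooth_onP sf; apply/smooth_onP => k; have [] := Cn_cos_sin (sf k). Qed.
Lemma smooth_sin f : smooth_on U f -> smooth_on U (fun x => sin (f x)).
Proof. by move=> /smooth_onP sf; apply/smooth_onP => k; have [] := Cn_cos_sin (sf k). Qed.
End SmoothOps.

Section Rows.
Variables (V : normedModType R) (U : set V).
Hypothesis oU : open U.

Lemma linear_coord n (i : 'I_n) : linear (fun x : 'rV[R]_n => x 0 i : R).
Proof. by move=> a u v; rewrite !mxE. Qed.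

Lemma smooth_coord n (f : V -> 'rV[R]_n) i : smooth_on U f -> smooth_on U (fun x => f x 0 i).
Proof. exact: (smooth_linear oU (linear_coord i) (@coord_continuous R 1 n 0 i)). Qed.

Lemma smooth_scalev (W : normedModType R) (f : V -> R) (w : W) :
  smooth_on U f -> smooth_on U (fun x => f x *: w).
Proof.
apply: (smooth_linear oU (L := fun a : R => a *: w)).
  by move=> a u v; rewrite scalerDl scalerA.
exact: scalel_continuous.
Qed.

Lemma smooth_row n (f : V -> 'rV[R]_n) :
  (forall i, smooth_on U (fun x => f x 0 i)) -> smooth_on U f.
Proof.
move=> sf; apply: (smooth_ext oU) (smooth_sum oU (fun i => smooth_scalev (delta_mx 0 i) (sf i))).
by move=> x _; rewrite -row_sum_delta.
Qed.

Lemma derive_coord n (f : V -> 'rV[R]_n) x v i : derivable f x v ->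
  'D_v f x 0 i = 'D_v (fun y => f y 0 i) x.
Proof. by move=> df; rewrite derive_mx // mxE. Qed.
End Rows.
End Smooth.

(** * Additivity of the derivative in the direction, symmetry of second derivatives *)

Section Directional.
Variable R : realType.

Lemma is_derive_line (V W : normedModType R) (f : V -> W) x v (s : R) :
  derivable f (s *: v + x) v ->
  is_derive s 1 (fun h : R => f (h *: v + x)) ('D_v f (s *: v + x)).
Proof.
move=> df; set g := fun h : R => _.
have E : (fun h : R => h^-1 *: ((g \o shift s) (h *: 1) - g s)) =
  (fun h : R => h^-1 *: ((f \o shift (s *: v + x)) (h *: v) - f (s *: v + x))).
  by apply/funext => h; rewrite /g /= [_%:A]mulr1 scalerDl addrA.
by split; rewrite /derivable /derive E.
Qed.

Lemma MVT0 (g dg : R -> R) (t : R) :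
  (forall s : R, `|s| <= `|t| -> is_derive s 1 g (dg s)) ->
  exists2 s : R, `|s| <= `|t| & g t - g 0 = dg s * t.
Proof.
move=> Dg.
have cg (s : R) : `|s| <= `|t| -> {for s, continuous g}.
  move=> /Dg[h _]; exact/differentiable_continuous/derivable1_diffP.
have mvt a b : a < b -> (forall s, a <= s <= b -> `|s| <= `|t|) ->
    exists2 s : R, `|s| <= `|t| & g b - g a = dg s * (b - a).
  move=> ab hab; have [||c] := @MVT R g dg a b ab _ _.
  - by move=> s; rewrite in_itv /= => /andP[h1 h2]; apply: Dg; apply: hab; rewrite !ltW.
  - apply: continuous_in_subspaceT => s; rewrite inE /= in_itv /= => /andP[h1 h2].
    by apply: cg; apply: hab; rewrite h1.
  by rewrite in_itv /= => /andP[h1 h2] ->; exists c => //; apply: hab; rewrite !ltW.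
have [t0|t0|->] := ltgtP t 0.
- have [|s hs E] := mvt t 0 t0.
    by move=> s /andP[h1 h2]; rewrite (ltr0_norm t0) ler_norml; apply/andP; split; lra.
  by exists s => //; rewrite -[LHS]opprB E; ring.
- have [|s hs E] := mvt 0 t t0.
    by move=> s /andP[h1 h2]; rewrite (gtr0_norm t0) ler_norml; apply/andP; split; lra.
  by exists s => //; rewrite E subr0.
- by exists 0; rewrite ?normr0 // subrr mulr0.
Qed.

Section Fixed.
Variables (V : normedModType R) (U : set V) (oU : open U).

Lemma small_comb (x u v : V) (P : set V) : nbhs x P ->
  exists2 d : R, 0 < d & forall s t, `|s| <= d -> `|t| <= d -> P (s *: u + (t *: v + x)).
Proof.
move=> /nbhs_ballP[r /= r0 rP].
pose M := `|u| + `|v| + 1.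
have M0 : 0 < M by rewrite /M ltr_wpDl.
exists (r / 2 / M); first by rewrite !divr_gt0.
move=> s t hs ht; apply: rP; rewrite -ball_normE /ball_ /= addrA opprD addrCA subrr addr0 normrN.
apply: (le_lt_trans (ler_normD _ _)); rewrite !normrZ.
have h1 : `|s| * `|u| <= r / 2 / M * `|u| by rewrite ler_wpM2r.
have h2 : `|t| * `|v| <= r / 2 / M * `|v| by rewrite ler_wpM2r.
apply: (le_lt_trans (lerD h1 h2)); rewrite -mulrDr.
apply: (@lt_trans _ _ (r / 2 / M * M)).
  by rewrite ltr_pM2l ?divr_gt0 // /M ltrDl.
by rewrite divfK ?gt_eqF // ltr_pdivrMr // ltr_pMr // ltr1n.
Qed.

Variables (f : V -> R) (sf : smooth_on U f).

(** Directional derivatives alone need not be additive in the direction; the continuity of ['D_u f]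
    is what makes them so. The increment is split at [t *: v + x], and the mean value theorem
    compares its [u] part [A t] with ['D_u f] near [x]. *)
Lemma deriveDdir x u v : U x -> 'D_(u + v) f x = 'D_u f x + 'D_v f x.
Proof.
move=> Ux; apply: cvg_lim => //.
have UN : nbhs x U by exact: open_nbhs_nbhs.
pose A t := t^-1 * (f (t *: u + (t *: v + x)) - f (t *: v + x)).
pose B t := t^-1 *: ((f \o shift x) (t *: v) - f x).
have -> : (fun h : R => h^-1 *: ((f \o shift x) (h *: (u + v)) - f x)) = (fun t => A t + B t).
  apply/funext => t; rewrite /A /B -[_^-1 * _]/(_ *: _) -scalerDr; congr (_ *: _).
  by rewrite /= addrA subrK scalerDr addrA.
have cB : B @ 0^' --> 'D_v f x.
  by have h : derivable f x v := smooth_derivable sf Ux; exact: h.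
apply: cvgD cB.
apply/cvgrPdist_lt => e e0.
have cD := smooth_cont (smooth_derive u sf) Ux.
have [d d0 dP] := small_comb u v (filterI UN ((cvgrPdist_lt _ _).1 cD e e0)).
near=> t.
have t0 : t != 0 by near: t; exact: nbhs_dnbhs_neq.
have td : `|t| <= d by near: t; apply: dnbhs0_le.
have [|s st E] := @MVT0 (fun h => f (h *: u + (t *: v + x)))
   (fun s => 'D_u f (s *: u + (t *: v + x))) t.
  move=> s st; apply: is_derive_line; apply: smooth_derivable sf _.
  by have [] := dP s t (le_trans st td) td.
move: E; rewrite scale0r add0r => E.
rewrite /A E mulrC mulfK //.
by have [] := dP s t (le_trans st td) td.
Unshelve. all: by end_near. Qed.

Lemma deriveZdir x (a : R) v : U x -> 'D_(a *: v) f x = a * 'D_v f x.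
Proof.
move=> Ux.
have d0 : derivable f (0 *: v + x) v by rewrite scale0r add0r; exact: smooth_derivable.
have := is_derive_line d0.
rewrite -[0](mulr0 a) => h.
have ha : is_derive (0 : R) 1 (fun h : R => a * h) a.
  by apply: is_derive_eq; rewrite [_ *: _]mulr1.
have [_] := @is_derive1_comp R _ _ 0 _ _ h ha.
rewrite mulr0 scale0r add0r mulrC => <-.
rewrite /derive; congr (lim (_ @ 0^')); apply/funext => t /=.
by rewrite addr0 mulr0 scale0r add0r [_%:A]mulr1 scalerA [a * t]mulrC.
Qed.

Lemma derive_mixed_mvt x u v (d : R) : 0 < d ->
  (forall s t, `|s| <= d -> `|t| <= d -> U (s *: u + (t *: v + x))) ->
  exists s t, [/\ `|s| <= d, `|t| <= d &
    f (d *: u + (d *: v + x)) - f (d *: v + x) - (f (d *: u + x) - f x)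
    = 'D_v ('D_u f) (s *: u + (t *: v + x)) * d * d].
Proof.
move=> d0 hU; have dd : `|d| = d by rewrite gtr0_norm.
have U0 s : `|s| <= d -> U (s *: u + x).
  by move=> sd; have := hU s 0 sd; rewrite scale0r add0r; apply; rewrite normr0 ltW.
have [|s sd E] := @MVT0 (fun h => f (h *: u + (d *: v + x)) - f (h *: u + x))
   (fun s => 'D_u f (s *: u + (d *: v + x)) - 'D_u f (s *: u + x)) d.
  move=> s; rewrite dd => sd; apply: is_deriveB.
    by apply: is_derive_line; apply: smooth_derivable sf _; apply: hU; rewrite ?dd.
  by apply: is_derive_line; apply: smooth_derivable sf _; exact: U0.
rewrite dd in sd.
have [|t td E2] := @MVT0 (fun h => 'D_u f (h *: v + (s *: u + x)))
   (fun t => 'D_v ('D_u f) (t *: v + (s *: u + x))) d.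
  move=> t; rewrite dd => td; apply: is_derive_line; apply: smooth_derivable (smooth_derive u sf) _.
  by rewrite addrCA; exact: hU.
rewrite dd in td.
exists s, t; split => //; rewrite !scale0r !add0r in E E2.
rewrite addrCA [t *: v + _]addrCA in E2.
transitivity (f (d *: u + (d *: v + x)) - f (d *: u + x) - (f (d *: v + x) - f x)); first by ring.
by rewrite E E2.
Qed.
End Fixed.

(** By [derive_mixed_mvt] the second difference of [f] over a small parallelogram equals [d * d]
    times either mixed derivative, each at some point of the parallelogram. If the two differed at
    [x], continuity up to half the gap would be contradicted. *)
Lemma derive_swap (V : normedModType R) (U : set V) (f : V -> R) x u v :
  open U -> smooth_on U f -> U x -> 'D_u ('D_v f) x = 'D_v ('D_u f) x.
Proof.
move=> oU sf Ux.
have UN : nbhs x U by exact: open_nbhs_nbhs.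
apply/eqP; rewrite -subr_eq0 -normr_eq0; apply/negP => /negP ne.
have {ne} e0 : 0 < `|'D_u ('D_v f) x - 'D_v ('D_u f) x| / 2.
  by rewrite divr_gt0 // lt_def ne /=.
set e := _ / 2 in e0.
have c1 := smooth_cont (smooth_derive u (smooth_derive v sf)) Ux.
have c2 := smooth_cont (smooth_derive v (smooth_derive u sf)) Ux.
have [d1 d10 dP1] := small_comb v u (filterI UN ((cvgrPdist_lt _ _).1 c1 e e0)).
have [d2 d20 dP2] := small_comb u v (filterI UN ((cvgrPdist_lt _ _).1 c2 e e0)).
pose d := Num.min d1 d2; have d0 : 0 < d by rewrite lt_min d10.
have l1 (s : R) : `|s| <= d -> `|s| <= d1 by move=> h; apply: le_trans h _; rewrite ge_min lexx.
have l2 (s : R) : `|s| <= d -> `|s| <= d2 by move=> h; apply: le_trans h _; rewrite ge_min lexx orbT.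
clearbody d.
have [|s1 [t1 [h1 h2 E1]]] := @derive_mixed_mvt V U f sf x v u d d0.
  by move=> s t /l1 hs /l1 ht; have [] := dP1 s t hs ht.
have [|s2 [t2 [h3 h4 E2]]] := @derive_mixed_mvt V U f sf x u v d d0.
  by move=> s t /l2 hs /l2 ht; have [] := dP2 s t hs ht.
have [_ i1] := dP1 s1 t1 (l1 _ h1) (l1 _ h2).
have [_ i2] := dP2 s2 t2 (l2 _ h3) (l2 _ h4).
set p := 'D_u ('D_v f) (s1 *: v + (t1 *: u + x)) in i1 E1.
set q := 'D_v ('D_u f) (s2 *: u + (t2 *: v + x)) in i2 E2.
have pq : p = q.
  have sw (a b a' b' : R) : a - b - (a' - b') = a - a' - (b - b') by ring.
  have E0 := addrCA (d *: v) (d *: u) x.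
  rewrite E0 in E1; have E3 := etrans (esym E1) (etrans (sw _ _ _ _) E2).
  exact: (mulIf (lt0r_neq0 d0) (mulIf (lt0r_neq0 d0) E3)).
clear E1 E2; move: i1 i2; rewrite /= -/p -/q -pq /e {pq q}.
move: ('D_u ('D_v f) x) ('D_v ('D_u f) x) p => a b c i1 i2.
have : `|a - b| <= `|a - c| + `|b - c|.
  by rewrite [`|b - c|]distrC -[a - b](subrKA c) ler_normD.
by move: i1 i2; move: `|a - b| `|a - c| `|b - c| => r1 r2 r3; lra.
Qed.
End Directional.

(** * The ring of smooth functions on an open set *)

(* Functions are extended by 0 outside of W, so that equality in this ring is
   equality on W. *)
Record smfun (R : realType) (V : normedModType R) (W : set V) (oW : open W) := SmFun {
  smval :> V -> R;
  sm_smooth : smooth_on W smval;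
  sm_out : forall x, ~ W x -> smval x = 0 }.

Section SmoothRing.
Variables (R : realType) (V : normedModType R) (W : set V) (oW : open W).
Local Notation A := (smfun oW).

Lemma smfun_eq (f g : A) : (forall x, W x -> f x = g x) -> f = g.
Proof.
case: f g => [f sf zf] [g sg zg] /= fg.
have e : f = g.
  by apply/funext => x; have [/fg//|nW] := pselect (W x); rewrite zf // zg.
by subst g; congr SmFun; exact: Prop_irrelevance.
Qed.

HB.instance Definition _ := gen_eqMixin A.
HB.instance Definition _ := gen_choiceMixin A.

Lemma restr_subproof (f : V -> R) : smooth_on W f ->
  smooth_on W (fun x => if `[< W x >] then f x else 0).
Proof. by apply: smooth_ext => // x Wx; case: asboolP. Qed.

Definition sm_of (f : V -> R) (sf : smooth_on W f) : A :=
  @SmFun _ _ _ oW _ (restr_subproof sf) (fun x nW => ifF _ _ (introF (asboolP _) nW)).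

Lemma sm_ofE f (sf : smooth_on W f) x : W x -> sm_of sf x = f x.
Proof. by move=> Wx /=; case: asboolP. Qed.

Definition sm0 : A := sm_of (smooth_cst oW (0 : R)).
Definition sm1 : A := sm_of (smooth_cst oW (1 : R)).
Definition smopp (f : A) : A := sm_of (smooth_opp oW (sm_smooth f)).
Definition smadd (f g : A) : A := sm_of (smooth_add oW (sm_smooth f) (sm_smooth g)).
Definition smmul (f g : A) : A := sm_of (smooth_mul oW (sm_smooth f) (sm_smooth g)).

Lemma smaddA : associative smadd.
Proof. by move=> f g h; apply: smfun_eq => x Wx; rewrite !sm_ofE //; ring. Qed.
Lemma smaddC : commutative smadd.
Proof. by move=> f g; apply: smfun_eq => x Wx; rewrite !sm_ofE //; ring. Qed.
Lemma smadd0 : left_id sm0 smadd.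
Proof. by move=> f; apply: smfun_eq => x Wx; rewrite !sm_ofE //= /cst; ring. Qed.
Lemma smaddN : left_inverse sm0 smopp smadd.
Proof. by move=> f; apply: smfun_eq => x Wx; rewrite !sm_ofE //= /cst; ring. Qed.
HB.instance Definition _ := GRing.isZmodule.Build A smaddA smaddC smadd0 smaddN.

Lemma smmulA : associative smmul.
Proof. by move=> f g h; apply: smfun_eq => x Wx; rewrite !sm_ofE //; ring. Qed.
Lemma smmulC : commutative smmul.
Proof. by move=> f g; apply: smfun_eq => x Wx; rewrite !sm_ofE //; ring. Qed.
Lemma smmul1 : left_id sm1 smmul.
Proof. by move=> f; apply: smfun_eq => x Wx; rewrite !sm_ofE //= /cst; ring. Qed.
Lemma smmulD : left_distributive smmul smadd.
Proof. by move=> f g h; apply: smfun_eq => x Wx; rewrite !sm_ofE //; ring. Qed.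
HB.instance Definition _ := GRing.Zmodule_isComPzRing.Build A smmulA smmulC smmul1 smmulD.

Section Eval.
Variables (x : V) (Wx : W x).
Lemma smD (f g : A) : (f + g) x = f x + g x. Proof. exact: sm_ofE. Qed.
Lemma smM (f g : A) : (f * g) x = f x * g x. Proof. exact: sm_ofE. Qed.
Lemma smN (f : A) : (- f) x = - f x. Proof. exact: sm_ofE. Qed.
Lemma smB (f g : A) : (f - g) x = f x - g x. Proof. by rewrite smD smN. Qed.
Lemma sm1E : (1 : A) x = 1. Proof. exact: sm_ofE. Qed.
Lemma sm0E : (0 : A) x = 0. Proof. exact: sm_ofE. Qed.
Lemma smX (f : A) n : (f ^+ n) x = f x ^+ n.
Proof. by elim: n => [|n IH]; rewrite ?expr0 ?sm1E // !exprS smM IH. Qed.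
Lemma smnat n : (n%:R : A) x = n%:R.
Proof. by elim: n => [|n IH]; rewrite ?sm0E // -!natr1 smD sm1E IH. Qed.
Lemma evD (f g : A) a b : f x = a -> g x = b -> (f + g) x = a + b.
Proof. by move=> <- <-; exact: smD. Qed.
Lemma evB (f g : A) a b : f x = a -> g x = b -> (f - g) x = a - b.
Proof. by move=> <- <-; exact: smB. Qed.
Lemma evM (f g : A) a b : f x = a -> g x = b -> (f * g) x = a * b.
Proof. by move=> <- <-; exact: smM. Qed.
Definition smE := (smB, smD, smM, smX, smN, smnat, sm1E, sm0E).
End Eval.

Lemma regular_smfun (f : A) : (forall x, W x -> f x != 0) -> regular f.
Proof.
move=> f0 g fg; apply: smfun_eq => x Wx; apply: (mulfI (f0 x Wx)).
by rewrite sm0E // mulr0 -smM // fg sm0E.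
Qed.

Lemma smfun_reduced (f : A) : f * f = 0 -> f = 0.
Proof.
move=> ff; apply: smfun_eq => x Wx; apply/eqP.
by have := congr1 (fun h : A => h x) ff; rewrite (smM Wx) (sm0E Wx) => /eqP; rewrite mulf_eq0 orbb.
Qed.

(** This turns an algebraic contradiction into geometry: an open set on which the elimination proves
    [1 = 0] has no points. *)
Lemma smfun_nontrivial : (1 : A) = 0 -> forall x, ~ W x.
Proof.
move=> e x Wx; have := congr1 (fun h : A => h x) e.
by rewrite (sm1E Wx) (sm0E Wx) => /eqP; rewrite oner_eq0.
Qed.

Lemma regular_nat n : regular (n.+1%:R : A).
Proof. by apply: regular_smfun => x Wx; rewrite (smnat Wx) pnatr_eq0. Qed.
End SmoothRing.

Section DeriveRules.
Variables (R : realType) (V : normedModType R).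
Implicit Types f g : V -> R.
Lemma deriveDf f g x v : derivable f x v -> derivable g x v ->
  'D_v (fun y => f y + g y) x = 'D_v f x + 'D_v g x.
Proof. exact: deriveD. Qed.
Lemma deriveMf f g x v : derivable f x v -> derivable g x v ->
  'D_v (fun y => f y * g y) x = 'D_v f x * g x + f x * 'D_v g x.
Proof. by move=> df dg; rewrite [LHS](deriveM df dg) addrC -[g x *: _]mulrC. Qed.
End DeriveRules.

Section LinearFields.
Variables (R : realType) (n : nat).
Local Notation E := 'rV[R]_n.+1.
Variables (W : set E) (oW : open W).

Lemma derive_sum_coord (f : E -> R) x u : smooth_on W f -> W x ->
  'D_u f x = \sum_i u 0 i * 'D_(delta_mx 0 i) f x.
Proof.
move=> sf Wx; rewrite {1}(row_sum_delta u).
have add := fun u v => @deriveDdir R _ W oW f sf x u v Wx.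
have scal := fun a v => @deriveZdir R _ W f sf x a v Wx.
elim/big_ind2: _ => [|u1 a1 u2 a2 <- <-|i _]; first exact: derive0.
- exact: add.
- exact: scal.
Qed.

Lemma smooth_id_coord i : smooth_on W (fun x : E => x 0 i).
Proof. by apply: smooth_coord => //; exact: smooth_id. Qed.

Lemma derive_linear_coord (F : E -> E) x u i : linear F -> continuous F ->
  is_derive x u (fun y => F y 0 i) (F u 0 i).
Proof.
move=> lF cF; have := @is_derive_linear R E E E F id x u lF cF (@derivable_id _ _ x u).
rewrite derive_id => -[d1 d2]; split; first exact: (derivable_mxP _ _ _).1.
by rewrite -(derive_coord _ d1) d2.
Qed.

Lemma smooth_derive_field (F : E -> E) (f : E -> R) : linear F -> continuous F ->
  smooth_on W f -> smooth_on W (fun x => 'D_(F x) f x).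
Proof.
move=> lF cF sf.
apply: (@smooth_ext _ _ _ _ oW (fun x => \sum_i F x 0 i * 'D_(delta_mx 0 i) f x)).
  by move=> x Wx; rewrite -derive_sum_coord.
apply: smooth_sum => // i; apply: smooth_mul => //; last exact: smooth_derive.
apply: smooth_coord => //.
exact: (smooth_linear oW lF cF (smooth_id oW)).
Qed.

(** The first term differentiates the linear field, whose derivative along [u] is [F u]; in the
    second the field is frozen at [x]. *)
Lemma derive_derive_field (F : E -> E) (f : E -> R) x u : linear F -> continuous F ->
  smooth_on W f -> W x ->
  'D_u (fun y => 'D_(F y) f y) x = 'D_(F u) f x + 'D_u ('D_(F x) f) x.
Proof.
move=> lF cF sf Wx.
have e : \near x, 'D_(F x) f x = \sum_i F x 0 i * 'D_(delta_mx 0 i) f x.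
  by apply: eq_near_open Wx => // y Wy; exact: derive_sum_coord.
rewrite (near_eq_derive _ e).
have d i := derive_linear_coord x u i lF cF.
have di i : derivable (fun y => F y 0 i) x u by have [] := d i.
have Di i : 'D_u (fun y => F y 0 i) x = F u 0 i by have [] := d i.
have d' i : derivable ('D_(delta_mx 0 i) f) x u.
  exact: (smooth_derivable (smooth_derive _ sf) Wx).
have -> : (fun x => \sum_i F x 0 i * 'D_(delta_mx 0 i) f x) =
   \sum_i (fun x => F x 0 i * 'D_(delta_mx 0 i) f x).
  by apply/funext => y; rewrite fct_sumE.
rewrite derive_sum; last first.
  by move=> i; exact: derivableM (di i) (d' i).
rewrite (eq_bigr (fun i => F u 0 i * 'D_(delta_mx 0 i) f x
  + F x 0 i * 'D_(delta_mx 0 i) ('D_u f) x)); last first.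
  by move=> i _; rewrite (deriveMf (di i) (d' i)) Di (derive_swap _ _ oW sf Wx).
rewrite big_split /= -(derive_sum_coord _ sf Wx); congr (_ + _).
rewrite -(derive_sum_coord _ (smooth_derive u sf) Wx).
by rewrite (derive_swap _ _ oW sf Wx).
Qed.

Lemma field_commutator (F G : E -> E) (f : E -> R) x :
  linear F -> continuous F -> linear G -> continuous G -> smooth_on W f -> W x ->
  'D_(F x) (fun y => 'D_(G y) f y) x - 'D_(G x) (fun y => 'D_(F y) f y) x
  = 'D_(G (F x)) f x - 'D_(F (G x)) f x.
Proof.
move=> lF cF lG cG sf Wx.
rewrite (derive_derive_field _ lG cG sf Wx) (derive_derive_field _ lF cF sf Wx).
by rewrite (derive_swap _ _ oW sf Wx); ring.
Qed.
End LinearFields.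

(** * The left-invariant frame *)

Section Row4.
Variable R : realType.
Local Notation R4 := 'rV[R]_4.

Definition row4 (a b c d : R) : R4 := \row_j [:: a; b; c; d]`_j.

Lemma row4E0 a b c d : row4 a b c d 0 0 = a. Proof. by rewrite mxE. Qed.
Lemma row4E1 a b c d : row4 a b c d 0 1 = b. Proof. by rewrite mxE. Qed.
Lemma row4E2 a b c d : row4 a b c d 0 2%:R = c. Proof. by rewrite mxE. Qed.
Lemma row4E3 a b c d : row4 a b c d 0 3%:R = d. Proof. by rewrite mxE. Qed.
Definition row4E := (row4E0, row4E1, row4E2, row4E3).

Lemma ord4P (P : 'I_4 -> Prop) : P 0 -> P 1 -> P 2%:R -> P 3%:R -> forall i, P i.
Proof.
move=> p0 p1 p2 p3 [[|[|[|[|//]]]] hi].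
- by have <- : 0 = Ordinal hi by exact: val_inj.
- by have <- : 1 = Ordinal hi by exact: val_inj.
- by have <- : 2%:R = Ordinal hi by exact: val_inj.
- by have <- : 3%:R = Ordinal hi by exact: val_inj.
Qed.

Lemma row4P (u v : R4) : u 0 0 = v 0 0 -> u 0 1 = v 0 1 -> u 0 2%:R = v 0 2%:R ->
  u 0 3%:R = v 0 3%:R -> u = v.
Proof. by move=> h0 h1 h2 h3; apply/rowP; exact: ord4P. Qed.

Lemma sum4E (W : nmodType) (F : 'I_4 -> W) : \sum_i F i = F 0 + F 1 + F 2%:R + F 3%:R.
Proof.
rewrite !big_ord_recl big_ord0 addr0 !addrA.
by congr (_ + F _ + F _ + F _); apply: val_inj.
Qed.

Lemma dotE (u v : R4) : dot u v = u 0 0 * v 0 0 + u 0 1 * v 0 1 + u 0 2%:R * v 0 2%:R + u 0 3%:R * v 0 3%:R.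
Proof. exact: sum4E. Qed.

Lemma hopfE (p : R4) : hopf p = row4 (- p 0 1) (p 0 0) (- p 0 3%:R) (p 0 2%:R).
Proof. by []. Qed.

(* (-conj w, conj z) and (i conj w, -i conj z): together with [hopf] they are
   invariant under the action of SU(2). *)
Definition jfield (p : R4) : R4 := row4 (- p 0 2%:R) (p 0 3%:R) (p 0 0) (- p 0 1).
Definition kfield (p : R4) : R4 := row4 (p 0 3%:R) (p 0 2%:R) (- p 0 1) (- p 0 0).

Lemma mxD4 (u v : R4) i : (u + v) 0 i = u 0 i + v 0 i. Proof. by rewrite mxE. Qed.
Lemma mxB4 (u v : R4) i : (u - v) 0 i = u 0 i - v 0 i. Proof. by rewrite !mxE. Qed.
Lemma mxN4 (u : R4) i : (- u) 0 i = - u 0 i. Proof. by rewrite mxE. Qed.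
Lemma mxZ4 a (u : R4) i : (a *: u) 0 i = a * u 0 i. Proof. by rewrite mxE. Qed.
Definition mxE4 := (mxB4, mxD4, mxN4, mxZ4).

Ltac row4_linear := move=> a u v; apply: row4P; rewrite /jfield /kfield ?hopfE ?(mxE4, row4E); ring.
Lemma linear_hopf : linear (@hopf R). Proof. row4_linear. Qed.
Lemma linear_jfield : linear jfield. Proof. row4_linear. Qed.
Lemma linear_kfield : linear kfield. Proof. row4_linear. Qed.

Lemma smooth_row4 (V : normedModType R) (U : set V) (a b c d : V -> R) : open U ->
  smooth_on U a -> smooth_on U b -> smooth_on U c -> smooth_on U d ->
  smooth_on U (fun x => row4 (a x) (b x) (c x) (d x)).
Proof.
move=> oU sa sb sc sd; apply: smooth_row => //; apply: ord4P.
- by apply: smooth_ext sa => // x _; rewrite row4E.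
- by apply: smooth_ext sb => // x _; rewrite row4E.
- by apply: smooth_ext sc => // x _; rewrite row4E.
- by apply: smooth_ext sd => // x _; rewrite row4E.
Qed.

Lemma smooth_setT_continuous (V W : normedModType R) (f : V -> W) :
  smooth_on setT f -> continuous f.
Proof. by move=> sf x; apply: smooth_cont sf _. Qed.

Let c0 (i : 'I_4) := @smooth_id_coord R 3 setT openT i.
Lemma continuous_hopf : continuous (@hopf R).
Proof. by apply: smooth_setT_continuous; apply: smooth_row4; do ?apply: smooth_opp => //; try exact: openT; exact: c0. Qed.
Lemma continuous_jfield : continuous jfield.
Proof. by apply: smooth_setT_continuous; apply: smooth_row4; do ?apply: smooth_opp => //; try exact: openT; exact: c0. Qed.
Lemma continuous_kfield : continuous kfield.
Proof. by apply: smooth_setT_continuous; apply: smooth_row4; do ?apply: smooth_opp => //; try exact: openT; exact: c0. Qed.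
End Row4.

Section Frame.
Variables (R : realType) (eps : R) (eps_gt0 : 0 < eps).
Local Notation R4 := 'rV[R]_4.
Let sq := Num.sqrt eps.

(** Derivatives along a Berger-orthonormal frame, extended to [R4] by linear fields so that
    differentiation takes place on open subsets of the ambient space. The scalings follow from
    [hopf], [jfield], [kfield] being orthonormal for the round metric on the sphere. *)
Definition d1 (f : R4 -> R) (x : R4) : R := eps^-1 * 'D_(hopf x) f x.
Definition d2 (f : R4 -> R) (x : R4) : R := sq^-1 * 'D_(jfield x) f x.
Definition d3 (f : R4 -> R) (x : R4) : R := sq^-1 * 'D_(kfield x) f x.

Section Open.
Variables (W : set R4) (oW : open W).

Lemma smooth_d1 f : smooth_on W f -> smooth_on W (d1 f).
Proof.
move=> sf; apply: smooth_mul => //; first exact: (smooth_cst oW).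
exact: smooth_derive_field (@linear_hopf R) (@continuous_hopf R) sf.
Qed.
Lemma smooth_d2 f : smooth_on W f -> smooth_on W (d2 f).
Proof.
move=> sf; apply: smooth_mul => //; first exact: (smooth_cst oW).
exact: smooth_derive_field (@linear_jfield R) (@continuous_jfield R) sf.
Qed.
Lemma smooth_d3 f : smooth_on W f -> smooth_on W (d3 f).
Proof.
move=> sf; apply: smooth_mul => //; first exact: (smooth_cst oW).
exact: smooth_derive_field (@linear_kfield R) (@continuous_kfield R) sf.
Qed.

Lemma d_commutator (F G : R4 -> R4) (a b : R) (f : R4 -> R) (x : R4) : linear F -> continuous F -> linear G -> continuous G ->
  smooth_on W f -> W x ->
  a * 'D_(F x) (fun y => b * 'D_(G y) f y) x - b * 'D_(G x) (fun y => a * 'D_(F y) f y) x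
  = a * b * 'D_(G (F x) - F (G x)) f x.
Proof.
move=> lF cF lG cG sf Wx.
have sG := smooth_derive_field oW lG cG sf; have sF := smooth_derive_field oW lF cF sf.
have Z (h : R4 -> R) (c : R) u : smooth_on W h -> 'D_u (fun y => c * h y) x = c * 'D_u h x.
  by move=> sh; apply: deriveZ; exact: smooth_derivable sh Wx.
have -> : 'D_(G (F x) - F (G x)) f x = 'D_(G (F x)) f x - 'D_(F (G x)) f x.
  by rewrite -[in LHS]scaleN1r (deriveDdir oW sf _ _ Wx) (deriveZdir sf _ _ Wx) mulN1r.
rewrite !Z //.
have := field_commutator oW lF cF lG cG sf Wx.
move: ('D_(F x) _ x) ('D_(G x) _ x) ('D_(G (F x)) _ x) ('D_(F (G x)) _ x) => r1 r2 r3 r4 h.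
by rewrite -h; ring.
Qed.

Let sq2 : sq * sq = eps. Proof. by rewrite -expr2 sqr_sqrtr // ltW. Qed.
Let sq0 : sq != 0. Proof. by rewrite gt_eqF // sqrtr_gt0. Qed.

Lemma d23 f x : smooth_on W f -> W x -> d2 (d3 f) x - d3 (d2 f) x = 2 * d1 f x.
Proof.
move=> sf Wx; rewrite /d2 /d3 (d_commutator _ _ (@linear_jfield R) (@continuous_jfield R) (@linear_kfield R) (@continuous_kfield R) sf Wx).
have -> : kfield (jfield x) - jfield (kfield x) = 2 *: hopf x.
  by apply: row4P; rewrite /jfield /kfield ?hopfE ?(mxE4, row4E); ring.
by rewrite (deriveZdir sf _ _ Wx) /d1 -sq2; field.
Qed.
Lemma d31 f x : smooth_on W f -> W x -> d3 (d1 f) x - d1 (d3 f) x = 2 / eps * d2 f x.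
Proof.
move=> sf Wx; rewrite /d1 /d3 (d_commutator _ _ (@linear_kfield R) (@continuous_kfield R) (@linear_hopf R) (@continuous_hopf R) sf Wx).
have -> : hopf (kfield x) - kfield (hopf x) = 2 *: jfield x.
  by apply: row4P; rewrite /jfield /kfield ?hopfE ?(mxE4, row4E); ring.
rewrite (deriveZdir sf _ _ Wx) /d2; ring.
Qed.
Lemma d12 f x : smooth_on W f -> W x -> d1 (d2 f) x - d2 (d1 f) x = 2 / eps * d3 f x.
Proof.
move=> sf Wx; rewrite /d1 /d2 (d_commutator _ _ (@linear_hopf R) (@continuous_hopf R) (@linear_jfield R) (@continuous_jfield R) sf Wx).
have -> : jfield (hopf x) - hopf (jfield x) = 2 *: kfield x.
  by apply: row4P; rewrite /jfield /kfield ?hopfE ?(mxE4, row4E); ring.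
rewrite (deriveZdir sf _ _ Wx) /d3; ring.
Qed.
End Open.
End Frame.

(** * Metric line fields *)

Section Good.
Variables (R : realType) (eps : R) (eps_gt0 : 0 < eps) (eps_neq1 : eps <> 1).
Local Notation R4 := 'rV[R]_4.
Let m : R := 2 / eps.
Let e : R := m - 2.
Local Notation d1 := (d1 eps).
Local Notation d2 := (d2 eps).
Local Notation d3 := (d3 eps).
Variables v1 v2 v3 : R4 -> R.

(* g([N, V], N) = 0 for N = V x w in the frame e1, e2, e3. *)
Definition lie_quadratic (x : R4) : Prop := forall w1 w2 w3,
  let n1 := v2 x * w3 - v3 x * w2 in let n2 := v3 x * w1 - v1 x * w3 in
  let n3 := v1 x * w2 - v2 x * w1 in
  n1 * (n1 * d1 v1 x + n2 * d2 v1 x + n3 * d3 v1 x + 2 * (n2 * v3 x - n3 * v2 x))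
  + n2 * (n1 * d1 v2 x + n2 * d2 v2 x + n3 * d3 v2 x + m * (n3 * v1 x - n1 * v3 x))
  + n3 * (n1 * d1 v3 x + n2 * d2 v3 x + n3 * d3 v3 x + m * (n1 * v2 x - n2 * v1 x)) = 0.

(** [W] is open in the ambient space, and [v1], [v2], [v3] are the frame components of [V], extended
    off the sphere. Total geodesy enters only through [good_quad]. *)
Record good (W : set R4) : Prop := Good {
  good_open : open W;
  good_v1 : smooth_on W v1; good_v2 : smooth_on W v2; good_v3 : smooth_on W v3;
  good_unit : forall x, W x -> v1 x ^+ 2 + v2 x ^+ 2 + v3 x ^+ 2 = 1;
  good_quad : forall x, W x -> lie_quadratic x }.

Lemma good_sub W W' : open W' -> W' `<=` W -> good W -> good W'.
Proof.
move=> oW' sub [oW s1 s2 s3 u q]; split=> //; try exact: (smooth_sub sub).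
  by move=> x /sub; exact: u.
by move=> x /sub; exact: q.
Qed.

(* Components of the leaf curvature [nabla_V V], and [v . curl M / 2] for
   [M_ij = (nabla_(e_i) V)_j]. *)
Definition kap1 x := v1 x * d1 v1 x + v2 x * (d2 v1 x + v3 x) + v3 x * (d3 v1 x - v2 x).
Definition kap2 x := v1 x * (d1 v2 x - (m - 1) * v3 x) + v2 x * d2 v2 x + v3 x * (d3 v2 x + v1 x).
Definition kap3 x := v1 x * (d1 v3 x + (m - 1) * v2 x) + v2 x * (d2 v3 x - v1 x) + v3 x * d3 v3 x.
Definition twist x := 2^-1 * (v1 x * ((d2 v3 x - v1 x) - (d3 v2 x + v1 x))
  + v2 x * ((d3 v1 x - v2 x) - (d1 v3 x + (m - 1) * v2 x))
  + v3 x * ((d1 v2 x - (m - 1) * v3 x) - (d2 v1 x + v3 x))).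

Section OnW.
Variables (W : set R4) (gW : good W).
Let oW := good_open gW.
Let s1 := good_v1 gW.
Let s2 := good_v2 gW.
Let s3 := good_v3 gW.

Ltac smooth_tac oW := lazymatch goal with
  | |- smooth_on _ (fun x => @?f x + @?g x) => refine (smooth_add oW (f := f) (g := g) _ _); smooth_tac oW
  | |- smooth_on _ (fun x => @?f x * @?g x) => refine (smooth_mul oW (f := f) (g := g) _ _); smooth_tac oW
  | |- smooth_on _ (fun x => - @?f x) => refine (smooth_opp oW (f := f) _); smooth_tac oW
  | |- smooth_on _ (fun x => d1 ?f x) => refine (smooth_d1 eps oW (f := f) _); smooth_tac oW
  | |- smooth_on _ (fun x => d2 ?f x) => refine (smooth_d2 eps oW (f := f) _); smooth_tac oW
  | |- smooth_on _ (fun x => d3 ?f x) => refine (smooth_d3 eps oW (f := f) _); smooth_tac oW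
  | |- smooth_on _ (fun _ => ?c) => exact: (smooth_cst oW c)
  | |- _ => first [exact s1 | exact s2 | exact s3 | idtac]
  end.

Lemma smooth_kap1 : smooth_on W kap1. Proof. rewrite /kap1; smooth_tac oW. Qed.
Lemma smooth_kap2 : smooth_on W kap2. Proof. rewrite /kap2; smooth_tac oW. Qed.
Lemma smooth_kap3 : smooth_on W kap3. Proof. rewrite /kap3; smooth_tac oW. Qed.
Lemma smooth_twist : smooth_on W twist. Proof. rewrite /twist; smooth_tac oW. Qed.

Lemma good_derive_unit x u : W x ->
  v1 x * 'D_u v1 x + v2 x * 'D_u v2 x + v3 x * 'D_u v3 x = 0.
Proof.
move=> Wx.
have h : 'D_u (fun y => v1 y * v1 y + v2 y * v2 y + v3 y * v3 y) x = 0.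
  rewrite (eq_derive_open (g := cst (1 : R)) u oW _ Wx) ?derive_cst //.
  by move=> y Wy; rewrite /cst -(good_unit gW Wy); ring.
have D (f : R4 -> R) : smooth_on W f -> derivable f x u by move=> sf; exact: smooth_derivable sf Wx.
have e1 : 'D_u (fun y => v1 y * v1 y + v2 y * v2 y + v3 y * v3 y) x =
  2 * (v1 x * 'D_u v1 x + v2 x * 'D_u v2 x + v3 x * 'D_u v3 x).
  rewrite (deriveDf (D _ (smooth_add oW (smooth_mul oW s1 s1) (smooth_mul oW s2 s2))) (D _ (smooth_mul oW s3 s3))).
  rewrite (deriveDf (D _ (smooth_mul oW s1 s1)) (D _ (smooth_mul oW s2 s2))).
  rewrite (deriveMf (D _ s1) (D _ s1)) (deriveMf (D _ s2) (D _ s2)) (deriveMf (D _ s3) (D _ s3)).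
  ring.
by move: h; rewrite e1 => /eqP; rewrite mulf_eq0 pnatr_eq0 => /eqP.
Qed.

(** For [N] with constant components in the frame, [g([N, V], N) = g(nabla_N V, N)], so the
    quadratic identity concerns the matrix of covariant derivatives of [V]. Its rows are orthogonal
    to [V] because [V] has unit length, and [skew_on_orthogonal] solves for the derivatives. *)
Lemma good_solved x : W x ->
  [/\ v1 x * kap1 x + v2 x * kap2 x + v3 x * kap3 x = 0,
      [/\ d1 v1 x = v1 x * kap1 x, d1 v2 x = v1 x * kap2 x + twist x * v3 x + (m - 1) * v3 x
        & d1 v3 x = v1 x * kap3 x - twist x * v2 x - (m - 1) * v2 x],
      [/\ d2 v1 x = v2 x * kap1 x - twist x * v3 x - v3 x, d2 v2 x = v2 x * kap2 x
        & d2 v3 x = v2 x * kap3 x + twist x * v1 x + v1 x] &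
      [/\ d3 v1 x = v3 x * kap1 x + twist x * v2 x + v2 x,
          d3 v2 x = v3 x * kap2 x - twist x * v1 x - v1 x & d3 v3 x = v3 x * kap3 x]].
Proof.
move=> Wx; have u := good_unit gW Wx.
have D (a : R) w : (a * 'D_w v1 x) * v1 x + (a * 'D_w v2 x) * v2 x + (a * 'D_w v3 x) * v3 x = 0.
  by rewrite -[RHS](mulr0 a) -(good_derive_unit w Wx); ring.
have [| | | |kv [e11 e12 e13] [e21 e22 e23] [e31 e32 e33]] :=
  @skew_on_orthogonal R (v1 x) (v2 x) (v3 x)
   (d1 v1 x) (d1 v2 x - (m - 1) * v3 x) (d1 v3 x + (m - 1) * v2 x)
   (d2 v1 x + v3 x) (d2 v2 x) (d2 v3 x - v1 x)
   (d3 v1 x - v2 x) (d3 v2 x + v1 x) (d3 v3 x) u.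
- by rewrite -[RHS](D eps^-1 (hopf x)) /d1; ring.
- by rewrite -[RHS](D (Num.sqrt eps)^-1 (jfield x)) /d2; ring.
- by rewrite -[RHS](D (Num.sqrt eps)^-1 (kfield x)) /d3; ring.
- by move=> w1 w2 w3 n1 n2 n3; rewrite -[RHS](good_quad gW Wx w1 w2 w3) -/n1 -/n2 -/n3; ring.
rewrite -/(kap1 x) -/(kap2 x) -/(kap3 x) -/(twist x) in kv e11 e12 e13 e21 e22 e23 e31 e32 e33.
split=> //; split => //.
- by rewrite -e12; ring.
- by rewrite -e13; ring.
- by rewrite -e21; ring.
- by rewrite -e23; ring.
- by rewrite -e31; ring.
- by rewrite -e32; ring.
Qed.
End OnW.
End Good.

(** * The frame fields as derivations of the ring of smooth functions *)

Section FieldDerivation.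
Variables (R : realType) (n : nat) (W : set 'rV[R]_n.+1) (oW : open W).
Variables (a : R) (X : 'rV[R]_n.+1 -> 'rV[R]_n.+1).
Local Notation A := (smfun oW).
Hypotheses (lX : linear X) (cX : continuous X).

Lemma smooth_scaled_field f : smooth_on W f -> smooth_on W (fun x => a * 'D_(X x) f x).
Proof.
move=> sf; apply: smooth_mul => //; first exact: (smooth_cst oW).
exact: smooth_derive_field.
Qed.

Definition field_der (f : A) : A := sm_of oW (smooth_scaled_field (sm_smooth f)).

Lemma field_derE (f : A) x : W x -> field_der f x = a * 'D_(X x) f x.
Proof. exact: sm_ofE. Qed.

Lemma field_der_of f (sf : smooth_on W f) x : W x -> field_der (sm_of oW sf) x = a * 'D_(X x) f x.
Proof.
move=> Wx; rewrite field_derE //; congr (_ * _).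
by apply: (eq_derive_open _ oW) => // y Wy; rewrite sm_ofE.
Qed.

Lemma field_derivation : derivation field_der.
Proof.
have D (f : A) x u : W x -> derivable f x u := smooth_derivable (sm_smooth f).
split=> f g; apply: smfun_eq => x Wx.
  rewrite field_derE // [RHS](smD Wx) !field_derE //.
  rewrite (eq_derive_open (g := fun y => f y + g y) _ oW _ Wx); last by move=> y Wy; rewrite (smD Wy).
  by rewrite (deriveDf (D f x _ Wx) (D g x _ Wx)); ring.
rewrite field_derE // [RHS](smD Wx) !(smM Wx) !field_derE //.
rewrite (eq_derive_open (g := fun y => f y * g y) _ oW _ Wx); last by move=> y Wy; rewrite (smM Wy).
by rewrite (deriveMf (D f x _ Wx) (D g x _ Wx)); ring.
Qed.
End FieldDerivation.

Lemma field_der_comp (R : realType) (n : nat) (W : set 'rV[R]_n.+1) (oW : open W) (a b : R)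
    (X Y : 'rV[R]_n.+1 -> 'rV[R]_n.+1) (lX : linear X) (cX : continuous X) (lY : linear Y)
    (cY : continuous Y) (f : smfun oW) x : W x ->
  field_der a lX cX (field_der b lY cY f) x = a * 'D_(X x) (fun y => b * 'D_(Y y) f y) x.
Proof.
move=> Wx; rewrite field_derE //; congr (_ * _).
by apply: (eq_derive_open _ oW) => // y Wy; rewrite field_derE.
Qed.

Section GoodRing.
Variables (R : realType) (eps : R) (eps_gt0 : 0 < eps) (eps_neq1 : eps <> 1).
Local Notation R4 := 'rV[R]_4.
Let m : R := 2 / eps.
Let e : R := m - 2.
Variables v1 v2 v3 : R4 -> R.
Local Notation good := (good eps v1 v2 v3).
Local Notation kap1 := (kap1 eps v1 v2 v3).
Local Notation kap2 := (kap2 eps v1 v2 v3).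
Local Notation kap3 := (kap3 eps v1 v2 v3).
Local Notation twist := (twist eps v1 v2 v3).
Local Notation sigma := (fun x => 1 - v1 x * v1 x).

Section OnW.
Variables (W : set R4) (gW : good W).
Let oW := good_open gW.
Local Notation A := (smfun oW).

Definition D1 : A -> A := field_der eps^-1 (@linear_hopf R) (@continuous_hopf R).
Definition D2 : A -> A := field_der (Num.sqrt eps)^-1 (@linear_jfield R) (@continuous_jfield R).
Definition D3 : A -> A := field_der (Num.sqrt eps)^-1 (@linear_kfield R) (@continuous_kfield R).
Definition eA : A := sm_of oW (smooth_cst oW e).
Definition cA : A := sm_of oW (good_v1 gW).
Definition pA : A := sm_of oW (good_v2 gW).
Definition qA : A := sm_of oW (good_v3 gW).
Definition k1A : A := sm_of oW (smooth_kap1 gW).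
Definition k2A : A := sm_of oW (smooth_kap2 gW).
Definition k3A : A := sm_of oW (smooth_kap3 gW).
Definition wA : A := sm_of oW (smooth_twist gW).

Lemma good_metric_frame : metric_frame D1 D2 D3 eA cA pA qA k1A k2A k3A wA.
Proof.
have D1E (f : R4 -> R) (sf : smooth_on W f) x : W x -> D1 (sm_of oW sf) x = d1 eps f x by exact: field_der_of.
have D2E (f : R4 -> R) (sf : smooth_on W f) x : W x -> D2 (sm_of oW sf) x = d2 eps f x by exact: field_der_of.
have D3E (f : R4 -> R) (sf : smooth_on W f) x : W x -> D3 (sm_of oW sf) x = d3 eps f x by exact: field_der_of.
have me : e + 2 = 2 / eps by rewrite /e /m subrK.
split.
- by apply: smfun_eq => x Wx; rewrite D1E // /d1 derive_cst mulr0 (sm0E oW Wx).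
- by apply: smfun_eq => x Wx; rewrite D2E // /d2 derive_cst mulr0 (sm0E oW Wx).
- by apply: smfun_eq => x Wx; rewrite D3E // /d3 derive_cst mulr0 (sm0E oW Wx).
- move=> f; apply: smfun_eq => x Wx.
  have e1 : D2 (D3 f) x = d2 eps (d3 eps f) x := field_der_comp _ _ (@linear_jfield R) (@continuous_jfield R) (@linear_kfield R) (@continuous_kfield R) f Wx.
  have e2 : D3 (D2 f) x = d3 eps (d2 eps f) x := field_der_comp _ _ (@linear_kfield R) (@continuous_kfield R) (@linear_jfield R) (@continuous_jfield R) f Wx.
  have e3 : D1 f x = d1 eps f x := field_derE _ (@linear_hopf R) (@continuous_hopf R) f Wx.
  apply: (etrans (smB Wx (D2 (D3 f)) (D3 (D2 f)))).
  apply: (etrans (congr2 (fun r r' : R => r - r') e1 e2)).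
  transitivity  (2 * d1 eps f x); first exact: (d23 eps_gt0 oW (sm_smooth f) Wx).
  apply/esym; apply: (etrans (smM Wx _ _)); apply: (congr2 (fun r r' : R => r * r') _ e3).
  exact: smnat.
- move=> f; apply: smfun_eq => x Wx.
  have e1 : D3 (D1 f) x = d3 eps (d1 eps f) x := field_der_comp _ _ (@linear_kfield R) (@continuous_kfield R) (@linear_hopf R) (@continuous_hopf R) f Wx.
  have e2 : D1 (D3 f) x = d1 eps (d3 eps f) x := field_der_comp _ _ (@linear_hopf R) (@continuous_hopf R) (@linear_kfield R) (@continuous_kfield R) f Wx.
  have e3 : D2 f x = d2 eps f x := field_derE _ (@linear_jfield R) (@continuous_jfield R) f Wx.
  apply: (etrans (smB Wx (D3 (D1 f)) (D1 (D3 f)))).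
  apply: (etrans (congr2 (fun r r' : R => r - r') e1 e2)).
  transitivity  ((2 / eps) * d2 eps f x); first exact: (d31 eps oW (sm_smooth f) Wx).
  apply/esym; apply: (etrans (smM Wx _ _)); apply: (congr2 (fun r r' : R => r * r') _ e3).
  by rewrite (smD Wx) (smnat oW Wx) sm_ofE.
- move=> f; apply: smfun_eq => x Wx.
  have e1 : D1 (D2 f) x = d1 eps (d2 eps f) x := field_der_comp _ _ (@linear_hopf R) (@continuous_hopf R) (@linear_jfield R) (@continuous_jfield R) f Wx.
  have e2 : D2 (D1 f) x = d2 eps (d1 eps f) x := field_der_comp _ _ (@linear_jfield R) (@continuous_jfield R) (@linear_hopf R) (@continuous_hopf R) f Wx.
  have e3 : D3 f x = d3 eps f x := field_derE _ (@linear_kfield R) (@continuous_kfield R) f Wx.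
  apply: (etrans (smB Wx (D1 (D2 f)) (D2 (D1 f)))).
  apply: (etrans (congr2 (fun r r' : R => r - r') e1 e2)).
  transitivity  ((2 / eps) * d3 eps f x); first exact: (d12 eps oW (sm_smooth f) Wx).
  apply/esym; apply: (etrans (smM Wx _ _)); apply: (congr2 (fun r r' : R => r * r') _ e3).
  by rewrite (smD Wx) (smnat oW Wx) sm_ofE.
- by apply: smfun_eq => x Wx; rewrite !(smE oW Wx) !sm_ofE // (good_unit gW Wx).
- by apply: smfun_eq => x Wx; rewrite !(smE oW Wx) !sm_ofE //; have [] := good_solved gW Wx.
- by apply: smfun_eq => x Wx; rewrite !(smE oW Wx) D1E // !sm_ofE //; have [_ [] ] := good_solved gW Wx.
- by apply: smfun_eq => x Wx; rewrite !(smE oW Wx) D1E // !sm_ofE // /cst me; have [_ [] ] := good_solved gW Wx.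
- by apply: smfun_eq => x Wx; rewrite !(smE oW Wx) D1E // !sm_ofE // /cst me; have [_ [] ] := good_solved gW Wx.
- by apply: smfun_eq => x Wx; rewrite !(smE oW Wx) D2E // !sm_ofE //; have [_ _ [] ] := good_solved gW Wx.
- by apply: smfun_eq => x Wx; rewrite !(smE oW Wx) D2E // !sm_ofE //; have [_ _ [] ] := good_solved gW Wx.
- by apply: smfun_eq => x Wx; rewrite !(smE oW Wx) D2E // !sm_ofE //; have [_ _ [] ] := good_solved gW Wx.
- by apply: smfun_eq => x Wx; rewrite !(smE oW Wx) D3E // !sm_ofE //; have [_ _ _ [] ] := good_solved gW Wx.
- by apply: smfun_eq => x Wx; rewrite !(smE oW Wx) D3E // !sm_ofE //; have [_ _ _ [] ] := good_solved gW Wx.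
- by apply: smfun_eq => x Wx; rewrite !(smE oW Wx) D3E // !sm_ofE //; have [_ _ _ [] ] := good_solved gW Wx.
Qed.

Lemma regular_eA : regular eA.
Proof.
apply: regular_smfun => x Wx; rewrite sm_ofE // /cst /e /m subr_eq0.
apply/negP => /eqP h; apply: eps_neq1.
have : 2 * eps = 2 by rewrite -[in LHS]h divfK ?gt_eqF.
by move=> /(canRL (mulKf _)); rewrite mulVf ?pnatr_eq0 //; apply.
Qed.

Lemma regular_ec2 : regular (eA * cA ^+ 2 + 2).
Proof.
apply: regular_smfun => x Wx; rewrite !(smE oW Wx) !sm_ofE // /cst /e /m.
have u := good_unit gW Wx; rewrite gt_eqF //.
(* Positivity shows once [2] is replaced by twice the squared length of [V]. *)
rewrite (_ : _ + 2 = 2 / eps * v1 x ^+ 2 + 2 * (v2 x ^+ 2 + v3 x ^+ 2)); last first.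
  transitivity ((2 / eps - 2) * v1 x ^+ 2 + 2 * (v1 x ^+ 2 + v2 x ^+ 2 + v3 x ^+ 2)); last by ring.
  by rewrite u mulr1.
have [v10|v10] := eqVneq (v1 x) 0.
  by rewrite v10 in u *; rewrite expr0n /= add0r in u; rewrite u expr0n /=; lra.
rewrite ltr_pwDl //; last by rewrite mulr_ge0 ?addr_ge0 ?sqr_ge0.
apply: mulr_gt0; [exact: divr_gt0|by rewrite exprn_even_gt0].
Qed.

(* Once [H = defect = 0] the curvature is [lamf] times V x e1, and
   [Lamf / 2] is the coefficient of X in the Killing field spanning the foliation. *)
Definition lamf x := (kap2 x * v3 x - kap3 x * v2 x) - v1 x * (twist x - 1).
Definition Lamf x := lamf x + e * v1 x.
(** [1 - v1 ^+ 2] times the coefficient [F] of the adapted frame; this product also makes sense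
    where [V] is vertical. *)
Definition defect x := (1 - twist x) * (1 - v1 x * v1 x) - v1 x * (kap2 x * v3 x - kap3 x * v2 x).
Definition derVf (f : R4 -> R) x := v1 x * d1 eps f x + v2 x * d2 eps f x + v3 x * d3 eps f x.

Lemma smooth_sigma : smooth_on W (fun x => 1 - v1 x * v1 x).
Proof.
apply: (smooth_add oW); first exact: (smooth_cst oW).
by apply: (smooth_opp oW); apply: (smooth_mul oW); exact: (good_v1 gW).
Qed.

Lemma smooth_lamf : smooth_on W lamf.
Proof.
have [[s1 s2] s3] := (good_v1 gW, good_v2 gW, good_v3 gW).
have [[[k1 k2] k3] t] := (smooth_kap1 gW, smooth_kap2 gW, smooth_kap3 gW, smooth_twist gW).
apply: (smooth_add oW (f := fun x => kap2 x * v3 x - kap3 x * v2 x)).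
  apply: (smooth_add oW (f := fun x => kap2 x * v3 x)); first exact: smooth_mul.
  by apply: smooth_opp => //; apply: smooth_mul.
apply: smooth_opp => //; apply: smooth_mul => //.
by apply: (smooth_add oW) => //; exact: (smooth_cst oW).
Qed.

Lemma smooth_Lamf : smooth_on W Lamf.
Proof.
apply: (smooth_add oW); first exact: smooth_lamf.
by apply: (smooth_mul oW); [exact: (smooth_cst oW)|exact: (good_v1 gW)].
Qed.

Lemma smooth_defect : smooth_on W defect.
Proof.
have [[s1 s2] s3] := (good_v1 gW, good_v2 gW, good_v3 gW).
have [[[k1 k2] k3] t] := (smooth_kap1 gW, smooth_kap2 gW, smooth_kap3 gW, smooth_twist gW).
apply: (smooth_add oW (f := fun x => (1 - twist x) * (1 - v1 x * v1 x))).
  apply: (smooth_mul oW (f := fun x => 1 - twist x)); last exact: smooth_sigma.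
  by apply: (smooth_add oW); [exact: (smooth_cst oW)|apply: smooth_opp].
apply: smooth_opp => //; apply: smooth_mul => //.
apply: (smooth_add oW (f := fun x => kap2 x * v3 x)); first exact: smooth_mul.
by apply: smooth_opp => //; apply: smooth_mul.
Qed.

Lemma smooth_derVf f : smooth_on W f -> smooth_on W (derVf f).
Proof.
have [[s1 s2] s3] := (good_v1 gW, good_v2 gW, good_v3 gW) => sf.
apply: (smooth_add oW (f := fun x => v1 x * d1 eps f x + v2 x * d2 eps f x)).
  apply: (smooth_add oW (f := fun x => v1 x * d1 eps f x)).
    by apply: (smooth_mul oW) => //; exact: smooth_d1.
  by apply: (smooth_mul oW) => //; exact: smooth_d2.
by apply: (smooth_mul oW) => //; exact: smooth_d3.
Qed.

Section NonPolar.
Hypothesis s0 : forall x, W x -> 1 - v1 x * v1 x != 0.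
Definition siA : A := sm_of oW (smooth_inv oW s0 smooth_sigma).
Local Notation VA := (der_V D1 D2 D3 cA pA qA).
Local Notation xA := (der_x D1 D2 D3 cA pA qA).
Local Notation yA := (der_y D2 D3 pA qA).
Local Notation KA := (k2A * qA - k3A * pA).

Lemma siAE : siA * (1 - cA ^+ 2) = 1.
Proof.
apply: smfun_eq => x Wx; rewrite !(smE oW Wx) !sm_ofE // expr2 mulVf //; exact: s0.
Qed.

Lemma good_adapted : adapted_frame VA xA yA cA wA k1A KA siA eA pA qA.
Proof.
have f1 : derivation D1 by exact: field_derivation.
have f2 : derivation D2 by exact: field_derivation.
have f3 : derivation D3 by exact: field_derivation.
exact: (metric_frame_adapted f1 f2 f3 good_metric_frame (@regular_nat _ _ _ oW) siAE).
Qed.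

Let hV : derivation VA.
Proof. by apply: der_V_derivation; exact: field_derivation. Qed.
Let hx : derivation xA.
Proof. by apply: der_x_derivation; exact: field_derivation. Qed.
Let hy : derivation yA.
Proof. by apply: der_y_derivation; exact: field_derivation. Qed.

(** Formulated as emptiness of [W], so that it can be applied to the open subset where [kap1] is
    nonzero. The other two emptiness lemmas are meant in the same way. *)
Lemma good_H_empty : (forall x, W x -> kap1 x != 0) -> forall x, ~ W x.
Proof.
move=> H0; apply: smfun_nontrivial.
apply: (af_trivial hV hx hy good_adapted) regular_eA _.
  exact: smfun_reduced.
by apply: regular_smfun => x Wx; rewrite sm_ofE //; exact: H0.
Qed.

Let k1A0 : (forall x, W x -> kap1 x = 0) -> k1A = 0.
Proof. by move=> h; apply: smfun_eq => x Wx; rewrite sm_ofE // (sm0E oW Wx) h. Qed.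

Let FE x : W x -> (1 - wA - cA * KA * siA) x * (1 - v1 x * v1 x) = defect x.
Proof.
by move=> Wx; have := s0 Wx; rewrite !(smE oW Wx) !sm_ofE // /defect => h; field.
Qed.

Lemma good_F_empty : (forall x, W x -> kap1 x = 0) -> (forall x, W x -> defect x != 0) ->
  forall x, ~ W x.
Proof.
move=> /k1A0 H0 F0; apply: smfun_nontrivial.
apply: (af_H0_F hV hx hy good_adapted) regular_eA regular_ec2 H0 _.
apply: regular_smfun => x Wx; apply: contraNneq (F0 x Wx) => h.
by rewrite -FE // h mul0r.
Qed.

Section Defect0.
Hypotheses (H0 : forall x, W x -> kap1 x = 0) (F0 : forall x, W x -> defect x = 0).

Let FA0 : 1 - wA - cA * KA * siA = 0.
Proof.
apply: smfun_eq => x Wx; rewrite (sm0E oW Wx); apply: (mulIf (s0 Wx)).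
by rewrite mul0r FE // F0.
Qed.

Let LA : A := KA - cA * (wA - 1) + eA * cA.
Let LE x : W x -> LA x = Lamf x.
Proof. by move=> Wx; rewrite !(smE oW Wx) !sm_ofE. Qed.

Let dL x c (X : R4 -> R4) (lX : linear X) (cX : continuous X) : W x ->
  (@field_der R 3 W oW c X lX cX) LA x = c * 'D_(X x) Lamf x.
Proof.
move=> Wx; rewrite field_derE //; congr (_ * _).
exact: (eq_derive_open _ oW LE).
Qed.

Let cE x : W x -> cA x = v1 x. Proof. exact: sm_ofE. Qed.
Let pE x : W x -> pA x = v2 x. Proof. exact: sm_ofE. Qed.
Let qE x : W x -> qA x = v3 x. Proof. exact: sm_ofE. Qed.
Let D1L x : W x -> D1 LA x = d1 eps Lamf x. Proof. exact: dL. Qed.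
Let D2L x : W x -> D2 LA x = d2 eps Lamf x. Proof. exact: dL. Qed.
Let D3L x : W x -> D3 LA x = d3 eps Lamf x. Proof. exact: dL. Qed.

Let VLE x : W x -> VA LA x = derVf Lamf x.
Proof.
move=> Wx; rewrite /der_V /derVf.
apply: (evD Wx); [apply: (evD Wx)|]; apply: (evM Wx);
  [exact: cE|exact: D1L|exact: pE|exact: D2L|exact: qE|exact: D3L].
Qed.

Let sE x : W x -> (1 - cA ^+ 2 : A) x = 1 - v1 x * v1 x.
Proof. by move=> Wx; rewrite !(smE oW Wx) cE. Qed.

Lemma good_V_empty : (forall x, W x -> derVf Lamf x != 0) -> forall x, ~ W x.
Proof.
move=> V0; apply: smfun_nontrivial.
apply: (af_Vlam hV hx hy good_adapted) regular_eA regular_ec2 (k1A0 H0) FA0 _.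
by apply: regular_smfun => x Wx; rewrite VLE //; exact: V0.
Qed.

Lemma good_xy_Lam x : W x ->
  (1 - v1 x * v1 x) * d1 eps Lamf x - v1 x * v2 x * d2 eps Lamf x - v1 x * v3 x * d3 eps Lamf x = 0
  /\ v3 x * d2 eps Lamf x - v2 x * d3 eps Lamf x = (1 - v1 x * v1 x) * lamf x * Lamf x.
Proof.
move=> Wx; split.
  have h := congr1 (fun f : A => f x) (af_xlam hV hx hy good_adapted (k1A0 H0)).
  apply: etrans (etrans h (sm0E oW Wx)); apply/esym; rewrite /der_x.
  apply: (evB Wx); [apply: (evB Wx)|]; apply: (evM Wx).
  - exact: sE.
  - exact: D1L.
  - by apply: (evM Wx); [exact: cE|exact: pE].
  - exact: D2L.
  - by apply: (evM Wx); [exact: cE|exact: qE].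
  - exact: D3L.
have h := congr1 (fun f : A => f x) (af_ylam hV hx hy good_adapted FA0).
transitivity (yA LA x).
  apply/esym; rewrite /der_y; apply: (evB Wx); apply: (evM Wx);
    [exact: qE|exact: D2L|exact: pE|exact: D3L].
apply: (etrans h); apply: (evM Wx); [apply: (evM Wx)|exact: LE]; first exact: sE.
by rewrite !(smE oW Wx) !sm_ofE.
Qed.
End Defect0.
End NonPolar.
End OnW.
End GoodRing.

Lemma open_neq0 (R : realType) (V : normedModType R) (W : set V) (f : V -> R) :
  open W -> smooth_on W f -> open [set x | W x /\ f x != 0].
Proof.
move=> oW sf; rewrite openE => x [Wx fx].
have cf := smooth_cont sf Wx.
have h : nbhs x (f @^-1` [set y | y != 0]).
  by apply: cf; apply: open_nbhs_nbhs; split => //; exact: open_neq.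
by apply: filterS (filterI (open_nbhs_nbhs (conj oW Wx)) h) => y [].
Qed.

(** * The first-order system for the direction of a Killing field *)

Section Residuals.
Variables (R : realType) (eps : R) (eps_gt0 : 0 < eps) (eps_neq1 : eps <> 1).
Local Notation R4 := 'rV[R]_4.
Let m : R := 2 / eps.
Let e : R := m - 2.
Variables v1 v2 v3 : R4 -> R.
Local Notation good := (good eps v1 v2 v3).
Local Notation kap1 := (kap1 eps v1 v2 v3).
Local Notation kap2 := (kap2 eps v1 v2 v3).
Local Notation kap3 := (kap3 eps v1 v2 v3).
Local Notation twist := (twist eps v1 v2 v3).
Local Notation lam := (lamf eps v1 v2 v3).
Local Notation Lam := (Lamf eps v1 v2 v3).
Local Notation defect := (defect eps v1 v2 v3).
Local Notation derV := (derVf eps v1 v2 v3).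

(* The first order system satisfied by the direction of a Killing field. *)
Definition killing_relations (x : R4) : Prop :=
  [/\ kap1 x = 0, kap2 x = lam x * v3 x, kap3 x = - (lam x * v2 x),
      twist x = 1 - v1 x * lam x &
      [/\ d1 eps Lam x = 0, d2 eps Lam x = lam x * v3 x * Lam x &
          d3 eps Lam x = - (lam x * v2 x * Lam x)]].

Lemma good_neq0 W (gW : good W) (f : R4 -> R) x : smooth_on W f -> W x -> f x != 0 ->
  exists W', [/\ good W', W' x, W' `<=` W & forall y, W' y -> f y != 0].
Proof.
move=> sf Wx fx; exists [set y | W y /\ f y != 0]; split=> //; try by move=> y [].
by apply: (good_sub _ _ gW); [exact: open_neq0 (good_open gW) sf|move=> y []].
Qed.

Lemma killing_nonpolar W (gW : good W) x : (forall y, W y -> 1 - v1 y * v1 y != 0) ->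
  W x -> killing_relations x.
Proof.
move=> s0 Wx.
have H0 y : W y -> kap1 y = 0.
  move=> Wy; apply/eqP; apply/negP => /negP /(good_neq0 gW (smooth_kap1 gW) Wy)[W' [gW' W'y sub n0]].
  exact: (good_H_empty eps_gt0 eps_neq1 gW' (fun z h => s0 z (sub z h)) n0 W'y).
have F0 y : W y -> defect y = 0.
  move=> Wy; apply/eqP; apply/negP => /negP /(good_neq0 gW (smooth_defect gW) Wy)[W' [gW' W'y sub n0]].
  exact: (good_F_empty eps_gt0 eps_neq1 gW' (fun z h => s0 z (sub z h)) (fun z h => H0 z (sub z h)) n0 W'y).
have V0 y : W y -> derV Lam y = 0.
  move=> Wy; apply/eqP; apply/negP => /negP /(good_neq0 gW (smooth_derVf gW (smooth_Lamf gW)) Wy)[W' [gW' W'y sub n0]].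
  exact: (good_V_empty eps_gt0 eps_neq1 gW' (fun z h => s0 z (sub z h)) (fun z h => H0 z (sub z h)) (fun z h => F0 z (sub z h)) n0 W'y).
have [hx hy] := good_xy_Lam eps_gt0 gW s0 H0 F0 Wx.
have hV := V0 x Wx; have hF := F0 x Wx; have hH := H0 x Wx.
have u := good_unit gW Wx; have sx := s0 x Wx.
have [kv _ _ _] := good_solved gW Wx.
rewrite hH mulr0 add0r in kv.
move: hx hy hV hF sx kv u; rewrite /derVf /defect.
rewrite /killing_relations hH.
set L := Lam x; set k2 := kap2 x; set k3 := kap3 x; set w := twist x.
have -> : lam x = (k2 * v3 x - k3 * v2 x) - v1 x * (w - 1) by [].
move: (v1 x) (v2 x) (v3 x) k2 k3 w L (d1 eps Lam x) (d2 eps Lam x) (d3 eps Lam x).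
move=> c p q k2 k3 w L a1 a2 a3 hx hy hV hF sx kv u.
set l := _ - c * (w - 1) in hy *.
have sE : 1 - c * c = p ^+ 2 + q ^+ 2 by rewrite -u; ring.
(* [e1 = x + c * V], and [Lam] is constant along both [x] and [V]. *)
have a10 : a1 = 0.
  transitivity ((1 - c * c) * a1 - c * p * a2 - c * q * a3 + c * (c * a1 + p * a2 + q * a3)).
    by ring.
  by rewrite hx hV; ring.
have hV' : p * a2 + q * a3 = 0 by rewrite -[RHS]hV a10; ring.
have lE : (1 - c * c) * l = k2 * q - k3 * p.
  by apply: subr0_eq; rewrite /l -[RHS](mulr0 c) -hF; ring.
(* Each remaining relation is verified after multiplication by [1 - c * c = p ^+ 2 + q ^+ 2], which
   is nonzero here; the last two recover the derivatives along [e2] and [e3] from those along [V]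
   and [y]. *)
split=> //; [| | |split=> //]; apply: (mulfI sx).
- rewrite mulrA lE sE; apply: subr0_eq; rewrite -[RHS](mulr0 p) -kv; ring.
- rewrite mulrN mulrA lE sE; apply: subr0_eq; rewrite -[RHS](mulr0 q) -kv; ring.
- rewrite mulrBr mulrCA lE; apply: subr0_eq; rewrite -[RHS]oppr0 -hF; ring.
- transitivity (q * (q * a2 - p * a3) + p * (p * a2 + q * a3)); first by rewrite sE; ring.
  by rewrite hy hV'; ring.
- transitivity (- p * (q * a2 - p * a3) + q * (p * a2 + q * a3)); first by rewrite sE; ring.
  by rewrite hy hV'; ring.
Qed.

(** Here [V] is [e1] up to a locally constant sign. Its curvature vanishes and its twist is [-1], so
    [lam = 2 * v1], and the relations reduce to [v1 ^+ 2 = 1]. *)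
Lemma killing_polar W (gW : good W) x : (forall y, W y -> 1 - v1 y * v1 y = 0) ->
  W x -> killing_relations x.
Proof.
move=> s0 Wx; have oW := good_open gW.
have vE y : W y -> v2 y = 0 /\ v3 y = 0.
  move=> Wy; have u := good_unit gW Wy; have := s0 y Wy.
  rewrite -u (_ : _ - _ = v2 y ^+ 2 + v3 y ^+ 2); last by ring.
  move=> /eqP; rewrite paddr_eq0 ?sqr_ge0 // !sqrf_eq0 => /andP[/eqP -> /eqP ->] //.
have v11 : v1 x * v1 x = 1 by apply/esym/subr0_eq; exact: s0.
have v1n : v1 x != 0 by apply/negP => /eqP h; move: v11; rewrite h mul0r => /eqP; rewrite eq_sym oner_eq0.
have D0 u (f : R4 -> R) a : (forall y, W y -> f y = a) -> 'D_u f x = 0.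
  by move=> h; rewrite (eq_derive_open (g := cst a) u oW h Wx) derive_cst.
have Dv2 u : 'D_u v2 x = 0 by apply: (D0 u _ 0) => y /vE[].
have Dv3 u : 'D_u v3 x = 0 by apply: (D0 u _ 0) => y /vE[].
have Dv1 y u : W y -> 'D_u v1 y = 0.
  move=> Wy; have h := good_derive_unit gW u Wy; have [e2 e3] := vE y Wy.
  rewrite e2 e3 !mul0r !addr0 in h; move/eqP: h; rewrite mulf_eq0 => /orP[/eqP h|/eqP //].
  by have := s0 y Wy; rewrite h mul0r subr0 => /eqP; rewrite oner_eq0.
have Dv2' y u : W y -> 'D_u v2 y = 0.
  move=> Wy; rewrite (eq_derive_open (g := cst 0) u oW _ Wy) ?derive_cst //.
  by move=> z /vE[].
have Dv3' y u : W y -> 'D_u v3 y = 0.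
  move=> Wy; rewrite (eq_derive_open (g := cst 0) u oW _ Wy) ?derive_cst //.
  by move=> z /vE[].
have E y : W y -> [/\ kap1 y = 0, kap2 y = 0, kap3 y = 0 & twist y = -1].
  move=> Wy; have [e2 e3] := vE y Wy.
  have e1 : v1 y * v1 y = 1 by apply/esym/subr0_eq; exact: s0.
  rewrite /kap1 /kap2 /kap3 /twist /d1 /d2 /d3 !Dv1 // !Dv2' // !Dv3' // e2 e3 !mulr0 !mul0r.
  split; try ring.
  transitivity (- (v1 y * v1 y)); last by rewrite e1.
  by field.
have LE y : W y -> lam y = 2 * v1 y.
  by move=> Wy; have [e1 e2 e3 e4] := E y Wy; rewrite /lamf e2 e3 e4; ring.
have DL u : 'D_u Lam x = 0.
  rewrite (eq_derive_open (g := fun y => (2 + e) * v1 y) u oW _ Wx).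
    rewrite [LHS]deriveZ; first by rewrite Dv1 // [LHS]mulr0.
    exact: smooth_derivable (good_v1 gW) Wx.
  by move=> y Wy; rewrite /Lamf LE // /e /m; ring.
have [e1 e2 e3 e4] := E x Wx; have [f2 f3] := vE x Wx.
rewrite /killing_relations e1 e2 e3 e4 f2 f3 LE // /d1 /d2 /d3 !DL.
by split; [|ring|ring| |split; ring] => //; rewrite mulrCA v11; ring.
Qed.

(* The open set where V is not vertical and the interior of its complement are
   together dense. *)
Lemma polar_closure W (gW : good W) (f : R4 -> R) : smooth_on W f ->
  (forall W' x, good W' -> W' `<=` W -> W' x ->
     (forall y, W' y -> 1 - v1 y * v1 y != 0) \/ (forall y, W' y -> 1 - v1 y * v1 y = 0) -> f x = 0) ->
  forall x, W x -> f x = 0.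
Proof.
move=> sf h x Wx; apply/eqP; apply/negP => /negP fx.
have [W1 [g1 W1x sub1 n1]] := good_neq0 gW sf Wx fx.
have [[y [W1y sy]]|hs] := pselect (exists y, W1 y /\ 1 - v1 y * v1 y != 0).
  have [W2 [g2 W2y sub2 n2]] := good_neq0 g1 (smooth_sigma g1) W1y sy.
  have := n1 y W1y; rewrite (h W2 y) ?eqxx //; last by left.
  exact: subset_trans sub1.
have := n1 x W1x; rewrite (h W1 x) ?eqxx //; right=> y W1y.
by apply/eqP; apply/negP => /negP sy; apply: hs; exists y.
Qed.

(** Each relation is the vanishing of a smooth function, so it passes from the dense open set
    treated by the two previous cases to all of [W]. *)
Lemma good_killing W (gW : good W) x : W x -> killing_relations x.
Proof.
have oW := good_open gW.
have [[s1 s2] s3] := (good_v1 gW, good_v2 gW, good_v3 gW).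
have [[[k1 k2] k3] t] := (smooth_kap1 gW, smooth_kap2 gW, smooth_kap3 gW, smooth_twist gW).
have [l L] := (smooth_lamf gW, smooth_Lamf gW).
have kr W' y : good W' -> W' `<=` W -> W' y ->
     (forall y, W' y -> 1 - v1 y * v1 y != 0) \/ (forall y, W' y -> 1 - v1 y * v1 y = 0) -> killing_relations y.
  by move=> gW' _ W'y [h|h]; [exact: killing_nonpolar gW' _ h W'y|exact: killing_polar gW' _ h W'y].
have clo (f : R4 -> R) : smooth_on W f -> (forall y, killing_relations y -> f y = 0) -> W x -> f x = 0.
  by move=> sf hf; apply: (polar_closure gW sf) => W' y gW' sub W'y /(kr _ _ gW' sub W'y); exact: hf.
have sub (f g : R4 -> R) : smooth_on W f -> smooth_on W g -> smooth_on W (fun y => f y - g y).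
  by move=> sf sg; apply: (smooth_add oW (f := f)) => //; exact: smooth_opp.
have mul (f g : R4 -> R) : smooth_on W f -> smooth_on W g -> smooth_on W (fun y => f y * g y).
  exact: smooth_mul.
have opp (f : R4 -> R) : smooth_on W f -> smooth_on W (fun y => - f y) by exact: smooth_opp.
have dd := (smooth_d1 eps oW L, smooth_d2 eps oW L, smooth_d3 eps oW L).
case: dd => [[dL1 dL2] dL3] Wx.
have cst1 : smooth_on W (fun _ => 1 : R) by exact: (smooth_cst oW).
split.
- by apply: (clo kap1) => // y [].
- apply: subr0_eq; apply: (clo (fun x => kap2 x - lam x * v3 x)) => //; first exact: sub (mul _ _ l s3).
  by move=> y [_ -> *]; rewrite subrr.
- apply: subr0_eq; apply: (clo (fun x => kap3 x - - (lam x * v2 x))) => //.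
    exact: sub (opp _ (mul _ _ l s2)).
  by move=> y [_ _ -> *]; rewrite subrr.
- apply: subr0_eq; apply: (clo (fun x => twist x - (1 - v1 x * lam x))) => //.
    exact: sub (sub _ _ cst1 (mul _ _ s1 l)).
  by move=> y [_ _ _ -> *]; rewrite subrr.
split.
- by apply: (clo (d1 eps Lam)) => // y [_ _ _ _ []].
- apply: subr0_eq; apply: (clo (fun x => d2 eps Lam x - lam x * v3 x * Lam x)) => //.
    exact: sub (mul _ _ (mul _ _ l s3) L).
  by move=> y [_ _ _ _ [_ -> _]]; rewrite subrr.
- apply: subr0_eq; apply: (clo (fun x => d3 eps Lam x - - (lam x * v2 x * Lam x))) => //.
    exact: sub (opp _ (mul _ _ (mul _ _ l s2) L)).
  by move=> y [_ _ _ _ [_ _ ->]]; rewrite subrr.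
Qed.
End Residuals.

(** * The sphere and the Berger metric *)

Section Sphere.
Variable R : realType.
Local Notation R4 := 'rV[R]_4.
Implicit Types x p q u v w : R4.

Lemma dotC u v : dot u v = dot v u.
Proof. by rewrite !dotE; ring. Qed.
Lemma dotDl u v w : dot (u + v) w = dot u w + dot v w.
Proof. by rewrite !dotE !mxE; ring. Qed.
Lemma dotBl u v w : dot (u - v) w = dot u w - dot v w.
Proof. by rewrite !dotE !mxE; ring. Qed.
Lemma dotZl (a : R) u w : dot (a *: u) w = a * dot u w.
Proof. by rewrite !dotE !mxE; ring. Qed.

Lemma dot_ge0 x : 0 <= dot x x.
Proof. by rewrite dotE -!expr2 !addr_ge0 ?sqr_ge0. Qed.

Lemma dot_eq0 x : (dot x x == 0) = (x == 0).
Proof.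
apply/eqP/eqP => [|->]; last by rewrite dotE !mxE !mulr0 !addr0.
rewrite dotE -!expr2 => /eqP; rewrite !paddr_eq0 ?addr_ge0 ?sqr_ge0 // !sqrf_eq0.
by move=> /andP[/andP[/andP[/eqP h0 /eqP h1] /eqP h2] /eqP h3]; apply: row4P; rewrite ?h0 ?h1 ?h2 ?h3 mxE.
Qed.

Lemma dot_gt0 x : x != 0 -> 0 < dot x x.
Proof. by move=> x0; rewrite lt_def dot_eq0 x0 dot_ge0. Qed.

Lemma S3_neq0 p : S3 p -> p != 0.
Proof. by rewrite /S3 /= => h; rewrite -dot_eq0 h oner_eq0. Qed.

Lemma retr_S3 x : x != 0 -> S3 (retr x).
Proof.
move=> x0; have d0 := dot_gt0 x0; rewrite /S3 /= /retr.
rewrite dotE !mxE; set s := _^-1.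
transitivity (s ^+ 2 * dot x x); first by rewrite dotE; ring.
by rewrite /s exprVn sqr_sqrtr ?ltW // mulVf // gt_eqF.
Qed.

Lemma retr_id p : S3 p -> retr p = p.
Proof. by rewrite /S3 /= => h; rewrite /retr h sqrtr1 invr1 scale1r. Qed.

Lemma retr_retr x : x != 0 -> retr (retr x) = retr x.
Proof. by move=> /retr_S3/retr_id. Qed.

Lemma retrZ (a : R) x : 0 < a -> retr (a *: x) = retr x.
Proof.
move=> a0; rewrite /retr (_ : dot (a *: x) (a *: x) = a ^+ 2 * dot x x); last first.
  by rewrite !dotE !mxE; ring.
rewrite sqrtrM ?sqr_ge0 // sqrtr_sqr gtr0_norm // scalerA invfM mulrAC mulVf ?mul1r //.
by rewrite gt_eqF.
Qed.

Lemma open_punctured : open [set x : R4 | x != 0].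
Proof.
have -> : [set x : R4 | x != 0] = ~` [set 0].
  by apply/seteqP; split=> x /=; [move/eqP|move=> h; apply/eqP].
by apply: closed_openC; apply: accessible_closed_set1; apply: hausdorff_accessible; exact: norm_hausdorff.
Qed.

Lemma smooth_coord0 (U : set R4) (i : 'I_4) : open U -> smooth_on U (fun x => x 0 i).
Proof. by move=> oU; exact: smooth_id_coord. Qed.

Lemma smooth_dot (V : normedModType R) (U : set V) (f g : V -> R4) : open U ->
  smooth_on U f -> smooth_on U g -> smooth_on U (fun y => dot (f y) (g y)).
Proof.
move=> oU sf sg; apply: smooth_sum => // i.
by apply: smooth_mul => //; exact: smooth_coord.
Qed.

Lemma smooth_rnorm : smooth_on [set x : R4 | x != 0] (fun x => (Num.sqrt (dot x x))^-1).
Proof.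
apply: (smooth_rsqrt open_punctured); first by move=> x; exact: dot_gt0.
exact: (smooth_dot open_punctured (smooth_id open_punctured) (smooth_id open_punctured)).
Qed.

Lemma smooth_retr : smooth_on [set x : R4 | x != 0] (@retr R).
Proof.
apply: (smooth_row open_punctured) => i.
apply: (smooth_ext open_punctured) (smooth_mul open_punctured smooth_rnorm (smooth_coord0 i open_punctured)).
by move=> x _; rewrite /retr mxE.
Qed.

Lemma open_cone (U : set R4) : open U -> open (cone U).
Proof.
move=> oU; rewrite openE => x [x0 Ux].
have cr := smooth_cont smooth_retr x0.
have h : nbhs x (@retr R @^-1` U) by apply: cr; exact: open_nbhs_nbhs.
by apply: filterS (filterI (open_nbhs_nbhs (conj open_punctured x0)) h) => y [].
Qed.

(** The scaling factor has derivative zero at [p] in the directions tangent to the sphere. *)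
Lemma derive_retr p u : S3 p -> dot p u = 0 -> 'D_u (@retr R) p = u.
Proof.
move=> Sp pu; have p0 := S3_neq0 Sp.
have dr : derivable (@retr R) p u by exact: smooth_derivable smooth_retr p0.
apply/rowP => i; rewrite (derive_coord _ dr).
have dx j := derive_linear_coord p u j (F := id) (fun a u v => erefl) (fun x => cvg_id).
have dd : is_derive p u (fun x : R4 => dot x x) (2 * dot p u).
  have -> : (fun x : R4 => dot x x) = (\sum_i (fun x : R4 => x 0 i * x 0 i)).
    by apply/funext => y; rewrite fct_sumE.
  apply: is_derive_eq; rewrite /dot mulr_sumr; apply: eq_bigr => j _.
  by rewrite -[_ *: _]/(_ * _); ring.
have [ddv ddE] := dd.
have hr := @is_derive_comp R R4 (fun y : R => (Num.sqrt y)^-1) (fun x : R4 => dot x x) p u _ (is_derive_rsqrt (dot_gt0 p0)) ddv.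
rewrite ddE pu !mulr0 in hr.
have [dx1 dx2] := dx i.
have [hr1 hr2] := hr.
rewrite (_ : (fun y : R4 => retr y 0 i) = (fun y : R4 => (Num.sqrt (dot y y))^-1 * y 0 i)); last first.
  by apply/funext => y; rewrite /retr mxE.
rewrite (deriveMf hr1 dx1) hr2 dx2 mul0r add0r.
by rewrite /= (Sp : dot p p = 1) sqrtr1 invr1 mul1r.
Qed.

Lemma tangent_frame p u : S3 p -> tangent p u ->
  u = dot u (hopf p) *: hopf p + dot u (jfield p) *: jfield p + dot u (kfield p) *: kfield p.
Proof.
rewrite /S3 /tangent /= => Sp pu.
apply: row4P; rewrite !mxD4 !mxZ4.
- rewrite -[LHS]mul1r -Sp -[LHS]subr0 -[X in _ - X](mul0r (p 0 0)) -pu !dotE /jfield /kfield !hopfE !row4E; ring.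
- rewrite -[LHS]mul1r -Sp -[LHS]subr0 -[X in _ - X](mul0r (p 0 1)) -pu !dotE /jfield /kfield !hopfE !row4E; ring.
- rewrite -[LHS]mul1r -Sp -[LHS]subr0 -[X in _ - X](mul0r (p 0 2%:R)) -pu !dotE /jfield /kfield !hopfE !row4E; ring.
- rewrite -[LHS]mul1r -Sp -[LHS]subr0 -[X in _ - X](mul0r (p 0 3%:R)) -pu !dotE /jfield /kfield !hopfE !row4E; ring.
Qed.

Lemma bergerE (eps : R) p u v : S3 p ->
  berger eps p u v = eps * (dot u v - dot u (hopf p) * dot v (hopf p))
                     + eps ^+ 2 * (dot u (hopf p) * dot v (hopf p)).
Proof.
move=> Sp; have hh : dot (hopf p) (hopf p) = 1.
  by rewrite -[RHS]Sp !dotE !hopfE !row4E; ring.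
rewrite /berger /horiz /vert !(dotBl, dotZl) ![dot _ (_ - _)]dotC !(dotBl, dotZl) ![dot _ (_ *: _)]dotC !dotZl hh.
by rewrite (dotC u v) (dotC (hopf p) u); ring.
Qed.
End Sphere.

(** * The orthonormal frame of the Berger metric *)

Section OrthonormalFrame.
Variables (R : realType) (eps : R) (eps_gt0 : 0 < eps).
Local Notation R4 := 'rV[R]_4.
Let sq := Num.sqrt eps.
Let sq0 : sq != 0. Proof. by rewrite gt_eqF // sqrtr_gt0. Qed.
Let sq2 : eps = sq ^+ 2. Proof. by rewrite sqr_sqrtr // ltW. Qed.

Definition frame_comb (a b c : R) (q : R4) : R4 :=
  eps^-1 * a *: hopf q + (Num.sqrt eps)^-1 * b *: jfield q + (Num.sqrt eps)^-1 * c *: kfield q.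

Lemma frame_tangent a b c q : tangent q (frame_comb a b c q).
Proof.
rewrite /tangent dotE /frame_comb !mxE4 hopfE /jfield /kfield !row4E; ring.
Qed.

Lemma berger_frame a b c a' b' c' q : S3 q ->
  berger eps q (frame_comb a b c q) (frame_comb a' b' c' q) = a * a' + b * b' + c * c'.
Proof.
move=> Sq; rewrite bergerE //.
have n1 : q 0 0 * q 0 0 + q 0 1 * q 0 1 + q 0 2%:R * q 0 2%:R + q 0 3%:R * q 0 3%:R = 1.
  by rewrite -dotE.
have dh x y z : dot (frame_comb x y z q) (hopf q) = eps^-1 * x.
  by rewrite -[RHS]mulr1 -n1 dotE /frame_comb !mxE4 hopfE /jfield /kfield !row4E; ring.
have dd x y z x' y' z' : dot (frame_comb x y z q) (frame_comb x' y' z' q) =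
   eps^-1 ^+ 2 * (x * x') + (Num.sqrt eps)^-1 ^+ 2 * (y * y' + z * z').
  by rewrite -[RHS]mulr1 -n1 dotE /frame_comb !mxE4 hopfE /jfield /kfield !row4E; ring.
rewrite !dh dd -/sq sq2; field; exact: sq0.
Qed.

(* The bracket of linear vector fields is their commutator, so these are the
   structure constants of the orthonormal frame. *)
Lemma frame_commutator v1 v2 v3 n1 n2 n3 q :
  frame_comb v1 v2 v3 (frame_comb n1 n2 n3 q) - frame_comb n1 n2 n3 (frame_comb v1 v2 v3 q)
  = frame_comb (2 * (n2 * v3 - n3 * v2)) (2 / eps * (n3 * v1 - n1 * v3))
      (2 / eps * (n1 * v2 - n2 * v1)) q.
Proof.
have e2 : eps^-1 = sq^-1 ^+ 2 by rewrite sq2 exprVn.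
apply: row4P; rewrite /frame_comb -/sq e2 !mxE4 !hopfE /jfield /kfield !row4E !mxE4 !row4E; ring.
Qed.

Lemma frame_combD a b c a' b' c' q :
  frame_comb (a + a') (b + b') (c + c') q = frame_comb a b c q + frame_comb a' b' c' q.
Proof. by apply: row4P; rewrite /frame_comb !mxE4; ring. Qed.
Lemma frame_combZ r a b c q : frame_comb (r * a) (r * b) (r * c) q = r *: frame_comb a b c q.
Proof. by apply: row4P; rewrite /frame_comb !mxE4; ring. Qed.

Section Calculus.
Variables (W : set R4) (oW : open W) (W0 : forall x, W x -> x != 0).
Variables (a b c : R4 -> R) (sa : smooth_on W a) (sb : smooth_on W b) (sc : smooth_on W c).

Lemma frame_field_coord i x : frame_comb (a x) (b x) (c x) (retr x) 0 i =
  (eps^-1 * a x * hopf (retr x) 0 i + sq^-1 * b x * jfield (retr x) 0 i)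
  + sq^-1 * c x * kfield (retr x) 0 i.
Proof. by rewrite /frame_comb !mxE4. Qed.

Let sretr : smooth_on W (@retr R).
Proof. by apply: smooth_sub (@smooth_retr R) => x /W0. Qed.

Let slin (F : R4 -> R4) i : linear F -> continuous F -> smooth_on W (fun x => F (retr x) 0 i).
Proof. by move=> lF cF; apply: smooth_coord => //; exact: (smooth_linear oW lF cF sretr). Qed.

Let shop i := slin i (@linear_hopf R) (@continuous_hopf R).
Let sj i := slin i (@linear_jfield R) (@continuous_jfield R).
Let sk i := slin i (@linear_kfield R) (@continuous_kfield R).

Let scal (r : R) f : smooth_on W f -> smooth_on W (fun x => r * f x).
Proof. by move=> sf; apply: (smooth_mul oW) sf; exact: (smooth_cst oW). Qed.

Lemma smooth_frame_field : smooth_on W (fun x => frame_comb (a x) (b x) (c x) (retr x)).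
Proof.
apply: (smooth_row oW) => i.
apply: (smooth_ext oW) (smooth_add oW (smooth_add oW (smooth_mul oW (scal eps^-1 sa) (shop i))
  (smooth_mul oW (scal sq^-1 sb) (sj i))) (smooth_mul oW (scal sq^-1 sc) (sk i))) => x _.
by rewrite frame_field_coord.
Qed.

(** The second term is the contribution of the frame: its fields are linear, so differentiating them
    along [Y] evaluates them at [Y]. *)
Lemma derive_frame_field q Y : W q -> S3 q -> tangent q Y ->
  'D_Y (fun x => frame_comb (a x) (b x) (c x) (retr x)) q =
  frame_comb ('D_Y a q) ('D_Y b q) ('D_Y c q) q + frame_comb (a q) (b q) (c q) Y.
Proof.
move=> Wq Sq tY.
have D (f : R4 -> R) : smooth_on W f -> derivable f q Y by move=> sf; exact: smooth_derivable sf Wq.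
have lin (F : R4 -> R4) i : linear F -> continuous F -> 'D_Y (fun x => F (retr x) 0 i) q = F Y 0 i.
  move=> lF cF; have dr : derivable (@retr R) q Y by exact: smooth_derivable sretr Wq.
  have [h1 h2] := is_derive_linear lF cF dr.
  by rewrite -[LHS](derive_coord _ h1) h2 derive_retr.
have Z (r : R) (f : R4 -> R) : smooth_on W f -> 'D_Y (fun y => r * f y) q = r * 'D_Y f q.
  by move=> sf; apply: deriveZ; exact: smooth_derivable sf Wq.
apply/rowP => i; rewrite (derive_coord _ (smooth_derivable smooth_frame_field Wq)).
rewrite (eq_derive_open Y oW (fun x _ => frame_field_coord i x) Wq).
have M1 := smooth_mul oW (scal eps^-1 sa) (shop i).
have M2 := smooth_mul oW (scal sq^-1 sb) (sj i).
have M3 := smooth_mul oW (scal sq^-1 sc) (sk i).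
rewrite (deriveDf (D _ (smooth_add oW M1 M2)) (D _ M3)) (deriveDf (D _ M1) (D _ M2)).
rewrite (deriveMf (D _ (scal eps^-1 sa)) (D _ (shop i))).
rewrite (deriveMf (D _ (scal sq^-1 sb)) (D _ (sj i))).
rewrite (deriveMf (D _ (scal sq^-1 sc)) (D _ (sk i))).
rewrite (lin _ i (@linear_hopf R) (@continuous_hopf R)).
rewrite (lin _ i (@linear_jfield R) (@continuous_jfield R)).
rewrite (lin _ i (@linear_kfield R) (@continuous_kfield R)).
rewrite !Z // (retr_id Sq) /frame_comb -/sq !mxE4; ring.
Qed.
End Calculus.
End OrthonormalFrame.

(** * From total geodesy to the quadratic identity *)

Section UnitTangent.
Variables (R : realType) (eps : R) (eps_gt0 : 0 < eps).
Local Notation R4 := 'rV[R]_4.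
Local Notation comb := (frame_comb eps).

Lemma bergerC p u v : S3 p -> berger eps p u v = berger eps p v u.
Proof. by move=> Sp; rewrite !bergerE // (dotC u v); ring. Qed.
Lemma bergerDl p u u' v : S3 p -> berger eps p (u + u') v = berger eps p u v + berger eps p u' v.
Proof. by move=> Sp; rewrite !bergerE // !dotDl; ring. Qed.
Lemma bergerBl p u u' v : S3 p -> berger eps p (u - u') v = berger eps p u v - berger eps p u' v.
Proof. by move=> Sp; rewrite !bergerE // !dotBl; ring. Qed.
Lemma bergerZr p (a : R) u v : S3 p -> berger eps p u (a *: v) = a * berger eps p u v.
Proof. by move=> Sp; rewrite (bergerC _ (a *: v) Sp) (bergerC u v Sp) !bergerE // !dotZl; ring. Qed.

Variables (U : set R4) (oU : open U) (v1 v2 v3 : R4 -> R).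
Let W := cone U.
Let oW : open W := open_cone oU.
Let W0 x : W x -> x != 0. Proof. by case. Qed.
Hypotheses (s1 : smooth_on W v1) (s2 : smooth_on W v2) (s3 : smooth_on W v3).
Hypotheses (r1 : forall x, v1 (retr x) = v1 x) (r2 : forall x, v2 (retr x) = v2 x)
  (r3 : forall x, v3 (retr x) = v3 x).
Variable TF : R4 -> set R4.
Hypothesis TFE : forall q, S3 q -> U q -> TF q = [set r *: comb (v1 q) (v2 q) (v3 q) q | r in setT].
Hypothesis TG : totally_geodesic eps (Defs.orthogonal eps TF).

Let W_S3 q : S3 q -> U q -> W q.
Proof. by move=> Sq Uq; split; [exact: S3_neq0|rewrite retr_id]. Qed.

Section FrameField.
Variables a b c : R4 -> R.
Hypotheses (sa : smooth_on W a) (sb : smooth_on W b) (sc : smooth_on W c).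
Hypotheses (ra : forall x, a (retr x) = a x) (rb : forall x, b (retr x) = b x)
  (rc : forall x, c (retr x) = c x).
Let X x := comb (a x) (b x) (c x) (retr x).

Lemma frame_field_retr x : W x -> X (retr x) = X x.
Proof. by move=> /W0 x0; rewrite /X ra rb rc retr_retr. Qed.

Lemma frame_vector_field : vector_field U X.
Proof.
split.
  apply: (smooth_ext oW) (smooth_frame_field eps oW W0 sa sb sc) => x Wx.
  by rewrite /= frame_field_retr.
by move=> q Sq Uq; rewrite /X retr_id //; exact: frame_tangent.
Qed.

Lemma dS3_frame_field q Y : S3 q -> U q -> tangent q Y ->
  dS3 X q Y = comb ('D_Y a q) ('D_Y b q) ('D_Y c q) q + comb (a q) (b q) (c q) Y.
Proof.
move=> Sq Uq tY; rewrite /dS3.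
rewrite (eq_derive_open (g := X) Y oW _ (W_S3 Sq Uq)); last by move=> x; exact: frame_field_retr.
exact: (derive_frame_field eps oW W0 sa sb sc (W_S3 Sq Uq) Sq tY).
Qed.
End FrameField.

Lemma derive_comb (f : R4 -> R) q a b c : smooth_on W f -> W q ->
  'D_(comb a b c q) f q = a * d1 eps f q + b * d2 eps f q + c * d3 eps f q.
Proof.
move=> sf Wq; rewrite /frame_comb !(deriveDdir oW sf _ _ Wq) !(deriveZdir sf _ _ Wq).
by rewrite /d1 /d2 /d3 !mulrA ![_ * eps^-1]mulrC ![_ * (Num.sqrt eps)^-1]mulrC.
Qed.

(** Take [N = V x w] with constant [w], a section of the orthogonal distribution. Total geodesy for
    the pair [N], [N] gives [g(nabla_N N, V) = 0], hence [g(N, nabla_N V) = 0] by differentiating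
    [g(N, V) = 0]. Torsion-freeness then turns [g([N, V], N)] into [- g(nabla_V N, N)], which is
    minus half the derivative of [g(N, N)] along [V]. Only brackets and derivatives of functions
    remain, and these are explicit in the frame. *)
Lemma lie_quadratic_S3 q : S3 q -> U q -> lie_quadratic eps v1 v2 v3 q.
Proof.
move=> Sq Uq w1 w2 w3.
have Wq := W_S3 Sq Uq.
pose n1 x := v2 x * w3 - v3 x * w2.
pose n2 x := v3 x * w1 - v1 x * w3.
pose n3 x := v1 x * w2 - v2 x * w1.
have sn (f g : R4 -> R) (r r' : R) : smooth_on W f -> smooth_on W g -> smooth_on W (fun x => f x * r - g x * r').
  move=> sf sg; apply: (smooth_add oW (f := fun x => f x * r)).
    by apply: (smooth_mul oW (f := f)) => //; exact: (smooth_cst oW).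
  apply: (smooth_opp oW (f := fun x => g x * r')).
  by apply: (smooth_mul oW (f := g)) => //; exact: (smooth_cst oW).
have sn1 : smooth_on W n1 by exact: sn.
have sn2 : smooth_on W n2 by exact: sn.
have sn3 : smooth_on W n3 by exact: sn.
have rn1 x : n1 (retr x) = n1 x by rewrite /n1 r2 r3.
have rn2 x : n2 (retr x) = n2 x by rewrite /n2 r3 r1.
have rn3 x : n3 (retr x) = n3 x by rewrite /n3 r1 r2.
pose V x := comb (v1 x) (v2 x) (v3 x) (retr x).
pose N x := comb (n1 x) (n2 x) (n3 x) (retr x).
have VV : vector_field U V by exact: frame_vector_field.
have VN : vector_field U N by exact: frame_vector_field.
have NE x : S3 x -> N x = comb (n1 x) (n2 x) (n3 x) x by move=> Sx; rewrite /N retr_id.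
have VE x : S3 x -> V x = comb (v1 x) (v2 x) (v3 x) x by move=> Sx; rewrite /V retr_id.
have NV x : S3 x -> berger eps x (N x) (V x) = 0.
  by move=> Sx; rewrite NE // VE // berger_frame // /n1 /n2 /n3; ring.
have secN : section_of (Defs.orthogonal eps TF) U N.
  split=> // x Sx Ux; split; first by rewrite NE //; exact: frame_tangent.
  move=> v; rewrite TFE // => -[r _ <-]; rewrite bergerZr // -VE // NV // mulr0 //.
have [nabla LC geo] := TG oU.
have [_ /(_ q Sq Uq) [_ /(_ (V q))]] := geo N N secN secN.
have VT : TF q (V q) by rewrite TFE //; exists 1 => //; rewrite scale1r VE.
move=> /(_ VT); rewrite bergerDl // => e1.
have {}e1 : berger eps q (nabla N N q) (V q) = 0.
  by move/eqP: e1; rewrite -mulr2n mulrn_eq0 /= => /eqP.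
have e2 := lc_metric LC VN VN VV Sq Uq.
have d0 : dS3 (fun x => berger eps x (N x) (V x)) q (N q) = 0.
  rewrite /dS3 (eq_derive_open (g := cst (0 : R)) (N q) oW _ Wq) ?derive_cst // => x [x0 _].
  by rewrite /= NV //; exact: retr_S3.
rewrite d0 e1 add0r in e2.
have e3 := lc_torsion_free LC VN VV Sq Uq.
have e4 := lc_metric LC VV VN VN Sq Uq.
have e5 : berger eps q (N q) (nabla V N q) + berger eps q (N q) (bracket N V q) = 0.
  have -> : nabla V N q = nabla N V q - bracket N V q by rewrite -e3 opprB addrC subrK.
  by rewrite (bergerC (N q) (_ - _) Sq) bergerBl // bergerC // -e2 (bergerC (bracket N V q) (N q) Sq); ring.
rewrite (bergerC (nabla V N q)) // in e4.
have tN : tangent q (N q) by rewrite NE //; exact: frame_tangent.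
have tV : tangent q (V q) by rewrite VE //; exact: frame_tangent.
have D (f : R4 -> R) : smooth_on W f -> derivable f q (V q) by move=> sf; exact: smooth_derivable sf Wq.
have e6 : dS3 (fun x => berger eps x (N x) (N x)) q (V q) =
   2 * (n1 q * 'D_(V q) n1 q + n2 q * 'D_(V q) n2 q + n3 q * 'D_(V q) n3 q).
  rewrite /dS3 (eq_derive_open (g := fun x => n1 x * n1 x + n2 x * n2 x + n3 x * n3 x) (V q) oW _ Wq); last first.
    move=> x [x0 _]; rewrite /= NE; last exact: retr_S3.
    by rewrite berger_frame; [rewrite rn1 rn2 rn3|exact: eps_gt0|exact: retr_S3].
  have [m1 m2 m3] := And3 (smooth_mul oW sn1 sn1) (smooth_mul oW sn2 sn2) (smooth_mul oW sn3 sn3).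
  rewrite (deriveDf (D _ (smooth_add oW m1 m2)) (D _ m3)) (deriveDf (D _ m1) (D _ m2)).
  rewrite (deriveMf (D _ sn1) (D _ sn1)) (deriveMf (D _ sn2) (D _ sn2)) (deriveMf (D _ sn3) (D _ sn3)).
  ring.
have e7 : bracket N V q = comb
   ('D_(N q) v1 q - 'D_(V q) n1 q + 2 * (n2 q * v3 q - n3 q * v2 q))
   ('D_(N q) v2 q - 'D_(V q) n2 q + 2 / eps * (n3 q * v1 q - n1 q * v3 q))
   ('D_(N q) v3 q - 'D_(V q) n3 q + 2 / eps * (n1 q * v2 q - n2 q * v1 q)) q.
  rewrite /bracket (dS3_frame_field s1 s2 s3 r1 r2 r3 Sq Uq tN).
  rewrite (dS3_frame_field sn1 sn2 sn3 rn1 rn2 rn3 Sq Uq tV).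
  have comb3 x1 x2 x3 y1 y2 y3 z1 z2 z3 : comb (x1 - y1 + z1) (x2 - y2 + z2) (x3 - y3 + z3) q =
      comb x1 x2 x3 q - comb y1 y2 y3 q + comb z1 z2 z3 q.
    by apply: row4P; rewrite /frame_comb !mxE4; ring.
  by rewrite comb3 -(frame_commutator eps_gt0) -NE // -VE // opprD addrACA.
have e8 : berger eps q (N q) (nabla V N q) = n1 q * 'D_(V q) n1 q + n2 q * 'D_(V q) n2 q + n3 q * 'D_(V q) n3 q.
  by apply: (@mulfI _ 2); rewrite ?pnatr_eq0 // -e6 e4; ring.
rewrite e8 e7 {1}NE // berger_frame // NE // in e5.
rewrite !derive_comb // in e5.
(* The derivatives of [n1], [n2], [n3] along [V] cancel between the bracket and the derivative of
   [g(N, N)]. *)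
cbv zeta; rewrite -/(n1 q) -/(n2 q) -/(n3 q) -[RHS]e5; ring.
Qed.
End UnitTangent.

Section Homogeneous.
Variable R : realType.
Local Notation R4 := 'rV[R]_4.

Lemma retr0 : retr (0 : R4) = 0.
Proof. by rewrite /retr scaler0. Qed.

Lemma retr_idem (x : R4) : retr (retr x) = retr x.
Proof. by have [->|/retr_retr//] := eqVneq x 0; rewrite !retr0. Qed.

(* Functions of the form [f \o retr] are homogeneous of degree 0. *)
Lemma derive_homogeneous (f : R4 -> R) (a : R) x u : 0 < a -> (forall y, f (retr y) = f y) ->
  'D_(a *: u) f (a *: x) = 'D_u f x.
Proof.
move=> a0 hf.
have fa y : f (a *: y) = f y by rewrite -hf retrZ // hf.
rewrite /derive; set g1 := fun h => h^-1 *: _; set g2 := fun h => h^-1 *: _.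
suff -> : g1 = g2 by []; apply/funext => h; rewrite /g1 /g2 /=.
by rewrite fa scalerA mulrC -scalerA -scalerDr fa.
Qed.

Lemma derive_field_homogeneous (f : R4 -> R) (F : R4 -> R4) x : x != 0 -> linear F ->
  (forall y, f (retr y) = f y) -> 'D_(F (retr x)) f (retr x) = 'D_(F x) f x.
Proof.
move=> x0 lF hf; rewrite /retr; set a := _^-1.
have F0 : F 0 = 0 by have := lF (-1) 0 0; rewrite scaler0 addr0 scaleN1r addNr.
have -> : F (a *: x) = a *: F x by rewrite -[a *: x]addr0 lF F0 addr0.
by apply: derive_homogeneous => //; rewrite invr_gt0 sqrtr_gt0 dot_gt0.
Qed.
End Homogeneous.

Section MetricGood.
Variables (R : realType) (eps : R) (eps_gt0 : 0 < eps).
Local Notation R4 := 'rV[R]_4.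
Let sq := Num.sqrt eps.
Let sq0 : sq != 0. Proof. by rewrite gt_eqF // sqrtr_gt0. Qed.
Let sq2 : eps = sq ^+ 2. Proof. by rewrite sqr_sqrtr // ltW. Qed.

Lemma lie_quadratic_retr (v1 v2 v3 : R4 -> R) x : x != 0 ->
  (forall y, v1 (retr y) = v1 y) -> (forall y, v2 (retr y) = v2 y) -> (forall y, v3 (retr y) = v3 y) ->
  lie_quadratic eps v1 v2 v3 (retr x) -> lie_quadratic eps v1 v2 v3 x.
Proof.
move=> x0 r1 r2 r3; rewrite /lie_quadratic /d1 /d2 /d3.
have h f := derive_field_homogeneous x0 (@linear_hopf R) (f := f).
have j f := derive_field_homogeneous x0 (@linear_jfield R) (f := f).
have k f := derive_field_homogeneous x0 (@linear_kfield R) (f := f).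
by rewrite (h _ r1) (h _ r2) (h _ r3) (j _ r1) (j _ r2) (j _ r3) (k _ r1) (k _ r2) (k _ r3) r1 r2 r3.
Qed.

Variable TF : R4 -> set R4.
Hypothesis TFm : metric_foliation eps TF.

(** The components of a local spanning field in the frame, divided by their norm. Reading them at
    [retr x] makes them homogeneous of degree 0, so the quadratic identity extends from the sphere
    to the cone. *)
Lemma metric_good p : S3 p -> exists (U : set R4) (v1 v2 v3 : R4 -> R),
  [/\ open U, U p, good eps v1 v2 v3 (cone U),
    [/\ forall x, v1 (retr x) = v1 x, forall x, v2 (retr x) = v2 x & forall x, v3 (retr x) = v3 x] &
    forall q, S3 q -> U q -> TF q = [set r *: frame_comb eps (v1 q) (v2 q) (v3 q) q | r in setT]].
Proof.
case: TFm => fol geo Sp.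
have [U [V [oU Up [sV tV] hV]]] := fol p Sp.
pose W := cone U; have oW : open W by exact: open_cone.
have W0 x : W x -> x != 0 by case.
have sr : smooth_on W (@retr R) by apply: smooth_sub (@smooth_retr R) => x /W0.
pose a1 x := dot ((V \o @retr R) x) (hopf (retr x)).
pose a2 x := dot ((V \o @retr R) x) (jfield (retr x)).
pose a3 x := dot ((V \o @retr R) x) (kfield (retr x)).
have sa1 : smooth_on W a1.
  exact: (smooth_dot oW sV (smooth_linear oW (@linear_hopf R) (@continuous_hopf R) sr)).
have sa2 : smooth_on W a2.
  exact: (smooth_dot oW sV (smooth_linear oW (@linear_jfield R) (@continuous_jfield R) sr)).
have sa3 : smooth_on W a3.
  exact: (smooth_dot oW sV (smooth_linear oW (@linear_kfield R) (@continuous_kfield R) sr)).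
have ra1 x : a1 (retr x) = a1 x by rewrite /a1 /= retr_idem.
have ra2 x : a2 (retr x) = a2 x by rewrite /a2 /= retr_idem.
have ra3 x : a3 (retr x) = a3 x by rewrite /a3 /= retr_idem.
pose b1 x := eps * a1 x; pose b2 x := sq * a2 x; pose b3 x := sq * a3 x.
have sc (r : R) f : smooth_on W f -> smooth_on W (fun x => r * f x).
  by move=> sf; apply: (smooth_mul oW) sf; exact: (smooth_cst oW).
have sb1 : smooth_on W b1 by exact: sc.
have sb2 : smooth_on W b2 by exact: sc.
have sb3 : smooth_on W b3 by exact: sc.
pose N x := b1 x * b1 x + b2 x * b2 x + b3 x * b3 x.
have sN : smooth_on W N.
  exact: (smooth_add oW (smooth_add oW (smooth_mul oW sb1 sb1) (smooth_mul oW sb2 sb2)) (smooth_mul oW sb3 sb3)).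
have VE q : S3 q -> U q -> V q = frame_comb eps (b1 q) (b2 q) (b3 q) q.
  move=> Sq Uq; rewrite {1}(tangent_frame Sq (tV q Sq Uq)) /frame_comb.
  rewrite /b1 /b2 /b3 /a1 /a2 /a3 /= retr_id // -/sq !mulrA !mulVf ?mul1r //.
  by rewrite gt_eqF.
have N0 x : W x -> 0 < N x.
  move=> [x0 Ux]; have Sx := retr_S3 x0.
  rewrite /N -!expr2 lt_def !addr_ge0 ?sqr_ge0 // andbT.
  apply/negP; rewrite !paddr_eq0 ?addr_ge0 ?sqr_ge0 // !sqrf_eq0 => /andP[/andP[/eqP h1 /eqP h2] /eqP h3].
  have [Vn _] := hV _ Sx Ux; apply: Vn; rewrite VE // /b1 /b2 /b3 ra1 ra2 ra3 -/(b1 x) -/(b2 x) -/(b3 x).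
  by rewrite h1 h2 h3 /frame_comb !mulr0 !scale0r !addr0.
pose r x := (Num.sqrt (N x))^-1.
have sr' : smooth_on W r by exact: (smooth_rsqrt oW N0 sN).
have rr x : r (retr x) = r x by rewrite /r /N /b1 /b2 /b3 ra1 ra2 ra3.
have r0 x : W x -> r x != 0 by move=> /N0 n0; rewrite /r invr_neq0 // gt_eqF // sqrtr_gt0.
pose v1 x := r x * b1 x; pose v2 x := r x * b2 x; pose v3 x := r x * b3 x.
have rv1 x : v1 (retr x) = v1 x by rewrite /v1 rr /b1 ra1.
have rv2 x : v2 (retr x) = v2 x by rewrite /v2 rr /b2 ra2.
have rv3 x : v3 (retr x) = v3 x by rewrite /v3 rr /b3 ra3.
have sv1 : smooth_on W v1 by exact: (smooth_mul oW).
have sv2 : smooth_on W v2 by exact: (smooth_mul oW).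
have sv3 : smooth_on W v3 by exact: (smooth_mul oW).
have TFE q : S3 q -> U q -> TF q = [set r *: frame_comb eps (v1 q) (v2 q) (v3 q) q | r in setT].
  move=> Sq Uq; have [_ ->] := hV q Sq Uq; rewrite VE // frame_combZ.
  have rq : r q != 0 by apply: r0; split; [exact: S3_neq0|rewrite retr_id].
  apply/seteqP; split=> y [t _ <-].
    by exists (t / r q) => //; rewrite scalerA divfK.
  by exists (t * r q) => //; rewrite scalerA.
exists U, v1, v2, v3; split=> //; split=> //.
  move=> x Wx; transitivity (r x ^+ 2 * N x); first by rewrite /v1 /v2 /v3 /N; ring.
  by rewrite /r exprVn sqr_sqrtr ?ltW ?N0 // mulVf // gt_eqF // N0.
move=> x [x0 Ux]; apply: lie_quadratic_retr => //.
exact: (lie_quadratic_S3 eps_gt0 oU sv1 sv2 sv3 rv1 rv2 rv3 TFE geo (retr_S3 x0) Ux).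
Qed.
End MetricGood.

(** * Killing fields and local rigidity *)

Section KillingFields.
Variable R : realType.
Local Notation R4 := 'rV[R]_4.

(* (iz, -iw), (-w, z) and (-iw, -iz): together with [hopf] they span u(2) *)
Definition rfield1 (p : R4) : R4 := row4 (- p 0 1) (p 0 0) (p 0 3%:R) (- p 0 2%:R).
Definition rfield2 (p : R4) : R4 := row4 (- p 0 2%:R) (- p 0 3%:R) (p 0 0) (p 0 1).
Definition rfield3 (p : R4) : R4 := row4 (p 0 3%:R) (- p 0 2%:R) (p 0 1) (- p 0 0).

Definition killf (k x : R4) : R4 :=
  k 0 0 *: rfield1 x + k 0 1 *: rfield2 x + k 0 2%:R *: rfield3 x + k 0 3%:R *: hopf x.

Ltac row4_linear := move=> a u v; apply: row4P; rewrite /rfield1 /rfield2 /rfield3 ?(mxE4, row4E); ring.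
Lemma linear_rfield1 : linear rfield1. Proof. row4_linear. Qed.
Lemma linear_rfield2 : linear rfield2. Proof. row4_linear. Qed.
Lemma linear_rfield3 : linear rfield3. Proof. row4_linear. Qed.
Let c0 (i : 'I_4) := @smooth_id_coord R 3 setT openT i.
Lemma continuous_rfield1 : continuous rfield1.
Proof. by apply: smooth_setT_continuous; apply: smooth_row4; do ?apply: smooth_opp => //; try exact: openT; exact: c0. Qed.
Lemma continuous_rfield2 : continuous rfield2.
Proof. by apply: smooth_setT_continuous; apply: smooth_row4; do ?apply: smooth_opp => //; try exact: openT; exact: c0. Qed.
Lemma continuous_rfield3 : continuous rfield3.
Proof. by apply: smooth_setT_continuous; apply: smooth_row4; do ?apply: smooth_opp => //; try exact: openT; exact: c0. Qed.

Lemma tangent_rfield p u : S3 p -> tangent p u ->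
  u = dot (rfield1 p) u *: rfield1 p + dot (rfield2 p) u *: rfield2 p + dot (rfield3 p) u *: rfield3 p.
Proof.
rewrite /S3 /tangent /= => Sp pu.
have h i : u 0 i = dot p p * u 0 i - dot p u * p 0 i by rewrite Sp pu; ring.
apply: row4P; rewrite !mxD4 !mxZ4 [LHS]h !dotE /rfield1 /rfield2 /rfield3 !row4E; ring.
Qed.

Lemma derive_dot (V : normedModType R) (f g : V -> R4) x v : derivable f x v -> derivable g x v ->
  'D_v (fun y => dot (f y) (g y)) x = dot ('D_v f x) (g x) + dot (f x) ('D_v g x).
Proof.
move=> df dg.
have dfi i : derivable (fun y => f y 0 i) x v := (derivable_mxP _ _ _).1 df 0 i.
have dgi i : derivable (fun y => g y 0 i) x v := (derivable_mxP _ _ _).1 dg 0 i.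
have -> : (fun y => dot (f y) (g y)) = \sum_i (fun y => f y 0 i * g y 0 i).
  by apply/funext => y; rewrite fct_sumE.
rewrite derive_sum; last by move=> i; exact: derivableM (dfi i) (dgi i).
rewrite /dot -big_split; apply: eq_bigr => i _ /=.
by rewrite (deriveMf (dfi i) (dgi i)) (derive_coord _ df) (derive_coord _ dg).
Qed.

Lemma derive_radial (f : R4 -> R) r : (forall y, f (retr y) = f y) -> 'D_r f r = 0.
Proof.
move=> hf; apply: lim_near_cst => //; near=> h.
have h1 : 0 < h + 1.
  have : `|h| < 1 by near: h; exact: dnbhs0_lt.
  by rewrite ltr_norml => /andP[h1 _]; lra.
have e : h *: r + r = (h + 1) *: r by rewrite scalerDl scale1r.
have -> : (f \o shift r) (h *: r) = f r by rewrite /= e -hf retrZ // hf.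
by rewrite subrr scaler0.
Unshelve. all: by end_near. Qed.
End KillingFields.

(* [moment_equation] is [D Phi = mu Phi] in the left-invariant frame, for
   [Phi = (zcoef, v2, v3, lamp)]. *)
Section Moment.
Variables (R : realType) (eps : R) (eps_gt0 : 0 < eps) (eps_neq1 : eps <> 1).
Local Notation R4 := 'rV[R]_4.
Local Notation comb := (frame_comb eps).
Variables (U : set R4) (v1 v2 v3 : R4 -> R).
Let W := cone U.
Hypothesis gW : good eps v1 v2 v3 W.
Hypotheses (r1 : forall x, v1 (retr x) = v1 x) (r2 : forall x, v2 (retr x) = v2 x)
  (r3 : forall x, v3 (retr x) = v3 x).
Let oW := good_open gW.
Let m : R := 2 / eps.
Let W0 x : W x -> x != 0. Proof. by case. Qed.
Local Notation lam := (lamf eps v1 v2 v3).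
Local Notation Lam := (Lamf eps v1 v2 v3).
Let mu (y2 y3 : R) (q : R4) := lam q * (y2 * v3 q - y3 * v2 q).

(** In the splitting of [V] into [lamp * e1], which is [Lam / 2] times [X], and a field with
    components [zcoef], [v2], [v3], the second part turns out to be proportional to a
    right-invariant field. *)
Definition lamp x : R := eps / 2 * Lam x.
Definition zcoef x : R := v1 x - lamp x.

Lemma smooth_lamp : smooth_on W lamp.
Proof. by apply: (smooth_mul oW) (smooth_Lamf gW); exact: (smooth_cst oW). Qed.
Lemma smooth_zcoef : smooth_on W zcoef.
Proof. apply: (smooth_add oW (good_v1 gW)); exact: (smooth_opp oW smooth_lamp). Qed.

Lemma moment_equation q y1 y2 y3 : W q ->
  [/\ y1 * d1 eps lamp q + y2 * d2 eps lamp q + y3 * d3 eps lamp q = mu y2 y3 q * lamp q,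
   y1 * d1 eps zcoef q + y2 * d2 eps zcoef q + y3 * d3 eps zcoef q
     + 2 * (y2 * v3 q - y3 * v2 q) = mu y2 y3 q * zcoef q,
   y1 * d1 eps v2 q + y2 * d2 eps v2 q + y3 * d3 eps v2 q
     + 2 / eps * (y3 * zcoef q - y1 * v3 q) = mu y2 y3 q * v2 q &
   y1 * d1 eps v3 q + y2 * d2 eps v3 q + y3 * d3 eps v3 q
     + 2 / eps * (y1 * v2 q - y2 * zcoef q) = mu y2 y3 q * v3 q].
Proof.
move=> Wq.
have [k1 k2 k3 kw [l1 l2 l3]] := good_killing eps_gt0 eps_neq1 gW Wq.
have [_ [e11 e12 e13] [e21 e22 e23] [e31 e32 e33]] := good_solved gW Wq.
have u := good_unit gW Wq.
have eps0 : eps != 0 by rewrite gt_eqF.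
have D (f : R4 -> R) w : smooth_on W f -> derivable f q w by move=> sf; exact: smooth_derivable sf Wq.
have Dlp w : 'D_w lamp q = eps / 2 * 'D_w Lam q.
  by apply: deriveZ; apply: D; exact: smooth_Lamf.
have Dz w : 'D_w zcoef q = 'D_w v1 q - eps / 2 * 'D_w Lam q.
  rewrite -Dlp; apply: deriveB; apply: D; [exact: good_v1 gW|exact: smooth_lamp].
have p1 : d1 eps lamp q = eps / 2 * d1 eps Lam q by rewrite /d1 Dlp mulrCA.
have p2 : d2 eps lamp q = eps / 2 * d2 eps Lam q by rewrite /d2 Dlp mulrCA.
have p3 : d3 eps lamp q = eps / 2 * d3 eps Lam q by rewrite /d3 Dlp mulrCA.
have z1 : d1 eps zcoef q = d1 eps v1 q - eps / 2 * d1 eps Lam q by rewrite /d1 Dz mulrBr mulrCA.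
have z2 : d2 eps zcoef q = d2 eps v1 q - eps / 2 * d2 eps Lam q by rewrite /d2 Dz mulrBr mulrCA.
have z3 : d3 eps zcoef q = d3 eps v1 q - eps / 2 * d3 eps Lam q by rewrite /d3 Dz mulrBr mulrCA.
have LE : Lam q = lam q + (2 / eps - 2) * v1 q by [].
rewrite p1 p2 p3 z1 z2 z3 l1 l2 l3 e11 e12 e13 e21 e22 e23 e31 e32 e33 k1 k2 k3 kw.
rewrite /mu /zcoef /lamp LE.
move: (v1 q) (v2 q) (v3 q) (lam q) u => c p s l u.
have hs : s ^+ 2 = 1 - c ^+ 2 - p ^+ 2 by rewrite -u; ring.
split.
- by field.
- by field.
- apply: subr0_eq; transitivity (y3 * l * (1 - (c ^+ 2 + p ^+ 2 + s ^+ 2)) * -1); first by field.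
  by rewrite u; ring.
- apply: subr0_eq; transitivity (y2 * l * (1 - (c ^+ 2 + p ^+ 2 + s ^+ 2))); first by field.
  by rewrite u; ring.
Qed.
End Moment.

Section ProjectivelyConstant.
Variables (R : realType) (V : normedModType R).

Lemma ball_cst (f : V -> R) p (d : R) :
  (forall x u, ball p d x -> derivable f x u /\ 'D_u f x = 0) ->
  forall x, ball p d x -> f x = f p.
Proof.
move=> h x px.
have hb s : `|s| <= 1 -> ball p d (s *: (x - p) + p).
  move=> s1; move: px; rewrite -!ball_normE /ball_ /= opprD addrCA subrr addr0 normrN normrZ distrC.
  by apply: le_lt_trans; rewrite ler_piMl.
have [|s s1] := @MVT0 R (fun t => f (t *: (x - p) + p)) (fun s => 'D_(x - p) f (s *: (x - p) + p)) 1.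
  by move=> s; rewrite normr1 => s1; apply: is_derive_line; have [] := h _ (x - p) (hb s s1).
rewrite normr1 in s1; rewrite scale1r scale0r add0r subrK (h _ (x - p) (hb s s1)).2 mul0r.
by move/eqP; rewrite subr_eq0 => /eqP.
Qed.

(* The products [f i * f j / |f|^2] have zero derivative. *)
Lemma direction_cst n (f : 'I_n -> V -> R) (W : set V) p : open W -> W p ->
  (forall i, smooth_on W (f i)) -> (forall x, W x -> 0 < \sum_i f i x ^+ 2) ->
  (forall x u, W x -> exists mu, forall i, 'D_u (f i) x = mu * f i x) ->
  exists2 d : R, 0 < d & forall x, ball p d x -> W x /\
    exists2 c, c != 0 & forall i, f i p = c * f i x.
Proof.
move=> oW Wp sf N0 Df.
have /nbhs_ballP[d /= d0 dW] : nbhs p W by exact: open_nbhs_nbhs.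
exists d => // x px; split; first exact: dW.
pose N x := \sum_i f i x ^+ 2.
have sN : smooth_on W N.
  apply: smooth_sum => // i; apply: (smooth_ext oW) (smooth_mul oW (sf i) (sf i)) => y _.
  by rewrite expr2.
have NN y : W y -> N y != 0 by move=> Wy; rewrite gt_eqF // N0.
have siN := smooth_inv oW NN sN.
pose P i j y := (f i y * f j y) * (N y)^-1.
have D (g : V -> R) y u : smooth_on W g -> W y -> derivable g y u.
  by move=> sg Wy; exact: smooth_derivable sg Wy.
have P0 i j : P i j x = P i j p.
  apply: (ball_cst (d := d)) px => y u /dW Wy.
  have sm := smooth_mul oW (sf i) (sf j).
  split; first exact: D (smooth_mul oW sm siN) Wy.
  have [mu hmu] := Df y u Wy.
  rewrite (deriveMf (D _ y u sm Wy) (D _ y u siN Wy)).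
  rewrite (deriveMf (D _ y u (sf i) Wy) (D _ y u (sf j) Wy)) !hmu.
  rewrite (deriveV (NN y Wy) (D _ y u sN Wy)).
  have -> : 'D_u N y = 2 * mu * N y.
    have -> : N = \sum_i (fun z => f i z * f i z).
      by apply/funext => z; rewrite fct_sumE; apply: eq_bigr => k _; rewrite expr2.
    rewrite derive_sum; last by move=> k; exact: derivableM (D _ y u (sf k) Wy) (D _ y u (sf k) Wy).
    rewrite fct_sumE mulr_sumr; apply: eq_bigr => k _.
    by rewrite (deriveMf (D _ y u (sf k) Wy) (D _ y u (sf k) Wy)) hmu; ring.
  by have := NN y Wy => n0; rewrite -[_ *: _]/(_ * _); field.
(* Contracting the equality of the products at [x] and at [p] with the vector of the [f j p] shows
   that the two vectors are proportional, with this factor. *)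
pose c := \sum_j f j p * f j x / N x.
have E i : f i p = c * f i x.
  have : \sum_j P i j x * f j p = \sum_j P i j p * f j p by apply: eq_bigr => j _; rewrite P0.
  have -> : \sum_j P i j p * f j p = f i p.
    transitivity (f i p * (N p)^-1 * N p); last by rewrite divfK // NN.
    by rewrite /N mulr_sumr; apply: eq_bigr => j _; rewrite /P; ring.
  move=> <-; rewrite /c mulr_suml; apply: eq_bigr => j _; rewrite /P; ring.
exists c => //; apply/negP => /eqP c0.
have := NN p Wp; rewrite /N big1 ?eqxx // => i _.
by rewrite E c0 mul0r expr0n.
Qed.
End ProjectivelyConstant.

(** * Local rigidity: the moments have a constant direction *)

Section LocalKilling.
Variables (R : realType) (eps : R) (eps_gt0 : 0 < eps) (eps_neq1 : eps <> 1).
Local Notation R4 := 'rV[R]_4.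
Local Notation comb := (frame_comb eps).
Let sq := Num.sqrt eps.
Let sq0 : sq != 0. Proof. by rewrite gt_eqF // sqrtr_gt0. Qed.

Lemma tangent_comb q Y : S3 q -> tangent q Y -> exists y1 y2 y3, Y = comb y1 y2 y3 q.
Proof.
move=> Sq tY; exists (eps * dot Y (hopf q)), (sq * dot Y (jfield q)), (sq * dot Y (kfield q)).
by rewrite {1}(tangent_frame Sq tY) /frame_comb -/sq !mulrA !mulVf ?mul1r // gt_eqF.
Qed.

(** Left-invariant fields commute with right-invariant ones and are skew. *)
Lemma rfield_skew (y1 y2 y3 b1 b2 b3 : R) q :
  [/\ dot (rfield1 (comb y1 y2 y3 q)) (comb b1 b2 b3 q) = - dot (rfield1 q) (comb y1 y2 y3 (comb b1 b2 b3 q)),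
      dot (rfield2 (comb y1 y2 y3 q)) (comb b1 b2 b3 q) = - dot (rfield2 q) (comb y1 y2 y3 (comb b1 b2 b3 q)) &
      dot (rfield3 (comb y1 y2 y3 q)) (comb b1 b2 b3 q) = - dot (rfield3 q) (comb y1 y2 y3 (comb b1 b2 b3 q))].
Proof.
by split; rewrite !dotE /frame_comb /rfield1 /rfield2 /rfield3 !row4E !mxE4 !hopfE /jfield /kfield !row4E !mxE4 !row4E; ring.
Qed.

Section Local.
Variables (U : set R4) (oU : open U) (v1 v2 v3 : R4 -> R).
Let W := cone U.
Hypothesis gW : good eps v1 v2 v3 W.
Hypotheses (r1 : forall x, v1 (retr x) = v1 x) (r2 : forall x, v2 (retr x) = v2 x)
  (r3 : forall x, v3 (retr x) = v3 x).
Let oW : open W := good_open gW.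
Let W0 x : W x -> x != 0. Proof. by case. Qed.
Local Notation lp := (lamp eps v1 v2 v3).
Local Notation zc := (zcoef eps v1 v2 v3).
Let slp : smooth_on W lp := smooth_lamp gW.
Let szc : smooth_on W zc := smooth_zcoef gW.
Let s2 := good_v2 gW.
Let s3 := good_v3 gW.
Hypothesis rlp : forall x, lp (retr x) = lp x.

Definition zfield x := comb (zc x) (v2 x) (v3 x) (retr x).
(** These are coordinates of [V] with respect to the fields in [killf]. On the sphere [rfield1],
    [rfield2], [rfield3] are orthonormal, so the first three are inner products with [zfield]; the
    factor [eps^-1] in the last one comes from [e1 = X / eps]. *)
Definition moment (i : 'I_4) (x : R4) : R :=
  (row4 (dot (rfield1 (retr x)) (zfield x)) (dot (rfield2 (retr x)) (zfield x))
        (dot (rfield3 (retr x)) (zfield x)) (eps^-1 * lp x)) 0 i.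

Let sretr : smooth_on W (@retr R).
Proof. by apply: smooth_sub (@smooth_retr R) => x /W0. Qed.
Let sz : smooth_on W zfield := smooth_frame_field eps oW W0 szc s2 s3.

Lemma smooth_moment i : smooth_on W (moment i).
Proof.
have sd (F : R4 -> R4) : linear F -> continuous F -> smooth_on W (fun x => dot (F (retr x)) (zfield x)).
  by move=> lF cF; exact: (smooth_dot oW (smooth_linear oW lF cF sretr) sz).
apply: (smooth_coord oW); apply: (smooth_row4 oW).
- exact: sd (@linear_rfield1 R) (@continuous_rfield1 R).
- exact: sd (@linear_rfield2 R) (@continuous_rfield2 R).
- exact: sd (@linear_rfield3 R) (@continuous_rfield3 R).
- by apply: (smooth_mul oW) slp; exact: (smooth_cst oW).
Qed.

(** Extend [Y] with constant frame components. In the derivative of an inner product of [zfield]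
    with a right-invariant field, [rfield_skew] moves [Y] to the other side, and what appears is the
    bracket of [Y] with [zfield]. By [moment_equation] this bracket is [mu] times [zfield]. *)
Lemma moment_derive_S3 q Y : W q -> S3 q -> tangent q Y ->
  exists mu, forall i, 'D_Y (moment i) q = mu * moment i q.
Proof.
move=> Wq Sq tY; have [y1 [y2 [y3 YE]]] := tangent_comb Sq tY.
have [e1 e2 e3 e4] := moment_equation eps_gt0 eps_neq1 gW y1 y2 y3 Wq.
have DY (f : R4 -> R) : smooth_on W f -> 'D_Y f q = y1 * d1 eps f q + y2 * d2 eps f q + y3 * d3 eps f q.
  by move=> sf; rewrite YE; exact: (derive_comb eps oU y1 y2 y3 sf Wq).
set mu := lamf eps v1 v2 v3 q * (y2 * v3 q - y3 * v2 q) in e1 e2 e3 e4.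
have zq : zfield q = comb (zc q) (v2 q) (v3 q) q by rewrite /zfield retr_id.
have dz : derivable zfield q Y by exact: smooth_derivable sz Wq.
have key (F : R4 -> R4) : linear F -> continuous F ->
    dot (F (comb y1 y2 y3 q)) (zfield q) = - dot (F q) (comb y1 y2 y3 (zfield q)) ->
    'D_Y (fun x => dot (F (retr x)) (zfield x)) q = mu * dot (F (retr q)) (zfield q).
  move=> lF cF sk.
  have dr : derivable (@retr R) q Y by exact: smooth_derivable sretr Wq.
  have [h1 h2] := is_derive_linear lF cF dr.
  rewrite (derive_dot h1 dz) h2 derive_retr // (derive_frame_field eps oW W0 szc s2 s3 Wq Sq tY).
  rewrite /= retr_id // {1}YE sk (DY _ szc) (DY _ s2) (DY _ s3) zq.
  have dotDr u v w : dot u (v + w) = dot u v + dot u w by rewrite dotC dotDl !(dotC _ u).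
  have dotNr u v : dot u (- v) = - dot u v by rewrite dotC -scaleN1r dotZl mulN1r dotC.
  have fc := frame_commutator eps_gt0 (zc q) (v2 q) (v3 q) y1 y2 y3 q.
  rewrite {1}YE; set B := comb y1 y2 y3 (comb _ _ _ q) in fc *; set C := comb _ _ _ (comb y1 y2 y3 q) in fc *.
  set A := comb _ _ _ q.
  have E : A + C - B = mu *: comb (zc q) (v2 q) (v3 q) q.
    by rewrite -addrA fc -frame_combD e2 e3 e4 frame_combZ.
  have -> : mu * dot (F q) (comb (zc q) (v2 q) (v3 q) q) = dot (F q) (A + C - B).
    by rewrite E dotC -dotZl dotC.
  by rewrite [RHS]dotDr dotNr addrC.
have [k1 k2 k3] := rfield_skew y1 y2 y3 (zc q) (v2 q) (v3 q) q.
rewrite -zq in k1 k2 k3.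
exists mu; apply: ord4P; rewrite /moment ?row4E.
- rewrite (eq_derive_open Y oW (g := fun x => dot (rfield1 (retr x)) (zfield x)) _ Wq).
    exact: key (@linear_rfield1 R) (@continuous_rfield1 R) k1.
  by move=> x _; exact: row4E0.
- rewrite (eq_derive_open Y oW (g := fun x => dot (rfield2 (retr x)) (zfield x)) _ Wq).
    exact: key (@linear_rfield2 R) (@continuous_rfield2 R) k2.
  by move=> x _; exact: row4E1.
- rewrite (eq_derive_open Y oW (g := fun x => dot (rfield3 (retr x)) (zfield x)) _ Wq).
    exact: key (@linear_rfield3 R) (@continuous_rfield3 R) k3.
  by move=> x _; exact: row4E2.
- rewrite (eq_derive_open Y oW (g := fun x => eps^-1 * lp x) _ Wq); last by move=> x _; exact: row4E3.
  rewrite [LHS](@deriveZ R R4 R lp eps^-1); last exact: smooth_derivable slp Wq.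
  by rewrite (DY _ slp) e1 -[LHS]/(eps^-1 * (mu * lp q)) mulrCA.
Qed.

Lemma moment_retr i x : moment i (retr x) = moment i x.
Proof. by rewrite /moment /zfield /zcoef rlp r1 r2 r3 retr_idem. Qed.

(** Homogeneity of degree 0 moves the base point to the sphere and kills the radial part of the
    direction. *)
Lemma moment_derive x u : W x -> exists mu, forall i, 'D_u (moment i) x = mu * moment i x.
Proof.
move=> Wx; have x0 := W0 Wx; have Sx := retr_S3 x0.
set r := retr x in Sx.
have Wr : W r by case: Wx => _ Ux; split; [exact: S3_neq0|rewrite /r retr_idem].
pose a := (Num.sqrt (dot x x))^-1.
have a0 : 0 < a by rewrite invr_gt0 sqrtr_gt0 dot_gt0.
pose b := dot r (a *: u).
pose Y := a *: u - b *: r.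
have tY : tangent r Y.
  by rewrite /tangent dotC dotBl dotZl (Sx : dot r r = 1) mulr1 /b dotC subrr.
have [mu hmu] := moment_derive_S3 Wr Sx tY.
exists mu => i.
have sm := smooth_moment i.
rewrite -(derive_homogeneous x u a0 (moment_retr i)) -[a *: x]/r.
have -> : a *: u = b *: r + Y by rewrite /Y addrC subrK.
rewrite (deriveDdir oW sm _ _ Wr) (deriveZdir sm _ _ Wr) (derive_radial _ (moment_retr i)).
by rewrite mulr0 add0r hmu moment_retr.
Qed.

Lemma moment_killf q : S3 q -> killf (\row_i moment i q) q = comb (v1 q) (v2 q) (v3 q) q.
Proof.
move=> Sq; have tz : tangent q (zfield q) by rewrite /zfield retr_id //; exact: frame_tangent.
rewrite /killf !mxE /moment !row4E retr_id // -(tangent_rfield Sq tz) /zfield retr_id //.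
by apply: row4P; rewrite /frame_comb /zcoef !mxE4; ring.
Qed.

Lemma moment_gt0 x : W x -> 0 < \sum_i moment i x ^+ 2.
Proof.
move=> Wx; have x0 := W0 Wx; have Sx := retr_S3 x0.
rewrite lt_def sumr_ge0 ?andbT; last by move=> i _; exact: sqr_ge0.
apply/negP => /eqP/psumr_eq0P h.
have m0 i : moment i (retr x) = 0.
  by rewrite moment_retr; apply/eqP; rewrite -sqrf_eq0 h // => j _; exact: sqr_ge0.
have := moment_killf Sx; rewrite /killf !mxE !m0 !scale0r !addr0 => hc.
have := berger_frame eps_gt0 (v1 (retr x)) (v2 (retr x)) (v3 (retr x)) (v1 (retr x)) (v2 (retr x)) (v3 (retr x)) Sx.
have Wr : W (retr x) by case: Wx => _ Ux; split; [exact: S3_neq0|rewrite retr_idem].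
have d0 w : dot (0 : R4) w = 0 by rewrite dotE !mxE !mul0r !addr0.
rewrite -hc bergerE // !d0 !(mul0r, mulr0, subr0, addr0) -!expr2 (good_unit gW Wr) => /eqP.
by rewrite eq_sym oner_eq0.
Qed.

Lemma local_killing p : S3 p -> U p -> exists (k : R4) (U' : set R4),
  [/\ open U', U' p, U' `<=` U & forall q, S3 q -> U' q -> exists2 c : R, c != 0 &
    killf k q = c *: comb (v1 q) (v2 q) (v3 q) q].
Proof.
move=> Sp Up.
have Wp : W p by split; [exact: S3_neq0|rewrite retr_id].
have [d d0 hd] := direction_cst oW Wp smooth_moment moment_gt0 moment_derive.
exists (\row_i moment i p), (ball p d `&` U); split.
- by apply: openI => //; exact: ball_open.
- by split => //; exact: ballxx.
- by move=> q [].
move=> q Sq [/hd[Wq [c c0 hc]] Uq]; exists c => //.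
by rewrite -moment_killf // /killf !mxE !hc !scalerDr !scalerA.
Qed.
End Local.

Lemma lamp_retr (v1 v2 v3 : R4 -> R) x :
  (forall y, v1 (retr y) = v1 y) -> (forall y, v2 (retr y) = v2 y) -> (forall y, v3 (retr y) = v3 y) ->
  lamp eps v1 v2 v3 (retr x) = lamp eps v1 v2 v3 x.
Proof.
move=> r1 r2 r3; have [->|x0] := eqVneq x 0; first by rewrite retr0.
rewrite /lamp /Lamf /lamf /kap2 /kap3 /twist /d1 /d2 /d3.
have h f := derive_field_homogeneous x0 (@linear_hopf R) (f := f).
have j f := derive_field_homogeneous x0 (@linear_jfield R) (f := f).
have k f := derive_field_homogeneous x0 (@linear_kfield R) (f := f).
by rewrite (h _ r2) (h _ r3) (j _ r1) (j _ r2) (j _ r3) (k _ r1) (k _ r2) (k _ r3) r1 r2 r3.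
Qed.

Lemma frame_comb_neq0 q a b c : S3 q -> a ^+ 2 + b ^+ 2 + c ^+ 2 = 1 -> comb a b c q != 0.
Proof.
move=> Sq u; apply/negP => /eqP h; have := berger_frame eps_gt0 a b c a b c Sq.
have d0 w : dot (0 : R4) w = 0 by rewrite dotE !mxE !mul0r !addr0.
rewrite h bergerE // !d0 !(mul0r, mulr0, subr0, addr0) -!expr2 u => /eqP.
by rewrite eq_sym oner_eq0.
Qed.

Theorem metric_foliation_locally_killing (TF : R4 -> set R4) p : metric_foliation eps TF ->
  S3 p -> exists (k : R4) (U : set R4), [/\ open U, U p &
    forall q, S3 q -> U q -> killf k q != 0 /\ TF q = [set r *: killf k q | r in setT]].
Proof.
move=> TFm Sp.
have [U [v1 [v2 [v3 [oU Up gW [r1 r2 r3] TFE]]]]] := metric_good eps_gt0 TFm Sp.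
have [k [U' [oU' U'p sub hk]]] :=
  local_killing oU gW r1 r2 r3 (fun x => lamp_retr x r1 r2 r3) Sp Up.
exists k, U'; split=> // q Sq U'q; have [c c0 kq] := hk q Sq U'q.
have Wq : cone U q by split; [exact: S3_neq0|rewrite retr_id //; exact: sub].
have n0 := frame_comb_neq0 Sq (good_unit gW Wq).
rewrite kq scaler_eq0 negb_or c0 n0; split=> //; rewrite TFE //; last exact: sub.
apply/seteqP; split=> y [t _ <-].
  by exists (t / c) => //; rewrite scalerA divfK.
by exists (t * c) => //; rewrite scalerA.
Qed.
End LocalKilling.

(** * From local to global Killing fields *)

Section Unique.
Variable R : realType.
Local Notation R4 := 'rV[R]_4.
Implicit Types k x p q : R4.

Definition wedge k k' x (i j : 'I_4) : R := killf k x 0 i * killf k' x 0 j - killf k x 0 j * killf k' x 0 i.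

Lemma killf_lin k x y (t : R) : killf k (t *: y + x) = t *: killf k y + killf k x.
Proof.
by rewrite /killf linear_rfield1 linear_rfield2 linear_rfield3 linear_hopf !scalerDr !scalerA
  ![_ * t]mulrC -!scalerA; apply: row4P; rewrite !mxE4; ring.
Qed.

Lemma killfZ k x (t : R) : killf k (t *: x) = t *: killf k x.
Proof.
have z : killf k 0 = 0.
  by apply: row4P; rewrite /killf /rfield1 /rfield2 /rfield3 !mxE4 hopfE !row4E !mxE; ring.
by rewrite -[t *: x]addr0 killf_lin z addr0.
Qed.

(* The second difference of a quadratic form recovers it from its values near [p]. *)
Lemma wedge_eq0 k k' (W : set R4) p : open W -> W p -> (forall x, W x -> forall i j, wedge k k' x i j = 0) ->
  forall x i j, wedge k k' x i j = 0.
Proof.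
move=> oW Wp h y i j.
have [d d0 hd] := small_comb y 0 (open_nbhs_nbhs (conj oW Wp)).
have hW (s : R) : `|s| <= d -> wedge k k' (s *: y + p) i j = 0.
  by move=> sd; apply: h; have := hd s 0 sd; rewrite scale0r add0r; apply; rewrite normr0 ltW.
have e0 := hW 0; have e1 := hW d; have e2 := hW (- d).
rewrite normr0 normrN gtr0_norm // in e0 e1 e2.
move: (e0 (ltW d0)) (e1 (lexx _)) (e2 (lexx _)); rewrite /wedge !killf_lin.
move: (killf k p) (killf k' p) (killf k y) (killf k' y) => P P' K K'; rewrite !mxE4.
move: (P 0 i) (P 0 j) (P' 0 i) (P' 0 j) (K 0 i) (K 0 j) (K' 0 i) (K' 0 j).
move=> a b a' b' c c1 c' c1' {}e0 {}e1 {}e2.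
apply: (mulfI (x := 2 * d ^+ 2)); first by rewrite mulf_neq0 ?pnatr_eq0 // expf_neq0 // gt_eqF.
rewrite mulr0.
transitivity (((d * c + a) * (d * c1' + b') - (d * c1 + b) * (d * c' + a'))
  + ((- d * c + a) * (- d * c1' + b') - (- d * c1 + b) * (- d * c' + a'))
  - 2 * ((0 * c + a) * (0 * c1' + b') - (0 * c1 + b) * (0 * c' + a'))); first by ring.
by rewrite e0 e1 e2; ring.
Qed.

(** At a single point [x] the map taking [k] to [killf k x] has a kernel, so the minors are
    collected from the three points (1, 0), (0, 1) and (1, 1) of C^2. *)
Lemma wedge_parallel k k' : (forall x i j, wedge k k' x i j = 0) ->
  forall i j, k 0 i * k' 0 j = k 0 j * k' 0 i.
Proof.
move=> h.
pose a := k 0 0; pose b := k 0 1; pose c := k 0 2%:R; pose d := k 0 3%:R.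
pose a' := k' 0 0; pose b' := k' 0 1; pose c' := k' 0 2%:R; pose d' := k' 0 3%:R.
have W0 := h (row4 1 0 0 0); have W2 := h (row4 0 0 1 0); have W3 := h (row4 1 0 1 0).
rewrite /wedge /killf /rfield1 /rfield2 /rfield3 in W0 W2 W3.
have e1 := W0 1 2%:R; have e2 := W0 1 3%:R; have e3 := W0 2%:R 3%:R.
have f1 := W2 0 1; have f2 := W2 0 3%:R; have f3 := W2 1 3%:R; have g := W3 1 3%:R.
rewrite !mxE4 !hopfE !row4E -/a -/b -/c -/d -/a' -/b' -/c' -/d' in e1 e2 e3 f1 f2 f3 g.
have two : (2 : R) != 0 by rewrite pnatr_eq0.
have ab : a * b' = b * a' by apply: (mulfI two); lra.
have ac : a * c' = c * a' by apply: (mulfI two); lra.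
have bc : b * c' = c * b' by apply: (mulfI two); lra.
have db : d * b' = b * d' by apply: (mulfI two); lra.
have dc : d * c' = c * d' by apply: (mulfI two); lra.
have ad : a * d' = d * a' by apply: (mulfI two); lra.
apply: ord4P; apply: ord4P; rewrite -/a -/b -/c -/d -/a' -/b' -/c' -/d' //; lra.
Qed.

Lemma parallel_coef k k' : k' != 0 -> (forall i j, k 0 i * k' 0 j = k 0 j * k' 0 i) ->
  exists c : R, k = c *: k'.
Proof.
move=> k0 h; have : exists i, k' 0 i != 0.
  apply/existsP; rewrite -negb_forall; apply: contra k0 => /forallP h0.
  by apply/eqP/rowP => i; rewrite mxE; apply/eqP.
move=> [i ki]; exists (k 0 i / k' 0 i); apply/rowP => j; rewrite mxE4.
by apply: (mulIf ki); rewrite h mulrAC divfK.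
Qed.
End Unique.

Lemma sqr_eq_sub1 (R : realFieldType) (t : R) : t ^+ 2 = (t - 1) ^+ 2 -> t = 2^-1 /\ t - 1 = - 2^-1.
Proof. by move=> h; split; apply: (@mulfI _ 2); rewrite ?pnatr_eq0 // ?mulrN divff ?pnatr_eq0 //; lra. Qed.

Section Global.
Variables (R : realType).
Local Notation R4 := 'rV[R]_4.
Variable TF : R4 -> set R4.

Definition killing_at (k p : R4) : Prop := exists U : set R4, [/\ open U, U p &
  forall q, S3 q -> U q -> killf k q != 0 /\ TF q = [set r *: killf k q | r in setT]].

Lemma killf0 (x : R4) : killf 0 x = 0.
Proof. by rewrite /killf !mxE !scale0r !addr0. Qed.

Lemma killing_at_neq0 k p : S3 p -> killing_at k p -> k != 0.
Proof.
move=> Sp [U [_ Up h]]; have [n0 _] := h p Sp Up.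
by apply: contraNneq n0 => ->; rewrite killf0.
Qed.

Lemma killing_at_unique k k' p : S3 p -> killing_at k p -> killing_at k' p ->
  exists c : R, k = c *: k'.
Proof.
move=> Sp hk hk'; have k'0 := killing_at_neq0 Sp hk'.
case: hk hk' => [U [oU Up h]] [U' [oU' U'p h']].
apply: parallel_coef k'0 _; apply: wedge_parallel.
have oW := open_cone (openI oU oU').
apply: (wedge_eq0 (p := p) oW); first by split; [exact: S3_neq0|rewrite retr_id].
move=> x [x0 [Ux U'x]] i j.
have Sx := retr_S3 x0; have [_ E] := h _ Sx Ux; have [n0 E'] := h' _ Sx U'x.
have : TF (retr x) (killf k (retr x)) by rewrite E; exists 1 => //; rewrite scale1r.
rewrite E' => -[r _ re].
pose a := Num.sqrt (dot x x).
have a0 : a != 0 by rewrite gt_eqF // sqrtr_gt0 dot_gt0.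
have xE : x = a *: retr x by rewrite /retr scalerA divff // scale1r.
have gen y b : x = b *: y -> killf k y = r *: killf k' y -> wedge k k' x i j = 0.
  by move=> -> e; rewrite /wedge !killfZ e; move: (killf k' y) => K; rewrite !mxE4; ring.
exact: gen xE (esym re).
Qed.

Hypothesis loc : forall p, S3 p -> exists k, killing_at k p.

(** A choice of a local Killing field at each point; only the line spanned by it is canonical. *)
Let kk p (Sp : S3 p) : R4 := sval (cid (loc Sp)).
Let kkP p (Sp : S3 p) : killing_at (kk Sp) p := svalP (cid (loc Sp)).

(* The orthogonal projection onto the line of [k] does not depend on the scale of [k],
   so it is locally constant, hence constant along paths. *)
Let proj (k : R4) (i j : 'I_4) : R := k 0 i * k 0 j / dot k k.

Let projZ k c i j : c != 0 -> proj (c *: k) i j = proj k i j.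
Proof.
move=> c0; rewrite /proj dotZl dotC dotZl !mxE4.
have [->|k0] := eqVneq k 0; first by rewrite !mxE !mulr0 !mul0r.
by have d0 := dot_gt0 k0; field; rewrite c0 gt_eqF.
Qed.

Let proj_parallel k k' : k != 0 -> (forall i j, proj k i j = proj k' i j) -> exists c : R, k = c *: k'.
Proof.
move=> k0 h; exists (dot k' k / dot k' k'); apply/rowP => i; rewrite mxE4.
transitivity (\sum_j proj k i j * k 0 j).
  transitivity (k 0 i / dot k k * dot k k); first by rewrite divfK // gt_eqF // dot_gt0.
  by rewrite {2}/dot mulr_sumr; apply: eq_bigr => j _; rewrite /proj; ring.
rewrite (eq_bigr (fun j => proj k' i j * k 0 j)); last by move=> j _; rewrite h.
by rewrite {1}/dot 2!mulr_suml; apply: eq_bigr => j _; rewrite /proj; ring.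
Qed.

Lemma killing_at_near k p : killing_at k p -> exists2 U : set R4, open U /\ U p &
  forall q, U q -> killing_at k q.
Proof. by move=> [U [oU Up h]]; exists U => // q Uq; exists U. Qed.

(** The radial projection of the line through [p] and [q] is a path on the sphere: by comparison of
    norms the line can meet the origin only at [t = 1/2], that is, for [q = - p]. Along the path the
    projection onto the line of [kk] has derivative zero. *)
Let same_line p q (Sp : S3 p) (Sq : S3 q) : q != p -> q != - p -> exists c : R, kk Sq = c *: kk Sp.
Proof.
move=> qp qNp.
have l0 (t : R) : t *: (q - p) + p != 0.
  apply/negP => /eqP h.
  have h' : t *: q = (t - 1) *: p.
    by apply/eqP; rewrite -subr_eq0 -[X in _ == X]h scalerBl scale1r scalerBr opprB addrA addrAC addrC.
  have : t ^+ 2 * dot q q = (t - 1) ^+ 2 * dot p p.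
    have dd (c : R) (u : R4) : dot (c *: u) (c *: u) = c ^+ 2 * dot u u.
      by rewrite dotZl dotC dotZl; ring.
    by rewrite -!dd h'.
  rewrite (Sp : dot p p = 1) (Sq : dot q q = 1) !mulr1 => /sqr_eq_sub1[t2 t1].
  move/eqP: qNp; apply; apply: (scalerI (a := t)); first by rewrite t2 invr_neq0 // pnatr_eq0.
  by rewrite h' t1 t2 scalerN scaleNr.
pose S t := retr_S3 (l0 t).
apply: proj_parallel => [|i j]; first exact: killing_at_neq0 Sq (kkP Sq).
pose f t := proj (kk (S t)) i j.
have df (t : R) : is_derive t 1 f 0.
  have [U [oU Ut] hU] := killing_at_near (kkP (S t)).
  have dc : is_derive t 1 (cst (f t) : R -> R) (0 : R) by exact: is_derive_cst.
  apply: near_eq_is_derive dc.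
  have ct : {for t, continuous (fun s : R => retr (s *: (q - p) + p))}.
    apply: continuous_comp; last exact: smooth_cont (@smooth_retr R) (l0 t).
    by apply: cvgD; [exact: scalel_continuous|exact: cvg_cst].
  have nU : \forall s \near t, U (retr (s *: (q - p) + p)) by apply: ct; exact: open_nbhs_nbhs.
  near=> s; rewrite /cst /f.
  have Us : U (retr (s *: (q - p) + p)) by near: s.
  have [c ec] := killing_at_unique (S s) (hU _ Us) (kkP (S s)).
  rewrite ec projZ //; apply/negP => /eqP c0.
  by have := killing_at_neq0 (S t) (kkP (S t)); rewrite ec c0 scale0r eqxx.
have ext k' x y (Sx : S3 x) (Sy : S3 y) : x = y -> proj (kk Sx) i j = k' -> proj (kk Sy) i j = k'.
  by move=> e; subst y; rewrite (Prop_irrelevance Sx Sy).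
apply: (ext _ _ _ (S 1)); first by rewrite scale1r subrK retr_id.
apply/esym; apply: (ext _ _ _ (S 0)); first by rewrite scale0r add0r retr_id.
exact: is_derive_0_is_cst df.
Unshelve. all: by end_near. Qed.

Theorem global_killing : exists k : R4, forall q, S3 q ->
  killf k q != 0 /\ TF q = [set r *: killf k q | r in setT].
Proof.
have S0 : S3 (row4 1 0 0 0 : R4) by rewrite /S3 /= dotE !row4E; ring.
(* Antipodal points are joined through [hopf p], which is orthogonal to both. *)
have any p q (Sp : S3 p) (Sq : S3 q) : exists c : R, kk Sq = c *: kk Sp.
  have Sh : S3 (hopf p) by rewrite /S3 /= -[RHS]Sp !dotE !hopfE !row4E; ring.
  have ph : dot p (hopf p) = 0 by rewrite !dotE !hopfE !row4E; ring.
  have [e|qp] := eqVneq q p.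
    by subst q; exists 1; rewrite scale1r (Prop_irrelevance Sp Sq).
  have [e|qNp] := eqVneq q (- p); last exact: same_line.
  have n1 : hopf p != p.
    by apply/eqP => h; have := (Sp : dot p p = 1); rewrite -{2}h ph => /eqP; rewrite eq_sym oner_eq0.
  have n2 : hopf p != - p.
    apply/eqP => h; have := (Sp : dot p p = 1); rewrite -{2}[p]opprK -h.
    by rewrite -scaleN1r dotC dotZl dotC ph mulr0 => /eqP; rewrite eq_sym oner_eq0.
  have [c1 e1] := same_line Sp Sh n1 n2.
  have [c2 e2] : exists c : R, kk Sq = c *: kk Sh.
    apply: same_line; rewrite e; apply/eqP => h.
      by move/eqP: n2; apply; rewrite h.
    by move/eqP: n1; apply; apply: oppr_inj; rewrite h.
  by exists (c2 * c1); rewrite e2 e1 scalerA.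
exists (kk S0) => q Sq.
have [U [oU Uq h]] := kkP Sq.
have [n0 E] := h q Sq Uq; have [c e] := any _ _ S0 Sq.
have kE : killf (kk Sq) q = c *: killf (kk S0) q.
  by rewrite e; apply: row4P; rewrite /killf !mxE4; ring.
rewrite kE scaler_eq0 negb_or in n0; have /andP[c0 k0] := n0.
split=> //; rewrite E kE; apply/seteqP; split=> y [t _ <-].
  by exists (t * c) => //; rewrite scalerA.
by exists (t / c) => //; rewrite scalerA divfK.
Qed.
End Global.

(** * The flow of a Killing field *)

Section Rotation.
Variable R : realType.
Local Notation R4 := 'rV[R]_4.

Definition rot (c s : R) (J : R4 -> R4) (x : R4) : R4 := c *: x + s *: J x.

Lemma linear0f (F : R4 -> R4) : linear F -> F 0 = 0.
Proof. by move=> lF; have := lF (-1) 0 0; rewrite scaler0 addr0 scaleN1r addNr. Qed.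
Lemma linearZf (F : R4 -> R4) a x : linear F -> F (a *: x) = a *: F x.
Proof. by move=> lF; rewrite -[a *: x]addr0 lF linear0f // addr0. Qed.
Lemma linearDf (F : R4 -> R4) x y : linear F -> F (x + y) = F x + F y.
Proof. by move=> lF; rewrite -[x]scale1r lF !scale1r. Qed.

Lemma linear_rot c s J : linear J -> linear (rot c s J).
Proof. by move=> lJ a u v; rewrite /rot lJ; apply: row4P; rewrite !mxE4; ring. Qed.

Lemma continuous_rot c s J : continuous J -> continuous (rot c s J).
Proof.
move=> cJ x.
have h1 : {for x, continuous (fun y : R4 => c *: y)} := @scaler_continuous _ _ c x.
have h2 : {for x, continuous (fun y : R4 => s *: J y)}.
  exact: (@continuous_comp _ _ _ J (fun y => s *: y) x (cJ x) (@scaler_continuous _ _ s (J x))).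
exact: (cvgD h1 h2).
Qed.

Lemma rot_rot c s c' s' J (b : R) x : linear J -> (forall y, J (J y) = - b *: y) ->
  rot c s J (rot c' s' J x) = rot (c * c' - b * (s * s')) (c * s' + s * c') J x.
Proof.
move=> lJ JJ; rewrite /rot (linearDf (c' *: x) (s' *: J x) lJ) (linearZf c' x lJ) (linearZf s' (J x) lJ) JJ.
by move: (J x) => Jx; apply: row4P; rewrite !mxE4; ring.
Qed.

Lemma rot_comm c s c' s' I J x : linear I -> linear J -> (forall y, I (J y) = J (I y)) ->
  rot c s I (rot c' s' J x) = rot c' s' J (rot c s I x).
Proof.
move=> lI lJ IJ; rewrite /rot (linearDf (c' *: x) (s' *: J x) lI) (linearDf (c *: x) (s *: I x) lJ)
  (linearZf c' x lI) (linearZf s' (J x) lI) (linearZf c x lJ) (linearZf s (I x) lJ) IJ.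
by move: (J (I x)) (I x) (J x) => r1 r2 r3; apply: row4P; rewrite !mxE4; ring.
Qed.

Lemma dot_rot c s J (b : R) x y : (forall u v, dot (J u) v = - dot u (J v)) ->
  (forall u v, dot (J u) (J v) = b * dot u v) -> c ^+ 2 + b * s ^+ 2 = 1 ->
  dot (rot c s J x) (rot c s J y) = dot x y.
Proof.
move=> Js Jb e.
have Dr (u v w : R4) : dot u (v + w) = dot u v + dot u w by rewrite dotC dotDl !(dotC u).
have Zr (a : R) (u v : R4) : dot u (a *: v) = a * dot u v by rewrite dotC dotZl dotC.
rewrite /rot dotDl !Dr !dotZl !Zr Jb Js -[RHS]mul1r -e.
by move: (dot x (J y)) (dot x y) => r1 r2; ring.
Qed.

Section KillingFlow.
Variable k : R4.
Local Notation a1 := (k 0 0).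
Local Notation a2 := (k 0 1).
Local Notation a3 := (k 0 2%:R).
Local Notation b := (k 0 3%:R).

(* The left- and right-invariant parts of [killf k] commute, and each squares to
   a negative scalar, so their flows are rotations and commute. *)
Definition lpart (x : R4) : R4 := a1 *: rfield1 x + a2 *: rfield2 x + a3 *: rfield3 x.
Definition speed : R := Num.sqrt (a1 ^+ 2 + a2 ^+ 2 + a3 ^+ 2).
(** The inner factor is the exponential of [t *: lpart]. If [speed = 0] then [lpart] vanishes, and
    with [0^-1 = 0] the factor is the identity. *)
Definition kflow (t : R) (x : R4) : R4 :=
  rot (cos (b * t)) (sin (b * t)) (@hopf R)
    (rot (cos (speed * t)) (speed^-1 * sin (speed * t)) lpart x).

Lemma speed2 : speed ^+ 2 = a1 ^+ 2 + a2 ^+ 2 + a3 ^+ 2.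
Proof. by rewrite sqr_sqrtr // !addr_ge0 ?sqr_ge0. Qed.

Lemma linear_lpart : linear lpart.
Proof.
move=> a u v; rewrite /lpart linear_rfield1 linear_rfield2 linear_rfield3.
move: (rfield1 u) (rfield2 u) (rfield3 u) (rfield1 v) (rfield2 v) (rfield3 v) => r1 r2 r3 s1 s2 s3.
by apply: row4P; rewrite !mxE4; ring.
Qed.

Lemma continuous_lpart : continuous lpart.
Proof.
have c (a : R) (F : R4 -> R4) : continuous F -> continuous (fun x => a *: F x).
  by move=> cF x; exact: (@continuous_comp _ _ _ F (fun y => a *: y) x (cF x) (@scaler_continuous _ _ a (F x))).
move=> x; exact: (cvgD (cvgD (c a1 _ (@continuous_rfield1 R) x) (c a2 _ (@continuous_rfield2 R) x))
  (c a3 _ (@continuous_rfield3 R) x)).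
Qed.

Lemma killfE x : killf k x = lpart x + b *: hopf x. Proof. by []. Qed.

Lemma lpart_lpart x : lpart (lpart x) = - speed ^+ 2 *: x.
Proof.
by rewrite speed2; apply: row4P; rewrite /lpart /rfield1 /rfield2 /rfield3 !(mxE4, row4E); ring.
Qed.

Lemma hopf_hopf (x : R4) : hopf (hopf x) = - 1 *: x.
Proof. by apply: row4P; rewrite !hopfE !mxE4 !row4E; ring. Qed.

Lemma hopf_lpart x : hopf (lpart x) = lpart (hopf x).
Proof. by apply: row4P; rewrite /lpart /rfield1 /rfield2 /rfield3 !hopfE !(mxE4, row4E); ring. Qed.

Lemma lpart_skew u v : dot (lpart u) v = - dot u (lpart v).
Proof. by rewrite !dotE /lpart !mxE4 /rfield1 /rfield2 /rfield3 !row4E; ring. Qed.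

Lemma lpart_dot u v : dot (lpart u) (lpart v) = speed ^+ 2 * dot u v.
Proof.
by rewrite lpart_skew lpart_lpart dotC dotZl dotC mulNr opprK.
Qed.

Lemma hopf_skew (u v : R4) : dot (hopf u) v = - dot u (hopf v).
Proof. by rewrite !dotE !hopfE !row4E; ring. Qed.
Lemma hopf_dot (u v : R4) : dot (hopf u) (hopf v) = 1 * dot u v.
Proof. by rewrite !dotE !hopfE !row4E; ring. Qed.

(* Both sides vanish when [speed = 0]. *)
Lemma speed_sin t : speed * (speed^-1 * sin (speed * t)) = sin (speed * t).
Proof.
have [->|s0] := eqVneq speed 0; first by rewrite !mul0r sin0.
by rewrite mulVKf.
Qed.

Lemma lpart_speed x : speed^-1 * speed *: lpart x = lpart x.
Proof.
have [s0|s0] := eqVneq speed 0; last by rewrite mulVf // scale1r.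
have /eqP := speed2; rewrite s0 expr0n /= eq_sym !paddr_eq0 ?addr_ge0 ?sqr_ge0 // !sqrf_eq0.
by move=> /andP[/andP[/eqP h1 /eqP h2] /eqP h3]; rewrite /lpart h1 h2 h3 !scale0r !addr0 scaler0.
Qed.

Lemma linear_kflow t : linear (kflow t).
Proof.
move=> a u v; rewrite /kflow (linear_rot _ _ linear_lpart) (linear_rot _ _ (@linear_hopf R)) //.
Qed.

Lemma continuous_kflow t : continuous (kflow t).
Proof.
move=> x; apply: continuous_comp; apply: continuous_rot.
  exact: continuous_lpart.
exact: continuous_hopf.
Qed.

Lemma kflow_dot t x y : dot (kflow t x) (kflow t y) = dot x y.
Proof.
rewrite /kflow (dot_rot _ _ hopf_skew hopf_dot); last by rewrite mul1r cos2Dsin2.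
apply: (dot_rot _ _ lpart_skew lpart_dot).
by rewrite -exprMn speed_sin cos2Dsin2.
Qed.

Lemma kflow_hopf t x : kflow t (hopf x) = hopf (kflow t x).
Proof.
have e (y : R4) : hopf y = rot 0 1 (@hopf R) y by rewrite /rot scale0r add0r scale1r.
rewrite /kflow e (rot_comm _ _ _ _ _ linear_lpart (@linear_hopf R)); last by move=> y; rewrite hopf_lpart.
rewrite (rot_rot _ _ _ _ _ (@linear_hopf R) hopf_hopf) [RHS]e.
rewrite (rot_rot _ _ _ _ _ (@linear_hopf R) hopf_hopf); congr (rot _ _ _ _); ring.
Qed.

Lemma kflow_S3 t p : S3 p -> S3 (kflow t p).
Proof. by rewrite /S3 /= kflow_dot. Qed.

Lemma kflow0 p : kflow 0 p = p.
Proof. by rewrite /kflow /rot !mulr0 cos0 sin0 !mulr0 !scale0r !addr0 !scale1r. Qed.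

Lemma kflowD s t p : kflow (s + t) p = kflow s (kflow t p).
Proof.
rewrite /kflow (rot_comm _ _ _ _ _ linear_lpart (@linear_hopf R)); last by move=> y; rewrite hopf_lpart.
rewrite (rot_rot _ _ _ _ _ linear_lpart lpart_lpart) (rot_rot _ _ _ _ _ (@linear_hopf R) hopf_hopf).
rewrite !mulrDr !cosD !sinD.
have e : speed ^+ 2 * (speed^-1 * sin (speed * s) * (speed^-1 * sin (speed * t)))
    = sin (speed * s) * sin (speed * t).
  by rewrite -(speed_sin s) -(speed_sin t) !speed_sin; rewrite -[in RHS](speed_sin s) -[in RHS](speed_sin t); ring.
by congr (rot _ _ _ (rot _ _ _ _)); rewrite ?e; ring.
Qed.

(** By [bergerE] the metric is built from [dot] and [hopf], and the linear map [kflow k t] preserves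
    the one and commutes with the other. *)
Lemma kflow_isometry (eps : R) t : preserves_metric eps (kflow t).
Proof.
move=> p u v Sp tu tv.
have d w : tangent p w -> dS3 (kflow t) p w = kflow t w.
  move=> tw; rewrite /dS3.
  have dr : derivable (@retr R) p w by exact: smooth_derivable (@smooth_retr R) (S3_neq0 Sp).
  have [_ ->] := is_derive_linear (linear_kflow t) (@continuous_kflow t) dr.
  by rewrite derive_retr.
by rewrite !d // !bergerE //; [rewrite -kflow_hopf !kflow_dot|exact: kflow_S3].
Qed.
End KillingFlow.
End Rotation.

(** * Smoothness of the flow and its derivative along curves *)

Section Curves.
Variable R : realType.
Local Notation R4 := 'rV[R]_4.

Lemma rot_self c s (J : R4 -> R4) x : linear J -> J (rot c s J x) = rot c s J (J x).
Proof. by move=> lJ; rewrite /rot (linearDf _ _ lJ) !(linearZf _ _ lJ). Qed.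

Lemma is_derive_row (V : normedModType R) n (f : V -> 'rV[R]_n) x v (df : 'rV[R]_n) :
  (forall i, is_derive x v (fun y => f y 0 i) (df 0 i)) -> is_derive x v f df.
Proof.
move=> h; have d : derivable f x v.
  by apply/derivable_mxP => i j; rewrite (ord1 i); have [] := h j.
split=> //; apply/rowP => i; rewrite derive_coord //; by have [] := h i.
Qed.

Lemma is_derive_scale n (a : R -> R) (g : R -> 'rV[R]_n) (t da : R) dg :
  is_derive t 1 a da -> is_derive t 1 g dg ->
  is_derive t 1 (fun u => a u *: g u) (da *: g t + a t *: dg).
Proof.
move=> [a1 a2] [g1 g2]; apply: is_derive_row => i.
have gi1 : derivable (fun y => g y 0 i) t 1.
  by move/derivable_mxP : g1; apply.
have gi2 : 'D_1 (fun y => g y 0 i) t = dg 0 i by rewrite -g2 derive_coord.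
have e : (fun y : R => (a y *: g y) 0 i) = (fun y => a y * g y 0 i).
  by apply/funext => y; rewrite mxE.
rewrite e; split; first exact: (derivableM a1 gi1).
rewrite (deriveMf a1 gi1) a2 gi2 !mxE; ring.
Qed.

Lemma is_derive_rot (c s : R -> R) (J : R4 -> R4) (g : R -> R4) (t dc ds : R) dg :
  linear J -> continuous J ->
  is_derive t 1 c dc -> is_derive t 1 s ds -> is_derive t 1 g dg ->
  is_derive t 1 (fun u => rot (c u) (s u) J (g u))
    (rot dc ds J (g t) + rot (c t) (s t) J dg).
Proof.
move=> lJ cJ hc hs hg.
have hJ : is_derive t 1 (J \o g) (J dg).
  have [g1 g2] := hg.
  by have [h1 h2] := is_derive_linear lJ cJ g1; split=> //; rewrite h2 g2.
have h1 := is_derive_scale hc hg; have h2 := is_derive_scale hs hJ.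
have h3 := is_deriveD h1 h2.
apply: (@is_derive_eq _ _ _ _ _ _ _ _ h3).
by rewrite /rot addrACA.
Qed.

(** The product rule for the exponential of a multiple of [J] applied to a curve, where [q] is the
    rate of change of that multiple. The condition on [ds] is required only after multiplication by
    [J x], which covers [J = 0] with [speed = 0], where [ds] vanishes. *)
Lemma is_derive_osc (c s : R -> R) (J : R4 -> R4) (g : R -> R4) (t dc ds q m : R) dg :
  linear J -> continuous J -> (forall x, J (J x) = - m *: x) ->
  dc = - m * s t * q -> (forall x, ds *: J x = c t * q *: J x) ->
  is_derive t 1 c dc -> is_derive t 1 s ds -> is_derive t 1 g dg ->
  is_derive t 1 (fun u => rot (c u) (s u) J (g u))
    (q *: J (rot (c t) (s t) J (g t)) + rot (c t) (s t) J dg).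
Proof.
move=> lJ cJ JJ edc eds hc hs hg.
have h := is_derive_rot lJ cJ hc hs hg.
apply: (@is_derive_eq _ _ _ _ _ _ _ _ h); congr (_ + _).
rewrite /rot eds edc (linearDf (c t *: g t) (s t *: J (g t)) lJ) (linearZf (c t) (g t) lJ).
rewrite (linearZf (s t) (J (g t)) lJ) JJ.
move: (J (g t)) (g t) (c t) (s t) => y x a e {hc hs hg h edc eds}.
by apply: row4P; rewrite !mxE4; ring.
Qed.

Lemma smooth_rot (V : normedModType R) (U : set V) (c s : V -> R) (J : R4 -> R4) (g : V -> R4) :
  open U -> linear J -> continuous J -> smooth_on U c -> smooth_on U s -> smooth_on U g ->
  smooth_on U (fun u => rot (c u) (s u) J (g u)).
Proof.
move=> oU lJ cJ sc ss sg; apply: (smooth_row oU) => i.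
have sJ := smooth_linear oU lJ cJ sg.
apply: (smooth_ext oU) (smooth_add oU (smooth_mul oU sc (smooth_coord oU i sg))
   (smooth_mul oU ss (smooth_coord oU i sJ))).
by move=> x _; rewrite /rot mxD4 !mxZ4.
Qed.

Lemma is_derive_cosM (b : R) (f : R -> R) (t df : R) : is_derive t 1 f df ->
  is_derive t 1 (fun u => cos (b * f u)) (- (b * df * sin (b * f t))).
Proof.
move=> hf; have h : is_derive t 1 (fun u => b * f u) (b * df) := is_deriveZ b hf.
have [h1 h2] := h.
have := @is_derive_comp R R^o (@cos R) (fun u => b * f u) t 1 _ (is_derive_cos _) h1.
by rewrite h2 mulNr mulrC.
Qed.

Lemma is_derive_sinM (b : R) (f : R -> R) (t df : R) : is_derive t 1 f df ->
  is_derive t 1 (fun u => sin (b * f u)) (b * df * cos (b * f t)).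
Proof.
move=> hf; have h : is_derive t 1 (fun u => b * f u) (b * df) := is_deriveZ b hf.
have [h1 h2] := h.
have := @is_derive_comp R R^o (@sin R) (fun u => b * f u) t 1 _ (is_derive_sin _) h1.
by rewrite h2 mulrC.
Qed.

Section KillingFlowCurve.
Variable k : R4.

Lemma kflow_lpart t x : kflow k t (lpart k x) = lpart k (kflow k t x).
Proof.
have lJ : forall y, hopf (lpart k y) = lpart k (hopf y) by exact: hopf_lpart.
rewrite /kflow -(rot_self _ _ _ (linear_lpart k)); set y := rot _ _ (lpart k) x.
have ll := linear_lpart k; move: (lpart k) ll lJ y => J ll lJ y.
by rewrite /rot (linearDf _ _ ll) !(linearZf _ _ ll) lJ.
Qed.

Lemma linear_killf : linear (killf k).
Proof.
move=> a u v; rewrite !killfE (linear_lpart k) (@linear_hopf R).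
move: (lpart k u) (lpart k v) (hopf u) (hopf v) => r1 r2 r3 r4.
by apply: row4P; rewrite !mxE4; ring.
Qed.

Lemma continuous_killf : continuous (killf k).
Proof.
move=> x; exact: (cvgD (@continuous_lpart R k x)
  (@continuous_comp _ _ _ (@hopf R) (fun y => k 0 3%:R *: y) x (@continuous_hopf R x)
     (@scaler_continuous _ _ (k 0 3%:R) (hopf x)))).
Qed.

Lemma killf_kflow t x : kflow k t (killf k x) = killf k (kflow k t x).
Proof.
rewrite !killfE (linearDf _ _ (linear_kflow k t)) (linearZf _ _ (linear_kflow k t)).
by rewrite kflow_lpart kflow_hopf.
Qed.

Lemma is_derive_kflow (f : R -> R) (g : R -> R4) (t df : R) dg :
  is_derive t 1 f df -> is_derive t 1 g dg ->
  is_derive t 1 (fun u => kflow k (f u) (g u))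
    (df *: killf k (kflow k (f t) (g t)) + kflow k (f t) dg).
Proof.
move=> hf hg.
have hs : is_derive t 1 (fun u => (speed k)^-1 * sin (speed k * f u))
    ((speed k)^-1 * (speed k * df * cos (speed k * f t))) := is_deriveZ _ (is_derive_sinM (speed k) hf).
have h1 : is_derive t 1 (fun u => rot (cos (speed k * f u)) ((speed k)^-1 * sin (speed k * f u)) (lpart k) (g u))
    (df *: lpart k (rot (cos (speed k * f t)) ((speed k)^-1 * sin (speed k * f t)) (lpart k) (g t))
     + rot (cos (speed k * f t)) ((speed k)^-1 * sin (speed k * f t)) (lpart k) dg).
  refine (is_derive_osc (c := fun u => cos (speed k * f u)) (s := fun u => (speed k)^-1 * sin (speed k * f u))
    (q := df) (linear_lpart k) (@continuous_lpart R k) (lpart_lpart k) _ _ (is_derive_cosM (speed k) hf) hs hg).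
    by rewrite -[in LHS](speed_sin k (f t)); ring.
  move=> x; rewrite -[in RHS](lpart_speed k x) scalerA; congr (_ *: _); ring.
have h2 := is_derive_osc (q := df * k 0 3%:R) (@linear_hopf R) (@continuous_hopf R) (@hopf_hopf R) _ _
  (is_derive_cosM (k 0 3%:R) hf) (is_derive_sinM (k 0 3%:R) hf) h1.
have {h2} h2 := h2 ltac:(ring) ltac:(by move=> x; congr (_ *: _); ring).
apply: (@is_derive_eq _ _ _ _ _ _ _ _ h2).
set y := rot _ _ (lpart k) (g t).
have lr := linear_rot (cos (k 0 3%:R * f t)) (sin (k 0 3%:R * f t)) (@linear_hopf R).
rewrite (linearDf (df *: lpart k y) _ lr) (linearZf df (lpart k y) lr) addrA; congr (_ + _).
have e : kflow k (f t) (lpart k (g t)) =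
    rot (cos (k 0 3%:R * f t)) (sin (k 0 3%:R * f t)) (@hopf R) (lpart k y).
  rewrite /kflow /y; apply: (congr1 (rot (cos (k 0 3%:R * f t)) (sin (k 0 3%:R * f t)) (@hopf R))).
  exact/esym/rot_self/linear_lpart.
rewrite killfE -kflow_lpart e.
by rewrite -[rot _ _ _ y]/(kflow k (f t) (g t)) [RHS]scalerDr [in RHS]scalerA [RHS]addrC.
Qed.

Lemma smooth_kflow (V : normedModType R) (U : set V) (f : V -> R) (g : V -> R4) :
  open U -> smooth_on U f -> smooth_on U g -> smooth_on U (fun u => kflow k (f u) (g u)).
Proof.
move=> oU sf sg.
have sM (a : R) : smooth_on U (fun u => a * f u) := smooth_mul oU (smooth_cst oU a) sf.
apply: (smooth_rot oU (@linear_hopf R) (@continuous_hopf R) (smooth_cos oU (sM _)) (smooth_sin oU (sM _))).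
exact: (smooth_rot oU (linear_lpart k) (@continuous_lpart R k) (smooth_cos oU (sM _))
  (smooth_mul oU (smooth_cst oU _) (smooth_sin oU (sM _))) sg).
Qed.

Lemma kflow_isometric_flow (eps : R) : isometric_flow eps (kflow k).
Proof.
split.
- by move=> t p; exact: kflow_S3.
- by move=> p _; exact: kflow0.
- by move=> s t p _; exact: kflowD.
- set U := [set tx : R * R4 | _].
  have oU : open U.
    apply: (@open_comp _ _ (snd : R * R4 -> R4) [set x | x != 0]); last exact: open_punctured.
    by move=> x _; exact: cvg_snd.
  have sid := smooth_id oU.
  have sfst : smooth_on U (fst : R * R4 -> R).
    exact: (smooth_linear oU (L := fst : R * R4 -> R) _ (fun x => cvg_fst) sid).
  have ssnd : smooth_on U (snd : R * R4 -> R4).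
    exact: (smooth_linear oU (L := snd : R * R4 -> R4) _ (fun x => cvg_snd) sid).
  apply: (smooth_kflow oU sfst).
  apply: (smooth_row oU) => i.
  apply: (smooth_ext oU) (smooth_mul oU (smooth_rsqrt oU _ (smooth_dot oU ssnd ssnd)) (smooth_coord oU i ssnd)).
    by move=> x _; rewrite /retr mxE.
  by move=> x; exact: dot_gt0.
- by move=> t; exact: kflow_isometry.
Qed.
End KillingFlowCurve.
End Curves.

(** * Leaves and orbits *)

Section Leaves.
Variable R : realType.
Local Notation R4 := 'rV[R]_4.

Lemma antiderivative (f : R -> R) (a b s t : R) : a < s -> s <= t -> t < b ->
  (forall u, a < u < b -> {for u, continuous f}) ->
  exists F : R -> R, forall u : R, s <= u <= t -> is_derive u 1 F (f u).
Proof.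
move=> as_ st tb cf.
(* The fundamental theorem of calculus differentiates the integral at interior points, so the
   interval is enlarged to have [s] and [t] in its interior. *)
pose a' := (a + s) / 2; pose b' := (t + b) / 2.
have [a1 a2 b1 b2] : [/\ a < a', a' < s, t < b' & b' < b].
  by rewrite /a' /b'; split; lra.
clearbody a' b'.
have intf : (@lebesgue_measure R).-integrable `[a', b'] (EFin \o f).
  apply: continuous_compact_integrable; first exact: segment_compact.
  apply: continuous_in_subspaceT => u; rewrite inE /= in_itv /= => /andP[u1 u2].
  by apply: cf; rewrite (lt_le_trans a1 u1) (le_lt_trans u2 b2).
exists (fun x => \int[lebesgue_measure]_(u in `[a', x]) f u)%R => u /andP[u1 u2].
have a'u : a' < u by apply: lt_le_trans u1.
have ub : u < b' by apply: le_lt_trans b1.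
have cu : {for u, continuous f} by apply: cf; rewrite (lt_trans a1 a'u) (lt_trans ub b2).
have [h1 h2] := @continuous_FTC1_closed R f a' u b' ub intf a'u cu.
split; first exact: h1.
rewrite -derive1E; exact: h2.
Qed.

Lemma derive_zero_cst n (h : R -> 'rV[R]_n) (s t : R) : s <= t ->
  (forall u : R, s <= u <= t -> is_derive u 1 h 0) -> h s = h t.
Proof.
move=> st dh; apply/rowP => i.
have dhi (u : R) : s <= u <= t -> is_derive u 1 (fun y => h y 0 i) (0 : R).
  move=> /dh[h1 h2]; have hi : derivable (fun y => h y 0 i) u 1.
    by move/derivable_mxP : h1; apply.
  by split=> //; rewrite -derive_coord // h2 mxE.
have [] := @MVT_segment R (fun y => h y 0 i) (fun=> 0) s t st.
- by move=> u; rewrite in_itv /= => /andP[/ltW u1 /ltW u2]; apply: dhi; rewrite u1.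
- apply: continuous_in_subspaceT => u; rewrite inE /= in_itv /= => /dhi[d _].
  by apply: differentiable_continuous; apply/derivable1_diffP.
- by move=> c _; rewrite mul0r => /eqP; rewrite subr_eq0 => /eqP.
Qed.

Section KillingLeaves.
Variables (TF : R4 -> set R4) (k : R4).
Hypothesis TFk : forall q, S3 q -> killf k q != 0 /\ TF q = [set r *: killf k q | r in setT].

Lemma orbit_leaf p T : S3 p -> leaf TF p (kflow k T p).
Proof.
move=> Sp; exists (- `|T| - 1), (`|T| + 1), (fun u => kflow k u p).
have n0 := normr_ge0 T; have [t1 t2] : - `|T| <= T /\ T <= `|T| by rewrite lerNl ler_norm -normrN ler_norm.
split.
- by apply: smooth_kflow; [exact: interval_open|exact: smooth_id|exact: smooth_cst].
- move=> t _; have St := kflow_S3 k t Sp; split=> //.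
  have [_ ->] := TFk St; exists 1 => //.
  have [_ e] := is_derive_kflow k (is_derive_id t (1 : R)) (is_derive_cst p t (1 : R)).
  rewrite derive1E e; have := linear0f (linear_kflow k t).
  by rewrite /= => ->; rewrite addr0.
- exists 0, T; rewrite kflow0; split=> //; apply/andP; split; move: t1 t2 n0; move: `|T| => m; lra.
Qed.

(** The velocity of [c] is [f] times the Killing field, and [f], being a quotient of inner products,
    is continuous and has an antiderivative [F]. Undoing the flow for time [F u] makes the curve
    constant, because the flow preserves its generating field. *)
Lemma integral_curve (c : R -> R4) (a b s t : R) : smooth_on `]a, b[ c ->
  (forall u, a < u < b -> S3 (c u) /\ TF (c u) (derive1 c u)) ->
  a < s -> s <= t -> t < b -> exists T, c t = kflow k T (c s).
Proof.
move=> sc tc as_ st tb.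
have oI : open (`]a, b[%classic : set R) by exact: interval_open.
pose v u := killf k (c u).
pose f (u : R) := dot ('D_1 c u) (v u) * (dot (v u) (v u))^-1.
have vn (u : R) : a < u < b -> v u != 0 by move=> /tc[Su _]; have [] := TFk Su.
have sv : smooth_on `]a, b[ v.
  exact: (smooth_linear oI (linear_killf k) (@continuous_killf R k) sc).
have sf : smooth_on `]a, b[ f.
  refine (smooth_mul oI (smooth_dot oI (smooth_derive (1 : R) sc) sv) (smooth_inv oI _ (smooth_dot oI sv sv))) => u; rewrite /= in_itv /= => /vn h.
  by rewrite gt_eqF // dot_gt0.
have [|F dF] := @antiderivative f a b s t as_ st tb.
  by move=> u uab; apply: (smooth_cont sf); rewrite /= in_itv.
have dc (u : R) : a < u < b -> is_derive u 1 c (f u *: v u).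
  move=> uab; split; first by refine (smooth_derivable sc _); rewrite /= in_itv.
  have [Su] := tc u uab; have [v0 ->] := TFk Su; rewrite derive1E => -[r _ e].
  rewrite /f -e dotZl mulfK // gt_eqF // dot_gt0 //.
have h0 : kflow k (- F s) (c s) = kflow k (- F t) (c t).
  apply: (@derive_zero_cst _ (fun u => kflow k (- F u) (c u)) s t st) => u ust.
  have /andP[u1 u2] := ust.
  have uab : a < u < b by rewrite (lt_le_trans as_ u1) (le_lt_trans u2 tb).
  have dN : is_derive u 1 (fun y => - F y) (- f u) := is_deriveN (dF u ust).
  apply: (@is_derive_eq _ _ _ _ _ _ _ _ (is_derive_kflow k dN (dc u uab))).
  rewrite (linearZf _ _ (linear_kflow k _)) killf_kflow.
  by rewrite scaleNr addNr.
exists (F t - F s).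
by rewrite kflowD h0 -kflowD subrr kflow0.
Qed.

Lemma leaf_orbit : orbit_foliation (kflow k) TF.
Proof.
move=> p Sp; apply/seteqP; split=> q; last by move=> [T _ <-]; exact: orbit_leaf.
move=> [a [b [c [sc tc [s [t [/andP[s1 s2] /andP[t1 t2] <- <-]]]]]]].
have [st|/ltW ts] := leP s t.
  by have [T ->] := integral_curve sc tc s1 st t2; exists T.
have [T ->] := integral_curve sc tc t1 ts s2; exists (- T) => //.
by rewrite -kflowD addNr kflow0.
Qed.
End KillingLeaves.

End Leaves.

Theorem corollary1p3 (R : realType) (eps : R) (eps_gt0 : 0 < eps)
    (eps_neq1 : eps <> 1) (TF : 'rV[R]_4 -> set 'rV[R]_4)
    (TF_metric : metric_foliation eps TF) :
  exists2 phi : R -> 'rV[R]_4 -> 'rV[R]_4,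
    isometric_flow eps phi & orbit_foliation phi TF.
Proof.
have [k TFk] : exists k : 'rV[R]_4, forall q, S3 q ->
    killf k q != 0 /\ TF q = [set r *: killf k q | r in setT].
  apply: global_killing => p Sp; apply: metric_foliation_locally_killing TF_metric Sp => //.
exists (kflow k); [exact: kflow_isometric_flow|exact: leaf_orbit].
Qed.
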